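(* Let $\psi_1$ and $\psi_2$ be approximating functions such that $\max\{\psi_1(q),\psi_2(q)\}\geqslant q^{-\eta}$ for some $\eta <1$. Let $\bm\theta\in\mathbb{R}^2$ and $f\in C^{(3)}(I)$. Let $h$ be a regular dimension function such that $r^{-1}h(r)\to \infty$ as $r\to 0$ and $r^{-1}h(r)$ is decreasing. Furthermore, assume that $\mathcal{H}^h(\{x\in I: f''(x)=0\})=0$. Then \[\mathcal{H}^h(\mathcal{C}_f \cap \mathcal{A}(\psi_1, \psi_2, \bm\theta))= \begin {cases} 0 \ &{\rm if } \quad\sum\limits_{q=1}^{\infty} q\cdot h\left(\frac{\min\{\psi_1(q),\psi_2(q)\}}{q}\right)\cdot\max\{\psi_1(q),\psi_2(q)\} < \infty \\[2ex] \infty \ & {\rm if } \quad\sum\limits_{q=1}^{\infty} q\cdot h\left(\frac{\min\{\psi_1(q),\psi_2(q)\}}{q}\right)\cdot\max\{\psi_1(q),\psi_2(q)\} = \infty. \end {cases}\]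
   Context: Approximating functions $\psi_1,\psi_2:\mathbb{N}\to\mathbb{R}^+$ are monotonic with $\psi_i(q)\to 0$ as $q\to\infty$. For fixed $\bm\theta=(\theta_1,\theta_2)\in\mathbb{R}^2$, $\mathcal{A}(\psi_1,\psi_2,\bm\theta)$ is the set of $\mathbf{x}=(x_1,x_2)\in\mathbb{R}^2$ such that $\|qx_1-\theta_1\|<\psi_1(q)$ and $\|qx_2-\theta_2\|<\psi_2(q)$ hold simultaneously for infinitely many $q\in\mathbb{N}$, where $\|\cdot\|$ is the distance to the nearest integer. $I$ is an interval of $\mathbb{R}$, $f:I\to\mathbb{R}$, and $\mathcal{C}_f=\{(x,f(x)):x\in I\}$. A dimension function is an increasing continuous $h:\mathbb{R}^+\to\mathbb{R}^+$ with $h(r)\to0$ as $r\to0$; it is regular if there exist constants $r_0,\lambda_1,\lambda_2\in(0,1)$ with $h(\lambda_1 r)\leqslant\lambda_2 h(r)$ for $r\in(0,r_0)$. $\mathcal{H}^h$ denotes the Hausdorff $h$-measure. *)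

(* Defs.v *)
From HB Require Import structures.
From mathcomp Require Import all_boot all_order all_algebra.
From mathcomp Require Import all_classical all_reals all_analysis.

Set Implicit Arguments.
Unset Strict Implicit.
Unset Printing Implicit Defensive.

Import Order.TTheory GRing.Theory Num.Theory.
Import numFieldNormedType.Exports.

Local Open Scope classical_set_scope.
Local Open Scope ring_scope.

Section Hausdorff_measure.
Context {R : realType} {X : Type}.
Implicit Types (d : X -> X -> R) (h : R -> R) (A U : set X).

(* diam d set0 = -oo, so the empty set may be used in any cover at cost 0. *)
Definition diam d U : \bar R :=
  ereal_sup [set (d p.1 p.2)%:E | p in U `*` U].

(* A dimension function lives on ]0, +oo[; this is its extension by h(0) = 0,
   needed because covering sets may have diameter 0. *)
Definition gauge h (r : R) : R := if 0 < r then h r else 0.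

(* Covers indexed by nat include the finite ones (pad with set0). *)
Definition delta_cover d (delta : R) A (U : nat -> set X) : Prop :=
  A `<=` \bigcup_i U i /\ (forall i, (diam d (U i) <= delta%:E)%E).

Definition hausdorff_content d h (delta : R) A : \bar R :=
  ereal_inf [set (\sum_(0 <= i <oo) (gauge h (fine (diam d (U i))))%:E)%E
            | U in delta_cover d delta A].

(* The contents increase as delta decreases, so this supremum is the limit of
   hausdorff_content d h delta A as delta tends to 0 from the right. *)
Definition hausdorff_measure d h A : \bar R :=
  ereal_sup [set hausdorff_content d h delta A | delta in [set e : R | 0 < e]].

End Hausdorff_measure.

Section planar_curves.
Context {R : realType}.
Implicit Types (psi : nat -> R) (f h : R -> R) (I : set R).

Definition dist1 (x y : R) : R := `|x - y|.

Definition dist2 (x y : R * R) : R :=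
  Num.sqrt ((x.1 - y.1) ^+ 2 + (x.2 - y.2) ^+ 2).

Definition dist_int (x : R) : R :=
  inf (range (fun n : int => `|x - n%:~R|)).

(* Indices q range over the positive integers; the value psi 0 is unused. *)
Definition approximating_function psi : Prop :=
  [/\ forall q, (0 < q)%N -> 0 < psi q,
      (forall p q, (0 < p <= q)%N -> psi q <= psi p) \/
      (forall p q, (0 < p <= q)%N -> psi p <= psi q)
    & psi @ \oo --> (0 : R)].

Definition simul_approx psi1 psi2 (theta : R * R) : set (R * R) :=
  [set x | infinite_set
    [set q : nat | [/\ (0 < q)%N,
                       dist_int (q%:R * x.1 - theta.1) < psi1 q
                     & dist_int (q%:R * x.2 - theta.2) < psi2 q]]].

Definition curve I f : set (R * R) := [set (x, f x) | x in I].

(* Derivatives of f : I -> R are taken relative to I (one-sided at an endpoint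
   of I belonging to I), so values of f outside I play no role. *)
Definition diff_quotient f (x y : R) : R := (f y - f x) / (y - x).

Definition derivable_in I f (x : R) : Prop :=
  cvg (diff_quotient f x y @[y --> within I x^']).

Definition derive_in I f : R -> R :=
  fun x => lim (diff_quotient f x y @[y --> within I x^']).

Definition derive_in_n I (n : nat) f : R -> R := iter n (derive_in I) f.

Definition class_C (n : nat) I f : Prop :=
  (forall k, (k < n)%N -> forall x, I x -> derivable_in I (derive_in_n I k f) x)
  /\ {within I, continuous (derive_in_n I n f)}.

(* h : R -> R represents a function on ]0, +oo[; "increasing" is non-strict. *)
Definition dimension_function h : Prop :=
  [/\ forall r, 0 < r -> 0 < h r,
      forall r s, 0 < r -> r <= s -> h r <= h s,
      {within [set r : R | 0 < r], continuous h}
    & h r @[r --> 0^'+] --> (0 : R)].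

Definition regular_function h : Prop :=
  exists r0 lambda1 lambda2 : R,
    [/\ 0 < r0 < 1, 0 < lambda1 < 1, 0 < lambda2 < 1
      & forall r, 0 < r < r0 -> h (lambda1 * r) <= lambda2 * h r].

Definition volume_sum psi1 psi2 h : \bar R :=
  (\sum_(1 <= q <oo)
     (q%:R * h (Num.min (psi1 q) (psi2 q) / q%:R)
           * Num.max (psi1 q) (psi2 q))%:E)%E.

End planar_curves.

(* Main.v *)
Require Import Defs.
From HB Require Import structures.
From mathcomp Require Import all_boot all_order all_algebra.
From mathcomp Require Import all_classical all_reals all_analysis.
From mathcomp Require Import ring lra zify.

Set Implicit Arguments.
Unset Strict Implicit.
Unset Printing Implicit Defensive.

Import Order.TTheory GRing.Theory Num.Theory.
Import numFieldNormedType.Exports.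

Local Open Scope classical_set_scope.
Local Open Scope ring_scope.

(** A rational point near the curve is an integer triple (q, p1, p2) at which, for
    some parameter x, two linear forms are small: X1, the error in one coordinate,
    and X2, the distance to the tangent line at x.  In a unimodular frame adapted
    to x such triples are counted by Minkowski reduction, at the cost of the
    inverses of the first minima of the lattice and of its dual.  The dual frames
    come from a system of the same kind, so any bound on the average of the
    inverse minima improves itself, and iterating it reaches every exponent above 1.
    This gives the sharp count O(d Q^2 (b - a + Q^-tau)) for d >= Q^-eta, eta < 1,
    and convergence follows by covering dyadic blocks.

    For divergence, the same count applied to homogeneous forms shows that at half
    of the points of a grid of mesh about 1 / (d Q^2) the lattice has bounded
    covering radius, so a shifted rational point lies near each of them.  Given a
    cheap cover of the limsup set, one descends through nested intervals around
    such points, always to one that meets cover elements of too small a total cost;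
    the limit point is then not covered.  Regularity of h allows one to keep only
    the scales at which the number of grid points grows geometrically.  The
    coordinate with the smaller psi serves as the parameter. *)

(** * Unimodular frames and reduced bases *)

(** A first minimum can be as small as 1/Q, so the pointwise bound gives only exponent 2 for the
    average. If exponent b is known for the dual frames, primitive vectors of height at most n
    number O(n^b); interpolating the resulting count of small minima with the trivial one gives
    every exponent 2 - s with b s < 1. The map b -> 2 - 1/b fixes 1 with derivative 1, so 1 itself
    is never reached and a factor Q^tau is always lost. This is where eta < 1 enters: at scale s =
    sqrt(d Q) >= Q^((1 - eta)/2) the main term of the count carries s^3 and the cusp terms at most
    s^2, and the spare s pays for the loss.

    The curve enters only through a triple (A, B, E) with dE = A dB to second order and A, B
    bi-Lipschitz, a structure that the dual inherits; curvature is the bi-Lipschitz property.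

    In the divergence half no measure is built on the limsup set. The descent works against one
    given cover, and the role of a Frostman measure is played by a number g that compares length
    with admissible cost. *)

Section Triples.
Context {T : comNzRingType}.
Implicit Types u v w : T * T * T.

(* The pairing is anti-diagonal so that the dual of a unipotent frame is
   again given by lower triangular coordinates. *)
Definition dotp v w : T := v.1.1 * w.2 + v.1.2 * w.1.2 + v.2 * w.1.1.

(** The coordinates are listed in reverse, so that under the anti-diagonal pairing
    [dotp u (crossp v w)] is the determinant of the three vectors. *)
Definition crossp v w : T * T * T :=
  (v.1.1 * w.1.2 - v.1.2 * w.1.1,
   v.2 * w.1.1 - v.1.1 * w.2,
   v.1.2 * w.2 - v.2 * w.1.2).

Definition scalev (c : T) v : T * T * T := (c * v.1.1, c * v.1.2, c * v.2).
Definition subv v w : T * T * T :=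
  (v.1.1 - w.1.1, v.1.2 - w.1.2, v.2 - w.2).
Definition addv v w : T * T * T :=
  (v.1.1 + w.1.1, v.1.2 + w.1.2, v.2 + w.2).

Lemma vecP v w : v.1.1 = w.1.1 -> v.1.2 = w.1.2 -> v.2 = w.2 -> v = w.
Proof. by case: v => [[a b] c]; case: w => [[a' b'] c'] /= -> -> ->. Qed.

Lemma dotpC v w : dotp v w = dotp w v.
Proof. rewrite /dotp; ring. Qed.

Lemma crossp_crossp w v u :
  crossp w (crossp v u) = subv (scalev (dotp v w) u) (scalev (dotp u w) v).
Proof. by apply: vecP; rewrite /= /dotp; ring. Qed.

Lemma dotp_crossr v w : dotp (crossp v w) w = 0.
Proof. rewrite /dotp /=; ring. Qed.

Lemma dotp_subl u v w : dotp (subv u v) w = dotp u w - dotp v w.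
Proof. rewrite /dotp /=; ring. Qed.

Lemma dotp_subr u v w : dotp w (subv u v) = dotp w u - dotp w v.
Proof. rewrite /dotp /=; ring. Qed.

Lemma dotp_scalel c v w : dotp (scalev c v) w = c * dotp v w.
Proof. rewrite /dotp /=; ring. Qed.

Lemma dotp_scaler c v w : dotp w (scalev c v) = c * dotp w v.
Proof. rewrite /dotp /=; ring. Qed.

Lemma crossp_subr u v w : crossp w (subv u v) = subv (crossp w u) (crossp w v).
Proof. by apply: vecP; rewrite /=; ring. Qed.

Lemma crossp_scaler c u w : crossp w (scalev c u) = scalev c (crossp w u).
Proof. by apply: vecP; rewrite /=; ring. Qed.

Lemma crosspp u : crossp u u = (0, 0, 0).
Proof. by apply: vecP; rewrite /=; ring. Qed.

Lemma subv_eq0 u v : subv u v = (0, 0, 0) -> u = v.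
Proof.
move: u v => [[a b] c] [[a' b'] c'] [] /eqP + /eqP + /eqP.
by rewrite !subr_eq0 => /eqP -> /eqP -> /eqP ->.
Qed.

(** The witness [u] of primitivity replaces a division: expanding u x (w x z) gives a
    proportionality factor that is integral over the integers. *)
Lemma crossp0_prop u w z : dotp u w = 1 -> crossp w z = (0, 0, 0) ->
  z = scalev (dotp u z) w.
Proof.
move=> uw wz; have := crossp_crossp u w z.
rewrite wz => H; apply: subv_eq0.
have -> : subv z (scalev (dotp u z) w) =
  subv (scalev (dotp w u) z) (scalev (dotp z u) w).
  by rewrite (dotpC w) uw (dotpC z); apply: vecP; rewrite /=; ring.
by rewrite -H; apply: vecP; rewrite /=; ring.
Qed.

(** Two vectors of the plane orthogonal to [w] have a cross product normal to it. The factor later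
    numbers the rows of a planar lattice. *)
Lemma crossp_orth u w v z : dotp u w = 1 -> dotp v w = 0 -> dotp z w = 0 ->
  crossp v z = scalev (dotp u (crossp v z)) w.
Proof.
move=> uw vw zw; apply: (crossp0_prop uw).
by rewrite crossp_crossp vw zw; apply: vecP; rewrite /=; ring.
Qed.

Lemma cramer (u v v' : T * T * T) (t : T * T * T) : dotp u (crossp v v') = 1 ->
  t = addv (scalev (dotp t (crossp v v')) u)
     (addv (scalev (dotp t (crossp v' u)) v)
           (scalev (dotp t (crossp u v)) v')).
Proof.
move=> D; apply: vecP; rewrite -[LHS]mul1r -D /= /dotp /=; ring.
Qed.

End Triples.

Section Lattice.
Context {R : realType}.

Definition ivec := (int * int * int)%type.
Definition rv (v : ivec) : R * R * R := (v.1.1%:~R, v.1.2%:~R, v.2%:~R).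

Lemma rv_sub v w : rv (subv v w) = subv (rv v) (rv w).
Proof. by apply: vecP; rewrite /= rmorphB. Qed.

Lemma rv_add v w : rv (addv v w) = addv (rv v) (rv w).
Proof. by apply: vecP; rewrite /= rmorphD. Qed.

Lemma rv_scale c v : rv (scalev c v) = scalev c%:~R (rv v).
Proof. by apply: vecP; rewrite /= rmorphM. Qed.

Lemma rv_cross v w : rv (crossp v w) = crossp (rv v) (rv w).
Proof. by apply: vecP; rewrite /= rmorphB !rmorphM. Qed.

Lemma rv_dot v w : dotp (rv v) (rv w) = (dotp v w)%:~R.
Proof. by rewrite /dotp /= !rmorphD !rmorphM. Qed.

(** Three weights and a lower unipotent matrix with entries A, E, B. [nrm] is the squared Euclidean
    length of the image of a vector. *)
Record frame := Frame { fA : R; fB : R; fE : R; f0 : R; f1 : R; f2 : R }.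

Definition unif (F : frame) : Prop :=
  [/\ 0 < f0 F, 0 < f1 F, 0 < f2 F & f0 F * f1 F * f2 F = 1].

Definition bil (F : frame) (v w : R * R * R) : R :=
  f0 F ^+ 2 * (v.1.1 * w.1.1)
  + f1 F ^+ 2 * ((v.1.2 + fA F * v.1.1) * (w.1.2 + fA F * w.1.1))
  + f2 F ^+ 2 * ((v.2 + fB F * v.1.2 + fE F * v.1.1)
               * (w.2 + fB F * w.1.2 + fE F * w.1.1)).

Definition nrm F v := bil F v v.

(** The inverse transpose with reversed coordinates. Each weight is the inverse of one of [f0],
    [f1], [f2], written as a product of the other two so that identities stay polynomial. *)
Definition dualf (F : frame) : frame :=
  Frame (- fB F) (- fA F) (fA F * fB F - fE F)
        (f0 F * f1 F) (f0 F * f2 F) (f1 F * f2 F).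

Lemma dualfK F : unif F -> dualf (dualf F) = F.
Proof.
case: F => A B E a b c [/= _ _ _ abc]; rewrite /dualf /=; congr Frame; try ring.
- by rewrite (_ : _ * _ = a * b * c * a); [rewrite abc mul1r|ring].
- by rewrite (_ : _ * _ = a * b * c * b); [rewrite abc mul1r|ring].
- by rewrite (_ : _ * _ = a * b * c * c); [rewrite abc mul1r|ring].
Qed.

Lemma unif_dual F : unif F -> unif (dualf F).
Proof.
case: F => A B E a b c [/= a0 b0 c0 abc]; split => /=; try by rewrite mulr_gt0.
by rewrite (_ : _ * _ = (a * b * c) ^+ 2); [rewrite abc expr1n|ring].
Qed.

Lemma nrm_ge0 F v : 0 <= nrm F v.
Proof.
by rewrite /nrm /bil -!expr2 !addr_ge0// mulr_ge0// sqr_ge0.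
Qed.

(** Lagrange's identity: the squared area spanned by two vectors is the squared dual length of their
    cross product. It turns areas in planar sublattices into norms of dual vectors. *)
Lemma lagrange F v w :
  nrm F v * nrm F w = bil F v w ^+ 2 + nrm (dualf F) (crossp v w).
Proof. rewrite /nrm /bil /=; ring. Qed.

Lemma bil_subr F u v w : bil F w (subv u v) = bil F w u - bil F w v.
Proof. rewrite /bil /=; ring. Qed.

Lemma bil_scaler F c v w : bil F w (scalev c v) = c * bil F w v.
Proof. rewrite /bil /=; ring. Qed.

Lemma nrm_scale F c v : nrm F (scalev c v) = c ^+ 2 * nrm F v.
Proof. rewrite /nrm /bil /=; ring. Qed.

Lemma dotp_cauchy F v w : unif F ->
  dotp v w ^+ 2 <= nrm F v * nrm (dualf F) w.
Proof.
case: F => A B E a b c [/= a0 b0 c0 abc].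
have -> : dotp v w = (a * v.1.1) * (b * c * (w.2 - A * w.1.2 + (A * B - E) * w.1.1))
  + (b * (v.1.2 + A * v.1.1)) * (a * c * (w.1.2 - B * w.1.1))
  + (c * (v.2 + B * v.1.2 + E * v.1.1)) * (a * b * w.1.1).
  have -> : dotp v w = a * b * c * dotp v w by rewrite abc mul1r.
  rewrite /dotp; ring.
set x0 := a * v.1.1; set x1 := b * (v.1.2 + _).
set x2 := c * (v.2 + _ + _); set y0 := b * c * (w.2 - _ + _).
set y1 := a * c * (w.1.2 - _); set y2 := a * b * w.1.1.
have -> : nrm (Frame A B E a b c) v = x0 ^+ 2 + x1 ^+ 2 + x2 ^+ 2.
  by rewrite /nrm /bil /x0 /x1 /x2 /=; ring.
have -> : nrm (dualf (Frame A B E a b c)) w = y0 ^+ 2 + y1 ^+ 2 + y2 ^+ 2.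
  by rewrite /nrm /bil /y0 /y1 /y2 /=; ring.
have := sqr_ge0 (x0 * y1 - x1 * y0); have := sqr_ge0 (x0 * y2 - x2 * y0).
have := sqr_ge0 (x1 * y2 - x2 * y1).
by clear; nra.
Qed.

Definition qn F (v : ivec) : R := nrm F (rv v).

Lemma qn_ge0 F v : 0 <= qn F v. Proof. exact: nrm_ge0. Qed.

Lemma int_sqr_ge1 (n : int) : n != 0 -> 1 <= (n%:~R : R) ^+ 2.
Proof.
move=> n0; rewrite expr2 -rmorphM /= -[1]/(1%:~R) ler_int; nia.
Qed.

Lemma int_norm_ge1 (n : int) : n != 0 -> 1 <= `|n%:~R : R|.
Proof. by move=> n0; rewrite -intr_norm -[1]/(1%:~R) ler_int; lia. Qed.

(** The frame is triangular, so the first nonzero integer coordinate contributes at least the square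
    of its weight. *)
Lemma qn_lower F : unif F -> exists2 k : R, 0 < k & forall v, v != (0, 0, 0) ->
  k <= qn F v.
Proof.
move=> [a0 b0 c0 _]; exists (Num.min (f0 F ^+ 2) (Num.min (f1 F ^+ 2) (f2 F ^+ 2))).
  by rewrite !lt_min !exprn_gt0.
move=> [[x y] z] v0; rewrite /qn /nrm /bil -!expr2 /=.
have [x0|x0] := eqVneq x 0; last first.
  rewrite ge_min; apply/orP; left.
  have := int_sqr_ge1 x0; set X := _ ^+ 2 => X1.
  rewrite -addrA; apply: ler_wpDr; first by rewrite addr_ge0// mulr_ge0// sqr_ge0.
  by rewrite ler_peMr// sqr_ge0.
rewrite x0 !mulr0 !addr0 expr0n mulr0 add0r.
have [y0|y0] := eqVneq y 0; last first.
  rewrite ge_min; apply/orP; right; rewrite ge_min; apply/orP; left.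
  have := int_sqr_ge1 y0; set X := _ ^+ 2 => X1.
  apply: ler_wpDr; first by rewrite mulr_ge0// sqr_ge0.
  by rewrite ler_peMr// sqr_ge0.
rewrite y0 !mulr0 !addr0 expr0n mulr0 add0r.
have [z0|z0] := eqVneq z 0; first by move: v0; rewrite x0 y0 z0 eqxx.
rewrite !ge_min; apply/orP; right; apply/orP; right.
by rewrite ler_peMr ?sqr_ge0// int_sqr_ge1.
Qed.

Lemma qn_gt0 F v : unif F -> v != (0, 0, 0) -> 0 < qn F v.
Proof. by move=> /qn_lower[k k0 H] /H; apply: lt_le_trans. Qed.

Lemma near_minimum F (P : ivec -> Prop) : unif F ->
  (exists2 v, v != (0, 0, 0) & P v) ->
  exists v, [/\ v != (0, 0, 0), P v &
    forall v', v' != (0, 0, 0) -> P v' -> 5 * qn F v <= 6 * qn F v'].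
Proof.
move=> uF [v0 v00 Pv0]; have [k k0 kP] := qn_lower uF.
pose S := [set qn F v | v in [set v : ivec | v != (0, 0, 0) /\ P v]].
have S0 : has_inf S.
  split; first by exists (qn F v0), v0.
  by exists k => _ [v [vn _] <-]; exact: kP.
have kS : k <= inf S.
  by apply: lb_le_inf; [exact: S0.1|move=> _ [v [vn _] <-]; exact: kP].
have e0 : 0 < inf S / 5 by rewrite divr_gt0//; lra.
have [_ [v [vn Pv] <-] Hv] := inf_adherent e0 S0.
exists v; split => // v' vn' Pv'.
have : inf S <= qn F v' by apply: ge_inf; [exact: S0.2|exists v'].
by move=> H; lra.
Qed.

Lemma primitive_factor (v : ivec) : v != (0, 0, 0) ->
  exists g v0 u, [/\ 0 < g, v = scalev g v0 & dotp u v0 = 1].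
Proof.
move: v => [[a b] c] v0.
have [u1 [u2 e1]] := Bezoutz a b; have [u3 [u4 e2]] := Bezoutz (gcdz a b) c.
set g := gcdz (gcdz a b) c in e2.
have g0 : g != 0.
  apply: contra v0; rewrite /g !gcdz_eq0 => /andP[/andP[/eqP-> /eqP->] /eqP->].
  by [].
have /dvdzP[c' cE] : (g %| c)%Z by rewrite dvdz_gcdr.
have /dvdzP[a' aE] : (g %| a)%Z by apply: dvdz_trans (dvdz_gcdl _ _) (dvdz_gcdl _ _).
have /dvdzP[b' bE] : (g %| b)%Z by apply: dvdz_trans (dvdz_gcdl _ _) (dvdz_gcdr _ _).
exists g, (a', b', c'), (u4, u3 * u2, u3 * u1); split.
- by rewrite lt_def g0.
- by apply: vecP => /=; rewrite mulrC.
- apply: (mulIf g0); rewrite mul1r -[RHS]e2 -e1 /dotp /=.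
  by rewrite [in RHS]aE [in RHS]bE [in RHS]cE; ring.
Qed.

Lemma qn_scale F c v : qn F (scalev c v) = c%:~R ^+ 2 * qn F v.
Proof. by rewrite /qn rv_scale nrm_scale. Qed.

Lemma scalev_neq0 (g : int) v : scalev g v != (0, 0, 0) -> v != (0, 0, 0).
Proof. by apply: contra => /eqP ->; apply/eqP/vecP; rewrite /= mulr0. Qed.

(** Removing a common factor g >= 2 divides [qn] by at least 4, more than the tolerance 6/5
    allows. *)
Lemma near_minimum_primitive F (P : ivec -> Prop) v : unif F ->
  (forall g v0, 0 < g -> P (scalev g v0) -> P v0) ->
  v != (0, 0, 0) -> P v ->
  (forall v', v' != (0, 0, 0) -> P v' -> 5 * qn F v <= 6 * qn F v') ->
  exists u, dotp u v = 1.
Proof.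
move=> uF Pdiv v0 Pv vmin.
have [g [w [u [g0 vE uw]]]] := primitive_factor v0.
have w0 : w != (0, 0, 0) by apply: (@scalev_neq0 g); rewrite -vE.
have [g1|g1] := eqVneq g 1.
  by exists u; rewrite vE g1 -[RHS]uw /dotp /=; ring.
have g2 : (2 : R) <= g%:~R by rewrite -[2]/(2%:~R) ler_int; lia.
have Pw : P w by apply: (Pdiv g) => //; rewrite -vE.
have := vmin _ w0 Pw; have := qn_gt0 uF w0; rewrite vE qn_scale.
set q := qn F w; set G : R := g%:~R in g2 *.
move=> q0 H; exfalso; clear -g2 q0 H; clearbody G q.
have g4 : 4 <= G ^+ 2 by rewrite expr2; nra.
by nra.
Qed.

(** Hermite's inequality in the plane orthogonal to [b]: the cross product of [a] and [crossp x b]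
    is [b], so the dual norm of [b] is a squared area. Reducing the second vector modulo [a] gives
    (5/6 - 1/4) q(a)^2 <= that area, and 12/7 is rounded up to 2. *)
Lemma hermite G a b x : unif G -> dotp x a = 1 -> dotp b a = 0 ->
  a != (0, 0, 0) ->
  (forall n, 5 * qn G a <= 6 * qn G (subv (crossp x b) (scalev n a))) ->
  qn G a ^+ 2 <= 2 * qn (dualf G) b.
Proof.
move=> uG xa ba a0 H.
have qa := qn_gt0 uG a0.
pose t : R := bil G (rv a) (rv (crossp x b)) / qn G a.
pose n := Num.floor (t + 2^-1).
have n1 : n%:~R <= t + 2^-1 by exact: floor_le_tmp.
have n2 : t + 2^-1 < n%:~R + 1 by have := floorD1_gt (t + 2^-1); rewrite intrD.
have L := lagrange G (rv a) (rv (subv (crossp x b) (scalev n a))).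
have cb : crossp a (subv (crossp x b) (scalev n a)) = b.
  rewrite crossp_subr crossp_scaler crosspp crossp_crossp xa ba.
  by apply: vecP; rewrite /=; ring.
rewrite -rv_cross cb in L.
have bE : bil G (rv a) (rv (subv (crossp x b) (scalev n a))) = (t - n%:~R) * qn G a.
  by rewrite rv_sub rv_scale bil_subr bil_scaler mulrBl /t divfK// gt_eqF.
move: L; rewrite bE -/(qn G a) -/(qn G _) -/(qn (dualf G) b) => L.
have := H n; set c := qn G (subv _ _) in L *; set qb := qn (dualf G) b in L *.
move=> Hn.
have sq : (t - n%:~R) ^+ 2 <= 4^-1.
  by nra.
have : ((t - n%:~R) * qn G a) ^+ 2 <= 4^-1 * qn G a ^+ 2.
  by rewrite exprMn ler_wpM2r// sqr_ge0.
move=> H2; have : qn G a * (5 * qn G a) <= qn G a * (6 * c) by rewrite ler_pM2l.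
have : 0 <= qb by exact: qn_ge0.
by move=> *; nra.
Qed.

Lemma orth_exists (w : ivec) : exists2 v : ivec, v != (0, 0, 0) & dotp v w = 0.
Proof.
case: w => [[a b] c]; have [b0|b0] := eqVneq b 0.
  have [c0|c0] := eqVneq c 0.
    by exists (1, 0, 0) => //; rewrite /dotp /= b0 c0; ring.
  by exists (0, 1, 0) => //; rewrite /dotp /= b0; ring.
exists (b, - c, 0); last by rewrite /dotp /=; ring.
by apply: contra b0 => /eqP[->].
Qed.

(** [w] is nearly shortest in the dual and [v] nearly shortest in the plane orthogonal to [w].
    Hermite's inequality, once in each lattice, bounds the square of either norm by twice the other,
    hence both by 2. [u] and [x] witness primitivity. *)
Lemma reduced_basis F : unif F -> exists w v u x : ivec,
  [/\ w != (0, 0, 0), v != (0, 0, 0), dotp u w = 1, dotp x v = 1 & dotp v w = 0] /\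
  [/\ qn (dualf F) w ^+ 2 <= 2 * qn F v, qn F v ^+ 2 <= 2 * qn (dualf F) w,
      0 < qn (dualf F) w <= 2 & 0 < qn F v <= 2].
Proof.
move=> uF; have uD := unif_dual uF.
have [w [w0 _ wmin]] : exists w, [/\ w != (0, 0, 0), True &
    forall v', v' != (0, 0, 0) -> True -> 5 * qn (dualf F) w <= 6 * qn (dualf F) v'].
  by apply: near_minimum => //; exists (1, 0, 0).
have [u uw] : exists u, dotp u w = 1.
  by apply: (@near_minimum_primitive (dualf F) (fun=> True)).
have [v [v0 vw vmin]] := @near_minimum F (fun v => dotp v w = 0) uF (orth_exists w).
have [x xv] : exists x, dotp x v = 1.
  apply: (@near_minimum_primitive F (fun v => dotp v w = 0)) => //.
  move=> g z g0 /eqP; rewrite dotp_scalel mulf_eq0 => /orP[|/eqP//].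
  by rewrite gt_eqF.
have H1 : qn (dualf F) w ^+ 2 <= 2 * qn F v.
  rewrite -[in X in _ <= _ * X](dualfK uF); apply: (hermite (x := u)) => // n.
  (* The competitor is nonzero because its cross product with [w] is [v]. *)
  apply: wmin => //; apply/eqP => E.
  have : crossp w (subv (crossp u v) (scalev n w)) = v.
    rewrite crossp_subr crossp_scaler crosspp crossp_crossp uw vw.
    by apply: vecP; rewrite /=; ring.
  rewrite E => vE; move: v0; rewrite -vE => /negP; apply.
  by apply/eqP/vecP; rewrite /=; ring.
have H2 : qn F v ^+ 2 <= 2 * qn (dualf F) w.
  apply: (hermite (x := x)) => //; first by rewrite dotpC.
  move=> n; apply: vmin.
    apply/eqP => E.
    have : crossp v (subv (crossp x w) (scalev n v)) = w.
      rewrite crossp_subr crossp_scaler crosspp crossp_crossp xv (dotpC w) vw.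
      by apply: vecP; rewrite /=; ring.
    rewrite E => wE; move: w0; rewrite -wE => /negP; apply.
    by apply/eqP/vecP; rewrite /=; ring.
  by rewrite dotp_subl dotp_scalel vw dotp_crossr mulr0 subr0.
exists w, v, u, x; split => //.
have qw := qn_gt0 uD w0; have qv := qn_gt0 uF v0.
set M := qn (dualf F) w in H1 H2 qw *; set N := qn F v in H1 H2 qv *.
have M2 : M <= 2.
  rewrite leNgt; apply/negP => M2.
  have MN : M < N by nra.
  clear -H2 qv M2 MN; clearbody M N.
  have := mulr_gt0 qv (_ : 0 < N - M); have := mulr_gt0 qv (_ : 0 < M - 2).
  by rewrite !subr_gt0 => /(_ M2) ? /(_ MN) ?; nra.
split => //; first by rewrite qw.
rewrite qv /= leNgt; apply/negP => N2.
have := mulr_gt0 qv (_ : 0 < N - 2); rewrite subr_gt0 => /(_ N2).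
by clear -H2 M2 N2; clearbody M N; nra.
Qed.

End Lattice.

(** * Counting lattice points *)

Section Counting.
Context {R : realType}.

Lemma norm_le_of_sqr (x b : R) : 0 <= b -> x ^+ 2 <= b ^+ 2 -> `|x| <= b.
Proof.
by move=> b0 xb; rewrite -ler_sqr ?nnegrE// real_normK// num_real.
Qed.

Lemma int_small (n : int) : `|n%:~R : R| < 1 -> n = 0.
Proof.
by have [//|/(int_norm_ge1 (R := R)) n1] := eqVneq n 0; rewrite ltNge n1.
Qed.

Lemma count_le_fibers (T A : eqType) (s : seq T) (g : T -> A) (vals : seq A)
    (c : A -> R) :
  (forall a, a \in vals -> (count (fun x => g x == a) s)%:R <= c a) ->
  (count (fun x => g x \in vals) s)%:R <= \sum_(a <- vals) c a.
Proof.
elim: vals => [|a vals IH] H.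
  rewrite big_nil (eq_count (a2 := pred0)) ?count_pred0// => x.
rewrite big_cons; have -> : count (fun x => g x \in a :: vals) s =
    count (predU (fun x => g x == a) (fun x => g x \in vals)) s.
  by apply: eq_count => x; rewrite /= inE.
have le : (count (predU (fun x => g x == a) (fun x => g x \in vals)) s <=
    count (fun x => g x == a) s + count (fun x => g x \in vals) s)%N.
  by rewrite -count_predUI leq_addr.
apply: (@le_trans _ _ ((count (fun x => g x == a) s)%:R +
    (count (fun x => g x \in vals) s)%:R)); first by rewrite -natrD ler_nat.
by apply: lerD; [apply: H; rewrite inE eqxx|
  apply: IH => b bv; apply: H; rewrite inE bv orbT].
Qed.

Lemma size_le_fibers (T A : eqType) (s : seq T) (g : T -> A) (vals : seq A)
    (c : A -> R) :
  (forall x, x \in s -> g x \in vals) ->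
  (forall a, a \in vals -> (count (fun x => g x == a) s)%:R <= c a) ->
  (size s)%:R <= \sum_(a <- vals) c a.
Proof.
move=> gv H; apply: le_trans (count_le_fibers H).
have : all (fun x => g x \in vals) s by apply/allP.
by rewrite all_count => /eqP ->.
Qed.

Lemma size_int_window (s : seq int) (k : R) : uniq s -> 0 <= k ->
  (forall x y, x \in s -> y \in s -> `|(x - y)%:~R| <= k) ->
  (size s)%:R <= 1 + 2 * k.
Proof.
case: s => [_ k0 _|x0 s us k0 H]; first by rewrite addr_ge0// mulr_ge0.
set S := x0 :: s in us H *; pose K := Num.floor k.
have K0 : 0 <= K by rewrite floor_ge0.
have HK x : x \in S -> `|x - x0| <= K.
  by move=> xS; rewrite floor_ge_int_tmp intr_norm H// inE eqxx.
pose g (x : int) := absz (x - x0 + K).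
have ug : uniq (map g S).
  rewrite map_inj_in_uniq// => x y /HK xS /HK yS; rewrite /g; lia.
have sub : {subset map g S <= iota 0 (2 * `|K|).+1}.
  move=> _ /mapP[x /HK xS ->]; rewrite mem_iota /g; lia.
have := uniq_leq_size ug sub; rewrite size_map size_iota => le.
apply: (@le_trans _ _ ((2 * `|K|).+1)%:R); first by rewrite ler_nat.
rewrite -addn1 natrD natrM addrC lerD2l ler_pM2l//.
have -> : (`|K|%N)%:R = K%:~R :> R by rewrite -[in RHS](gez0_abs K0) -pmulrn.
exact: floor_le_tmp.
Qed.

Lemma size_fibers (T : eqType) (s : seq T) (g : T -> int) (k c : R) :
  0 <= k -> 0 <= c ->
  (forall x y, x \in s -> y \in s -> `|(g x - g y)%:~R| <= k) ->
  (forall a, (size [seq x <- s | g x == a])%:R <= c) ->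
  (size s)%:R <= (1 + 2 * k) * c.
Proof.
move=> k0 c0 H Hc; pose V := undup (map g s).
have : (size s)%:R <= \sum_(a <- V) c.
  apply: (@size_le_fibers _ _ s g V (fun=> c)).
    by move=> x xs; rewrite mem_undup map_f.
  by move=> a _; rewrite -size_filter.
move=> /le_trans; apply; rewrite big_const_seq count_predT iter_addr addr0.
rewrite -[c *+ _]mulr_natl ler_wpM2r//; apply: size_int_window => //.
  exact: undup_uniq.
by move=> x y; rewrite !mem_undup => /mapP[x' xs ->] /mapP[y' ys ->]; exact: H.
Qed.

Definition lamF (F : frame) : R :=
  Num.sqrt (inf [set qn F v | v in [set v : ivec | v != (0, 0, 0)]]).

Lemma qn_has_inf (F : @frame R) : unif F ->
  has_inf [set qn F v | v in [set v : ivec | v != (0, 0, 0)]].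
Proof.
move=> /qn_lower[k k0 H]; split; first by exists (qn F (1, 0, 0)), (1, 0, 0).
by exists k => _ [v v0 <-]; exact: H.
Qed.

Lemma lamF_ge (F : @frame R) (c : R) : 0 <= c ->
  (forall v : ivec, v != (0, 0, 0) -> c ^+ 2 <= qn F v) -> c <= lamF F.
Proof.
move=> c0 H; have cE : Num.sqrt (c ^+ 2) = c by rewrite sqrtr_sqr ger0_norm.
rewrite -cE; apply: ler_wsqrtr; apply: lb_le_inf.
  by exists (qn F (1, 0, 0)), (1, 0, 0).
by move=> _ [v v0 <-]; exact: H.
Qed.

Lemma lamF_gt0 (F : @frame R) : unif F -> 0 < lamF F.
Proof.
move=> /qn_lower[k k0 H]; rewrite sqrtr_gt0; apply: lt_le_trans k0 _.
apply: lb_le_inf; first by exists (qn F (1, 0, 0)), (1, 0, 0).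
by move=> _ [v v0 <-]; exact: H.
Qed.

Lemma lamF_le (F : @frame R) v : unif F -> v != (0, 0, 0) ->
  lamF F <= Num.sqrt (qn F v).
Proof.
move=> uF v0; apply: ler_wsqrtr; apply: ge_inf; last by exists v.
exact: (qn_has_inf uF).2.
Qed.

(** Dividing out the content of a short vector only shortens it, so the witness can be taken
    primitive. *)
Lemma lamF_lt (F : @frame R) (e : R) : unif F -> 0 < e -> lamF F < e ->
  exists v u : ivec, [/\ v != (0, 0, 0), dotp u v = 1 & qn F v < e ^+ 2].
Proof.
move=> uF e0 le; have hi := qn_has_inf uF.
set S := [set _ | _ in _] in hi.
have S0 : 0 <= inf S.
  by apply: lb_le_inf; [exact: hi.1|move=> _ [v _ <-]; exact: qn_ge0].
have lt : inf S < e ^+ 2.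
  have : lamF F ^+ 2 < e ^+ 2 by rewrite ltr_sqr ?nnegrE ?sqrtr_ge0 ?ltW.
  by rewrite /lamF sqr_sqrtr.
have [_ [v v0 <-] Hv] : exists2 x, S x & x < e ^+ 2.
  have d0 : 0 < e ^+ 2 - inf S by rewrite subr_gt0.
  have [x Sx xlt] := inf_adherent d0 hi; exists x => //.
  by move: xlt; rewrite addrC subrK.
have [g [w [u [g0 vE uw]]]] := primitive_factor v0.
exists w, u; split=> //; first by apply: (@scalev_neq0 g); rewrite -vE.
apply: le_lt_trans Hv; rewrite vE qn_scale ler_peMl ?qn_ge0//.
by apply: int_sqr_ge1; rewrite gt_eqF.
Qed.

(** A layer of constant [dotp w] splits into rows parallel to [v]. The row index j is read off from
    v x (z - z') = j w, and Lagrange's identity bounds it by D |v| / |w|; within a row, points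
    differ by multiples of [v]. *)
Lemma basis_count (F : @frame R) (w v u x : ivec) (S : seq ivec) (D : R) :
  unif F -> dotp u w = 1 -> dotp x v = 1 -> dotp v w = 0 ->
  w != (0, 0, 0) -> v != (0, 0, 0) ->
  uniq S -> 0 <= D ->
  (forall z z', z \in S -> z' \in S -> qn F (subv z z') <= D ^+ 2) ->
  forall a, (size [seq z <- S | dotp w z == a])%:R <=
     (1 + 2 * (D * Num.sqrt (qn F v) / Num.sqrt (qn (dualf F) w)))
     * (1 + 2 * (D / Num.sqrt (qn F v))).
Proof.
move=> uF uw xv vw w0 v0 uS D0 HS a.
have qw := qn_gt0 (unif_dual uF) w0; have qv := qn_gt0 uF v0.
set M := qn (dualf F) w in qw *; set N := qn F v in qv *.
have m0 : 0 < Num.sqrt M by rewrite sqrtr_gt0.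
have n0 : 0 < Num.sqrt N by rewrite sqrtr_gt0.
have mE : Num.sqrt M ^+ 2 = M by rewrite sqr_sqrtr// ltW.
have nE : Num.sqrt N ^+ 2 = N by rewrite sqr_sqrtr// ltW.
set m := Num.sqrt M in m0 mE *; set n := Num.sqrt N in n0 nE *.
have cr0 z z' : dotp w z = a -> dotp w z' = a ->
    crossp v (subv z z') = scalev (dotp u (crossp v z) - dotp u (crossp v z')) w.
  move=> za z'a; rewrite -dotp_subr -crossp_subr; apply: crossp_orth => //.
  by rewrite dotpC dotp_subr za z'a subrr.
apply: (@size_fibers _ _ (fun z => dotp u (crossp v z))).
- by rewrite !mulr_ge0// ?invr_ge0 ltW.
- by rewrite addr_ge0// !mulr_ge0// ?invr_ge0 ltW.
- move=> z z'; rewrite !mem_filter => /andP[/eqP za zS] /andP[/eqP z'a z'S].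
  apply: norm_le_of_sqr; first by rewrite !mulr_ge0// ?invr_ge0 ltW.
  have := lagrange F (rv v) (rv (subv z z')); rewrite -rv_cross (cr0 _ _ za z'a).
  rewrite -/(qn F v) -/(qn F (subv z z')) -/(qn (dualf F) _) qn_scale -/N -/M.
  move=> L; rewrite expr_div_n ler_pdivlMr ?exprn_gt0// mE exprMn nE.
  have := HS _ _ zS z'S; set t := qn F _ in L *; set b := bil _ _ _ in L.
  move=> tD; have : N * t <= D ^+ 2 * N by rewrite mulrC ler_pM2r.
  by have := sqr_ge0 b; lra.
move=> j; rewrite -filter_predI.
rewrite -[X in _ <= X]mulr1; apply: (@size_fibers _ _ (fun z => dotp x z)) => //.
- by rewrite !mulr_ge0// ?invr_ge0 ltW.
- move=> z z'; rewrite !mem_filter => /andP[/andP[/eqP zj /eqP za] zS].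
  move=> /andP[/andP[/eqP z'j /eqP z'a] z'S].
  apply: norm_le_of_sqr; first by rewrite !mulr_ge0// ?invr_ge0 ltW.
  have := cr0 _ _ za z'a; rewrite zj z'j subrr => C.
  have dE : subv z z' = scalev (dotp x (subv z z')) v.
    by apply: crossp0_prop => //; rewrite C; apply: vecP; rewrite /= mul0r.
  have := HS _ _ zS z'S; rewrite dE qn_scale dotp_subr => H.
  by rewrite expr_div_n ler_pdivlMr ?exprn_gt0// nE.
move=> i; rewrite -filter_predI -[1]/(1%:R) ler_nat.
set S' := [seq _ <- S | _].
have uS' : uniq S' by rewrite filter_uniq.
have S'1 : forall z z', z \in S' -> z' \in S' -> z = z'.
  move=> z z'; rewrite !mem_filter => /andP[/andP[/eqP zi /andP[/eqP zj /eqP za]] zS].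
  move=> /andP[/andP[/eqP z'i /andP[/eqP z'j /eqP z'a]] z'S].
  have := cr0 _ _ za z'a; rewrite zj z'j subrr => C.
  have dE : subv z z' = scalev (dotp x (subv z z')) v.
    by apply: crossp0_prop => //; rewrite C; apply: vecP; rewrite /= mul0r.
  apply: subv_eq0; rewrite dE dotp_subr zi z'i subrr.
  by apply: vecP; rewrite /= mul0r.
case: S' uS' S'1 => [//|z [//|z' S'']] /= /andP[zn _] E.
by move: zn; rewrite (E z z') ?inE ?eqxx ?orbT.
Qed.

Lemma lattice_count_basis (F : @frame R) (w v u x : ivec) (S : seq ivec) (D : R) :
  unif F -> dotp u w = 1 -> dotp x v = 1 -> dotp v w = 0 ->
  w != (0, 0, 0) -> v != (0, 0, 0) ->
  uniq S -> 0 <= D ->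
  (forall z z', z \in S -> z' \in S -> qn F (subv z z') <= D ^+ 2) ->
  (size S)%:R <= (1 + 2 * (D * Num.sqrt (qn (dualf F) w))) *
     ((1 + 2 * (D * Num.sqrt (qn F v) / Num.sqrt (qn (dualf F) w)))
     * (1 + 2 * (D / Num.sqrt (qn F v)))).
Proof.
move=> uF uw xv vw w0 v0 uS D0 HS.
apply: (@size_fibers _ _ (fun z => dotp w z)).
- by rewrite mulr_ge0// sqrtr_ge0.
- by rewrite mulr_ge0// addr_ge0// !mulr_ge0// ?invr_ge0 sqrtr_ge0.
- move=> z z' zS z'S; apply: norm_le_of_sqr; first by rewrite mulr_ge0// sqrtr_ge0.
  rewrite -dotp_subr dotpC -rv_dot exprMn sqr_sqrtr ?qn_ge0//.
  apply: le_trans (dotp_cauchy _ _ uF) _; rewrite ler_wpM2r ?qn_ge0//.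
  exact: HS.
- exact: (basis_count uF uw xv vw w0 v0 uS D0 HS).
Qed.

(** The relation m^2 <= 2 n from the reduction turns the mixed term m / n into 2 / m, so only the
    cusp terms 1 / n and 1 / m survive. *)
Lemma count_bound (D m n : R) : 1 <= D -> 0 < m -> 0 < n -> m <= 2 -> n <= 2 ->
  m ^+ 2 <= 2 * n ->
  (1 + 2 * (D * m)) * ((1 + 2 * (D * n / m)) * (1 + 2 * (D / n))) <=
  100 * (D ^+ 3 + D / n + D ^+ 2 / m).
Proof.
move=> D1 m0 n0 m2 n2 mn.
have -> : (1 + 2 * (D * m)) * ((1 + 2 * (D * n / m)) * (1 + 2 * (D / n))) =
  1 + 2 * D * m + 4 * D ^+ 2 * n + 8 * D ^+ 3 + 2 * D * n / m + 2 * (D / n)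
  + 4 * D ^+ 2 * (m / n) + 4 * (D ^+ 2 / m).
  by field; rewrite !gt_eqF.
have D0 : 0 < D by lra.
have D2 : D <= D ^+ 2 by rewrite expr2; nra.
have D3 : D ^+ 2 <= D ^+ 3 by rewrite (exprS _ 2); nra.
have h1 : D * m <= D * 2 by rewrite ler_pM2l.
have h2 : D ^+ 2 * n <= D ^+ 2 * 2 by rewrite ler_pM2l ?exprn_gt0.
have h3 : D * n / m <= 2 * (D ^+ 2 / m).
  by rewrite mulrA ler_pM2r ?invr_gt0//; nra.
have h4 : D ^+ 2 * (m / n) <= 2 * (D ^+ 2 / m).
  rewrite [leRHS]mulrCA ler_pM2l ?exprn_gt0// ler_pdivrMr// mulrAC.
  by rewrite ler_pdivlMr// -expr2.
have h5 : 0 < D / n by rewrite divr_gt0.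
have h6 : 0 < D ^+ 2 / m by rewrite divr_gt0 ?exprn_gt0.
by lra.
Qed.

(* Slicing along a shortest dual vector bounds the number of lattice points in
   any translate of a ball; the last two terms account for the cusp. *)
Lemma lattice_count (F : @frame R) (S : seq ivec) (D : R) : unif F -> uniq S ->
  1 <= D ->
  (forall z z', z \in S -> z' \in S -> qn F (subv z z') <= D ^+ 2) ->
  (size S)%:R <= 100 * (D ^+ 3 + D / lamF F + D ^+ 2 / lamF (dualf F)).
Proof.
move=> uF uS D1 HS; have uD := unif_dual uF.
have [w [v [u [x [[w0 v0 uw xv vw] [H1 H2 /andP[M0 M2] /andP[N0 N2]]]]]]] :=
  reduced_basis uF.
have D0 : 0 <= D by lra.
apply: le_trans (lattice_count_basis uF uw xv vw w0 v0 uS D0 HS) _.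
have lw := lamF_le uD w0; have lv := lamF_le uF v0.
set M := qn (dualf F) w in H1 H2 M0 M2 lw *; set N := qn F v in H1 H2 N0 N2 lv *.
have m0 : 0 < Num.sqrt M by rewrite sqrtr_gt0.
have n0 : 0 < Num.sqrt N by rewrite sqrtr_gt0.
have mE : Num.sqrt M ^+ 2 = M by rewrite sqr_sqrtr// ltW.
have nE : Num.sqrt N ^+ 2 = N by rewrite sqr_sqrtr// ltW.
set m := Num.sqrt M in lw m0 mE *; set n := Num.sqrt N in lv n0 nE *.
have l0 := lamF_gt0 uF; have l0' := lamF_gt0 uD.
have m2 : m <= 2.
  by clear -m0 mE M2; clearbody m M; rewrite leNgt; apply/negP => ?; nra.
have n2 : n <= 2.
  by clear -n0 nE N2; clearbody n N; rewrite leNgt; apply/negP => ?; nra.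
have mn : m ^+ 2 <= 2 * n.
  have n20 : 0 <= 2 * n by rewrite mulr_ge0// ltW.
  rewrite -ler_sqr ?nnegrE ?sqr_ge0// [(2 * n) ^+ 2]exprMn nE mE.
  by apply: le_trans H1 _; rewrite ler_pM2r// expr2; lra.
apply: le_trans (count_bound D1 m0 n0 m2 n2 mn) _.
rewrite ler_pM2l//; apply: lerD; first apply: lerD => //.
  by rewrite ler_pM2l ?lef_pV2 ?posrE//; lra.
by rewrite ler_pM2l ?exprn_gt0 ?lef_pV2 ?posrE//; lra.
Qed.

Lemma prim_pm (v z u : ivec) (i : int) : dotp u z = 1 -> z = scalev i v ->
  z = v \/ z = scalev (- 1) v.
Proof.
move=> uz zE; have : i * dotp u v = 1 by rewrite -dotp_scaler -zE.
move=> H; have : (i %| 1)%Z by apply/dvdzP; exists (dotp u v); rewrite mulrC.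
rewrite dvdz1 => i1; have : i = 1 \/ i = -1 by lia.
case=> iE; [left|right]; rewrite zE iE //.
by apply: vecP; rewrite /= mul1r.
Qed.

(** For primitive vectors in a centred ball the cusp term in [lamF F] disappears, since a line
    through the origin contains at most two of them. Hence the self-improvement involves the dual
    minimum alone. *)
Lemma lattice_count_primitive (F : @frame R) (S : seq ivec) (D : R) :
  unif F -> uniq S -> 1 <= D ->
  (forall z, z \in S -> (exists u, dotp u z = 1) /\ qn F z <= D ^+ 2) ->
  (size S)%:R <= 20 ^+ 3 * D ^+ 6 / lamF (dualf F).
Proof.
move=> uF uS D1 HS; have uD := unif_dual uF.
have [w [v [u [x [[w0 v0 uw xv vw] [H1 H2 /andP[M0 M2] /andP[N0 N2]]]]]]] :=
  reduced_basis uF.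
have D0 : 0 < D by lra.
have HS2 z z' : z \in S -> z' \in S -> qn F (subv z z') <= (2 * D) ^+ 2.
  move=> /HS[_ h1] /HS[_ h2]; rewrite /qn rv_sub.
  have : nrm F (subv (rv z) (rv z')) <= 2 * nrm F (rv z) + 2 * nrm F (rv z').
    rewrite -subr_ge0 (_ : _ - _ = nrm F (addv (rv z) (rv z'))) ?nrm_ge0//.
    rewrite /nrm /bil /=; ring.
  by move: h1 h2; rewrite /qn exprMn; lra.
have D20 : 0 <= 2 * D by lra.
have cnt := lattice_count_basis uF uw xv vw w0 v0 uS D20 HS2.
have cnt' := basis_count uF uw xv vw w0 v0 uS D20 HS2.
have lw := lamF_le uD w0.
have dz z : z \in S -> `|(dotp w z)%:~R : R| <= D * Num.sqrt (qn (dualf F) w).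
  move=> /HS[_ zD]; apply: norm_le_of_sqr.
    by rewrite mulr_ge0 ?sqrtr_ge0// ltW.
  rewrite dotpC -rv_dot exprMn sqr_sqrtr ?qn_ge0//.
  by apply: le_trans (dotp_cauchy _ _ uF) _; rewrite ler_wpM2r ?qn_ge0.
have lz z : dotp w z = 0 -> z \in S -> crossp v z != (0, 0, 0) ->
   Num.sqrt (qn (dualf F) w) <= D * Num.sqrt (qn F v).
  move=> zw zS cz; have E : crossp v z = scalev (dotp u (crossp v z)) w.
    by apply: crossp_orth => //; rewrite dotpC.
  have [j0|j0] := eqVneq (dotp u (crossp v z)) 0.
    by move: cz; rewrite E j0 => /eqP[]; apply: vecP; rewrite /= mul0r.
  rewrite -ler_sqr ?nnegrE ?mulr_ge0 ?sqrtr_ge0 ?(ltW D0)// exprMn.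
  rewrite !sqr_sqrtr ?qn_ge0//.
  have := lagrange F (rv v) (rv z); rewrite -rv_cross E.
  rewrite -/(qn F v) -/(qn F z) -/(qn (dualf F) _) qn_scale => L.
  have := int_sqr_ge1 j0 (R := R); set j2 : R := (dotp u (crossp v z))%:~R ^+ 2 in L * => j1.
  have [_ zD] := HS _ zS; have := sqr_ge0 (bil F (rv v) (rv z)).
  have : qn F v * qn F z <= D ^+ 2 * qn F v by rewrite mulrC ler_wpM2r// qn_ge0.
  have : qn (dualf F) w <= j2 * qn (dualf F) w by rewrite ler_peMl// qn_ge0.
  by lra.
set M := qn (dualf F) w in H1 H2 M0 M2 lw cnt cnt' dz lz *.
set N := qn F v in H1 H2 N0 N2 cnt cnt' lz *.
have m0 : 0 < Num.sqrt M by rewrite sqrtr_gt0.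
have n0 : 0 < Num.sqrt N by rewrite sqrtr_gt0.
have mE : Num.sqrt M ^+ 2 = M by rewrite sqr_sqrtr// ltW.
have nE : Num.sqrt N ^+ 2 = N by rewrite sqr_sqrtr// ltW.
set m := Num.sqrt M in lw m0 mE cnt cnt' dz lz *.
set n := Num.sqrt N in n0 nE cnt cnt' lz *.
have l0' := lamF_gt0 uD.
have m2 : m <= 2.
  by clear -m0 mE M2; clearbody m M; rewrite leNgt; apply/negP => ?; nra.
have n2 : n <= 2.
  by clear -n0 nE N2; clearbody n N; rewrite leNgt; apply/negP => ?; nra.
have mn : m ^+ 2 <= 2 * n.
  have n20 : 0 <= 2 * n by rewrite mulr_ge0// ltW.
  rewrite -ler_sqr ?nnegrE ?sqr_ge0// [(2 * n) ^+ 2]exprMn nE mE.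
  by apply: le_trans H1 _; rewrite ler_pM2r// expr2; lra.
suff : (size S)%:R <= 20 ^+ 3 * D ^+ 6 / m.
  move=> /le_trans; apply; rewrite ler_pM2l ?mulr_gt0 ?exprn_gt0//.
  by rewrite lef_pV2 ?posrE.
clearbody m n.
have D2 : D <= D ^+ 2 by rewrite expr2; nra.
have D6 : D ^+ 2 <= D ^+ 6.
  by apply: ler_weXn2l.
(* If D m >= 1 then also n >= 1 / (2 D^2), and every factor of the count is bounded by a power of D.
   If D m < 1 all points lie in the plane orthogonal to [w]. *)
have [Dm|Dm] := ltP (D * m) 1; last first.
  apply: le_trans cnt _.
  have n1 : 1 <= 2 * D ^+ 2 * n.
    have : 1 <= (D * m) ^+ 2 by rewrite expr2; nra.
    rewrite exprMn => h; apply: le_trans h _.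
    by rewrite (_ : 2 * D ^+ 2 * n = D ^+ 2 * (2 * n)) ?ler_pM2l ?exprn_gt0//; ring.
  have a1 : 1 + 2 * (2 * D * m) <= 9 * D by nra.
  have a2 : 1 + 2 * (2 * D * n / m) <= 9 * D ^+ 2.
    rewrite mulrA -[X in X + _]((divff (x := m)) _) ?gt_eqF// -mulrDl.
    rewrite ler_pdivrMr//.
    have : D * n <= D * 2 by rewrite ler_pM2l.
    have : D ^+ 2 * m = D * (D * m) by ring.
    have : D * 1 <= D * (D * m) by rewrite ler_pM2l.
    by nra.
  have a3 : 1 + 2 * (2 * D / n) <= 9 * D ^+ 3.
    rewrite mulrA -[X in X + _]((divff (x := n)) _) ?gt_eqF// -mulrDl.
    rewrite ler_pdivrMr//.
    have : D * 1 <= D * (2 * D ^+ 2 * n) by rewrite ler_pM2l.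
    have : D * (2 * D ^+ 2 * n) = 2 * D ^+ 3 * n by ring.
    by nra.
  have p1 : 0 <= 2 * D * m by rewrite !mulr_ge0// ltW.
  have p2 : 0 <= 2 * D * n / m by rewrite !mulr_ge0// ?invr_ge0 ltW.
  have p3 : 0 <= 2 * D / n by rewrite !mulr_ge0// ?invr_ge0 ltW.
  have : (1 + 2 * (2 * D * m)) *
    ((1 + 2 * (2 * D * n / m)) * (1 + 2 * (2 * D / n))) <=
    9 * D * (9 * D ^+ 2 * (9 * D ^+ 3)).
    apply: ler_pM => //; [clear -p1; lra|apply: mulr_ge0; clear -p2 p3; lra|].
    by apply: ler_pM => //; clear -p2 p3; lra.
  move=> /le_trans; apply.
  rewrite ler_pdivlMr// (_ : _ * m = D ^+ 6 * (9 ^+ 3 * m)); last by ring.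
  rewrite [leRHS]mulrC ler_pM2l ?exprn_gt0//; clear -m0 m2; lra.
have k0 z : z \in S -> dotp w z = 0.
  by move=> /dz h; apply: int_small (le_lt_trans h Dm).
(* One point off the line of [v] forces m <= D n, which absorbs the 1 in the row count; otherwise
   only [v] and its opposite can occur. *)
have [/hasP[z zS cz]|] := boolP (has (fun z => crossp v z != (0, 0, 0)) S).
  have mDn := lz _ (k0 _ zS) zS cz.
  have := cnt' 0; have -> : [seq z <- S | dotp w z == 0] = S.
    by apply/all_filterP/allP => y yS; rewrite k0.
  move=> /le_trans; apply.
  have a2 : 1 + 2 * (2 * D * n / m) <= 5 * (D * n) / m.
    rewrite mulrA -[X in X + _]((divff (x := m)) _) ?gt_eqF// -mulrDl.
    by rewrite ler_pM2r ?invr_gt0//; clear -mDn; lra.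
  have p3 : 0 <= 2 * D / n by rewrite !mulr_ge0// ?invr_ge0 ltW.
  apply: (@le_trans _ _ (5 * (D * n) / m * (1 + 2 * (2 * D / n)))).
    by apply: ler_wpM2r => //; clear -p3; lra.
  rewrite (_ : _ * _ = (5 * D * n + 20 * D ^+ 2) / m); last first.
    by field; rewrite !gt_eqF.
  rewrite ler_pM2r ?invr_gt0//.
  have : D * n <= D * 2 by rewrite ler_pM2l.
  by move: D2 D6 D1; clear; lra.
rewrite -all_predC => /allP A.
have sub : {subset S <= [:: v; scalev (-1) v]}.
  move=> z zS; have := A z zS; rewrite /= negbK => /eqP cz.
  have [[u' uz] _] := HS _ zS.
  have := prim_pm uz (crossp0_prop xv cz); rewrite !inE.
  by case=> /eqP ->; rewrite ?orbT.
have := uniq_leq_size uS sub => /= s2.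
apply: (@le_trans _ _ 2); first by rewrite -[2]/(2%:R) ler_nat.
rewrite ler_pdivlMr//.
have : 1 <= D ^+ 6 by apply: exprn_ege1.
by lra.
Qed.

Lemma nrm_addv (F : @frame R) a b :
  nrm F (addv a b) <= 2 * nrm F a + 2 * nrm F b.
Proof.
rewrite -subr_ge0 (_ : _ - _ = nrm F (subv a b)) ?nrm_ge0//.
rewrite /nrm /bil /=; ring.
Qed.

(** Riesz representation of the linear form [dotp _ w] for the inner product [bil F]. *)
Lemma dual_direction (F : @frame R) (w : R * R * R) : unif F ->
  exists om, nrm F om = nrm (dualf F) w /\ forall z, bil F om z = dotp z w.
Proof.
case: F => A B E a b c [/= a0 b0 c0 abc].
pose X0 := (b * c) ^+ 2 * (w.2 - A * w.1.2 + (A * B - E) * w.1.1).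
pose X1 := (a * c) ^+ 2 * (w.1.2 - B * w.1.1).
pose X2 := (a * b) ^+ 2 * w.1.1.
exists (X0, X1 - A * X0, X2 - B * (X1 - A * X0) - E * X0).
have e1 : a ^+ 2 * (b * c) ^+ 2 = 1 by rewrite -exprMn mulrA abc expr1n.
have e2 : b ^+ 2 * (a * c) ^+ 2 = 1.
  by rewrite -exprMn mulrCA mulrA abc expr1n.
have e3 : c ^+ 2 * (a * b) ^+ 2 = 1 by rewrite -exprMn mulrC abc expr1n.
have H z : bil (Frame A B E a b c) (X0, X1 - A * X0, X2 - B * (X1 - A * X0) - E * X0)
    z = dotp z w.
  rewrite /bil /=.
  transitivity (a ^+ 2 * (b * c) ^+ 2 * (z.1.1 * (w.2 - A * w.1.2 + (A * B - E) * w.1.1))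
   + b ^+ 2 * (a * c) ^+ 2 * ((z.1.2 + A * z.1.1) * (w.1.2 - B * w.1.1))
   + c ^+ 2 * (a * b) ^+ 2 * ((z.2 + B * z.1.2 + E * z.1.1) * w.1.1)).
    by rewrite /X0 /X1 /X2; ring.
  by rewrite e1 e2 e3 /dotp; ring.
split => //; rewrite /nrm H /dotp /bil /= /X0 /X1 /X2; ring.
Qed.

Lemma near_int (t : R) : exists n : int, (t - n%:~R) ^+ 2 <= 4^-1.
Proof.
exists (Num.floor (t + 2^-1)).
have n1 : (Num.floor (t + 2^-1))%:~R <= t + 2^-1 by exact: floor_le_tmp.
have n2 := floorD1_gt (t + 2^-1); rewrite intrD in n2.
by move: n1 n2; set n := _%:~R; clearbody n => *; nra.
Qed.

(* Bounded covering radius, by reducing modulo a short basis. *)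
Lemma lattice_cover (F : @frame R) (c : R) : unif F -> 0 < c <= 1 ->
  (forall v, v != (0, 0, 0) -> c ^+ 2 <= qn F v) ->
  forall t, exists z, nrm F (subv (rv z) t) <= 7 / c ^+ 4.
Proof.
move=> uF /andP[c0 c1] Hc t; have uD := unif_dual uF.
have [w [v [u [x [[w0 v0 uw xv vw] [H1 H2 /andP[M0 M2] /andP[N0 N2]]]]]]] :=
  reduced_basis uF.
have Nc := Hc _ v0.
(* [v'] completes [v] to a reduced basis of the plane orthogonal to [w]. *)
have [n1 n1P] := near_int (bil F (rv v) (rv (crossp x w)) / qn F v).
pose v' := subv (crossp x w) (scalev n1 v).
have cb : crossp v v' = w.
  rewrite crossp_subr crossp_scaler crosspp crossp_crossp xv (dotpC w) vw.
  by apply: vecP; rewrite /=; ring.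
have Nv' : qn F v' * c ^+ 2 <= 2 * c ^+ 2 + 2.
  have L := lagrange F (rv v) (rv v'); rewrite -rv_cross cb in L.
  have bE : bil F (rv v) (rv v') =
     (bil F (rv v) (rv (crossp x w)) / qn F v - n1%:~R) * qn F v.
    by rewrite rv_sub rv_scale bil_subr bil_scaler mulrBl divfK// gt_eqF.
  move: L; rewrite bE exprMn -/(qn F v) -/(qn F v') -/(qn (dualf F) w).
  set d := (_ - _) ^+ 2 in n1P *; set N := qn F v in N0 N2 Nc *.
  set M := qn _ w in M0 M2 *; set N' := qn F v' => L.
  have : d * N ^+ 2 <= 4^-1 * N ^+ 2 by rewrite ler_wpM2r// sqr_ge0.
  have N'0 : 0 <= N' by exact: qn_ge0.
  move=> h; have hN : N * N' <= 4^-1 * N ^+ 2 + 2 by lra.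
  have h2 : N' * c ^+ 2 <= N * N' by rewrite mulrC ler_wpM2r.
  have [N1|N1] := leP N 1.
    have : 4^-1 * N ^+ 2 <= 4^-1 * N by rewrite expr2; nra.
    move=> h3; have : N * (N' - 4^-1) <= 2 by lra.
    have [le|lt] := leP N' 2; first by nra.
    by nra.
  have : N' <= 4^-1 * N + 2.
    rewrite -(ler_pM2l N0); apply: le_trans hN _.
    by rewrite expr2; nra.
  move=> h3; have : N' <= 5 / 2 by lra.
  have : c ^+ 2 <= 1 by rewrite expr2; nra.
  have : 0 < c ^+ 2 by rewrite exprn_gt0.
  by nra.
have Mc : c ^+ 4 <= 2 * qn (dualf F) w.
  apply: le_trans H2; rewrite (exprM c 2 2) ler_sqr ?nnegrE ?sqr_ge0//.
  exact: ltW.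
(* The target is first moved along [om], normal to the layers of [w], to the nearest layer of
   integral height; the two coordinates left in the basis [v], [v'] are then rounded. *)
have [om [oN ob]] := dual_direction (rv w) uF.
have [k kP] := near_int (dotp t (rv w)).
set e := dotp t (rv w) - k%:~R in kP.
pose t1 := subv t (scalev (e / qn (dualf F) w) om).
have ow : dotp om (rv w) = qn (dualf F) w by rewrite -ob.
have t1w : dotp t1 (rv w) = k%:~R.
  by rewrite dotp_subl dotp_scalel ow divfK ?gt_eqF// /e; ring.
pose t2 := subv t1 (rv (scalev k u)).
have t2w : dotp t2 (rv w) = 0.
  by rewrite dotp_subl t1w rv_scale dotp_scalel rv_dot uw mulr1 subrr.
have D1 : dotp (rv u) (crossp (rv v) (rv v')) = 1 :> R.
  by rewrite -rv_cross cb rv_dot uw.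
have := cramer t2 D1; rewrite -[in X in scalev X (rv u)]rv_cross cb t2w.
set y := dotp t2 _; set y' := dotp t2 _ => t2E.
have [i iP] := near_int y; have [i' i'P] := near_int y'.
exists (addv (scalev k u) (addv (scalev i v) (scalev i' v'))).
have -> : subv (rv (addv (scalev k u) (addv (scalev i v) (scalev i' v')))) t =
  addv (scalev (- (e / qn (dualf F) w)) om)
   (addv (scalev (i%:~R - y) (rv v)) (scalev (i'%:~R - y') (rv v'))).
  have tE : t = addv (scalev (e / qn (dualf F) w) om)
     (addv (rv (scalev k u)) t2).
    by rewrite /t2 /t1; apply: vecP; rewrite /=; ring.
  rewrite {1}tE t2E !rv_add !rv_scale; apply: vecP; rewrite /=; ring.
apply: le_trans (nrm_addv _ _ _) _.
have h1 : nrm F (scalev (- (e / qn (dualf F) w)) om) * c ^+ 4 <= 1 / 2.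
  rewrite nrm_scale sqrrN expr_div_n oN -/(qn (dualf F) w).
  set M := qn _ w in M0 Mc *.
  rewrite (_ : _ * _ * _ = e ^+ 2 * (c ^+ 4 / M)); last first.
    by field; rewrite gt_eqF.
  have : c ^+ 4 / M <= 2 by rewrite ler_pdivrMr.
  have : 0 <= c ^+ 4 / M by rewrite mulr_ge0 ?exprn_ge0 ?invr_ge0 ?ltW.
  have := sqr_ge0 e; clear -kP; move: kP.
  by set a := e ^+ 2; set b := c ^+ 4 / M; clearbody a b; nra.
have h2 : nrm F (addv (scalev (i%:~R - y) (rv v)) (scalev (i'%:~R - y') (rv v'))) <=
   1 + 2^-1 * qn F v'.
  apply: le_trans (nrm_addv _ _ _) _; rewrite !nrm_scale.
  rewrite -(sqrrN (i%:~R - y)) opprB -(sqrrN (i'%:~R - y')) opprB.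
  have : (y - i%:~R) ^+ 2 * nrm F (rv v) <= 4^-1 * nrm F (rv v).
    by rewrite ler_wpM2r// nrm_ge0.
  have : (y' - i'%:~R) ^+ 2 * nrm F (rv v') <= 4^-1 * nrm F (rv v').
    by rewrite ler_wpM2r// nrm_ge0.
  by move: N2; rewrite /qn; lra.
have c4 : 0 < c ^+ 4 by rewrite exprn_gt0.
rewrite ler_pdivlMr// mulrDl -mulrA.
have c2 : c ^+ 2 <= 1 by rewrite expr2; nra.
have c20 : 0 < c ^+ 2 by rewrite exprn_gt0.
have h3 : nrm F (addv (scalev (i%:~R - y) (rv v)) (scalev (i'%:~R - y') (rv v'))) *
   c ^+ 4 <= 3.
  rewrite (exprM c 2 2) (expr2 (c ^+ 2)) mulrA.
  move: h2; set X := nrm F _ => h2.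
  have X0 : 0 <= X by exact: nrm_ge0.
  have : X * c ^+ 2 <= (1 + 2^-1 * qn F v') * c ^+ 2 by rewrite ler_wpM2r// ltW.
  move=> h; have h4 : X * c ^+ 2 <= c ^+ 2 + 2^-1 * (qn F v' * c ^+ 2) by lra.
  have h5 : X * c ^+ 2 <= 3 by lra.
  have : X * c ^+ 2 * c ^+ 2 <= (2 * c ^+ 2 + 1) * c ^+ 2.
    by apply: ler_wpM2r; [exact: ltW|lra].
  move=> /le_trans; apply; clear -c2 c20.
  by set a := c ^+ 2 in c2 c20 *; clearbody a; nra.
(* The two parts contribute 2 * 1/2 and 2 * 3, whence the constant 7. *)
rewrite -[2 * nrm F (addv _ _) * _]mulrA; move: h1 h3; lra.
Qed.

End Counting.

(** * Averages of inverse minima *)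

Section PowerSums.
Context {R : realType}.

Lemma ler_sum_mem (I : eqType) (r : seq I) (F G : I -> R) :
  (forall i, i \in r -> F i <= G i) -> \sum_(i <- r) F i <= \sum_(i <- r) G i.
Proof.
by move=> H; rewrite big_seq [leRHS]big_seq; apply: ler_sum.
Qed.

Lemma powRDp (x r s : R) : 0 < x -> x `^ (r + s) = x `^ r * x `^ s.
Proof. by move=> x0; rewrite powRD// (gt_eqF x0) implybT. Qed.

(** Concavity of x^b. With y the right-hand side, y = b x + (1 - b), so averaging ln t <= t - 1 at t
    = x / y and t = 1 / y with weights b and 1 - b gives b ln x <= ln y. *)
Lemma powR_le_tangent (x b : R) : 0 < x -> 0 <= b <= 1 ->
  x `^ b <= 1 + b * (x - 1).
Proof.
move=> x0 /andP[b0 b1]; set y := 1 + b * (x - 1).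
have y0 : 0 < y.
  rewrite /y; have [|] := leP 1 x => h; first by nra.
  by have [->|bn] := eqVneq b 1; [lra|have : b < 1 by rewrite lt_def eq_sym bn]; nra.
rewrite -ler_ln ?posrE ?powR_gt0// ln_powR.
have h1 : ln (x / y) <= x / y - 1.
  have {1}-> : x / y = 1 + (x / y - 1) by ring.
  by apply: le_ln1Dx; rewrite ltrBrDr addNr divr_gt0.
have h2 : ln (1 / y) <= 1 / y - 1.
  have {1}-> : 1 / y = 1 + (1 / y - 1) by ring.
  by apply: le_ln1Dx; rewrite ltrBrDr addNr divr_gt0.
rewrite !ln_div ?posrE// ln1 in h1 h2.
have e : b * (x / y - 1) + (1 - b) * (1 / y - 1) = 0.
  have -> : b * (x / y - 1) + (1 - b) * (1 / y - 1) = (b * x + (1 - b)) / y - 1 by ring.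
  by rewrite (_ : b * x + (1 - b) = y) ?divff ?gt_eqF ?subrr// /y; ring.
have := ler_wpM2l b0 h1.
have b1' : 0 <= 1 - b by lra.
have := ler_wpM2l b1' h2.
by move: e; lra.
Qed.

(** Comparison with the integral of x^(-a), by induction on N with the tangent bound as increment
    estimate. *)
Lemma powsum (a : R) (N : nat) : 0 <= a < 1 ->
  \sum_(1 <= n < N.+1) n%:R `^ (- a) <= N%:R `^ (1 - a) / (1 - a).
Proof.
move=> /andP[a0 a1]; have c0 : 0 < 1 - a by lra.
elim: N => [|N IH].
  by rewrite big_geq// divr_ge0 ?powR_ge0// ltW.
rewrite big_nat_recr//=; apply: le_trans (lerD IH (lexx _)) _.
case: N {IH} => [|N].
  rewrite powR0 ?gt_eqF// mul0r add0r !powR1 ler_pdivlMr// mul1r; lra.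
set x : R := N.+1%:R; set y : R := N.+2%:R.
have x0 : 0 < x by rewrite ltr0n.
have y0 : 0 < y by rewrite ltr0n.
have xy : x / y = 1 - y^-1.
  have yE : y = x + 1 by rewrite /y /x natr1.
  by rewrite yE; field; rewrite gt_eqF//; lra.
have h : x `^ (1 - a) <= y `^ (1 - a) - (1 - a) * y `^ (- a).
  have -> : x = y * (x / y) by rewrite mulrC divfK ?gt_eqF.
  rewrite powRM ?(ltW y0) ?divr_ge0 ?(ltW x0) ?(ltW y0)//.
  have -> : y `^ (- a) = y `^ (1 - a) * y^-1.
    rewrite -(powR_inv1 (ltW y0)) -powRDp//.
    by congr (_ `^ _); ring.
  rewrite (_ : _ - (1 - a) * _ = y `^ (1 - a) * (1 + (1 - a) * (x / y - 1))); last first.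
    by rewrite xy; ring.
  rewrite ler_pM2l ?powR_gt0//; apply: powR_le_tangent; first by rewrite divr_gt0.
  by apply/andP; split; lra.
rewrite -(ler_pM2r c0) mulrDl !divfK ?gt_eqF//; lra.
Qed.

Lemma min_powR (x y s : R) (z : R) : 0 <= x -> 0 <= y -> 0 <= s <= 1 ->
  z <= x -> z <= y -> 0 <= z -> z <= x `^ (1 - s) * y `^ s.
Proof.
move=> x0 y0 /andP[s0 s1] zx zy z0.
have -> : z = z `^ (1 - s) * z `^ s.
  by rewrite -powRD ?subrK ?powRr1// oner_eq0.
by apply: ler_pM; rewrite ?powR_ge0// ge0_ler_powR ?nnegrE//; lra.
Qed.

(** Abel summation: 1 / k is at most 1 / N plus the sum of 1 / n^2 for n from k to N, because 1 / n
    - 1 / (n + 1) <= 1 / n^2. *)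
Lemma abel_inv (T : eqType) (s : seq T) (k : T -> nat) (N : nat) (c : nat -> R) :
  (forall x, x \in s -> (1 <= k x <= N)%N) ->
  (forall n, (1 <= n <= N)%N -> (count (fun x => (k x <= n)%N) s)%:R <= c n) ->
  (forall n, 0 <= c n) ->
  \sum_(x <- s) (k x)%:R^-1 <= \sum_(1 <= n < N.+1) c n / n%:R ^+ 2 + c N / N%:R.
Proof.
move=> ks kc c0.
case: s ks kc => [|x0 s0] ks kc.
  rewrite big_nil addr_ge0 ?divr_ge0// sumr_ge0// => i _.
  by rewrite divr_ge0// exprn_ge0.
set s := x0 :: s0 in ks kc *.
have N0 : (0 < N)%N.
  by have := ks x0; rewrite inE eqxx => /(_ isT) /andP[a b]; exact: leq_trans b.
pose e (m n : nat) : R := if (m <= n)%N then (n%:R ^+ 2)^-1 else 0.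
have e0 m n : 0 <= e m n by rewrite /e; case: ifP => // _; rewrite invr_ge0 exprn_ge0.
have tel m : (1 <= m <= N)%N -> m%:R^-1 <= \sum_(1 <= n < N.+1) e m n + N%:R^-1.
  move=> /andP[m0 mN].
  have H : forall d, m%:R^-1 <= \sum_(1 <= n < m + d) e m n + (m + d)%:R^-1 :> R.
    elim=> [|d IH]; first by rewrite addn0 lerDr sumr_ge0.
    rewrite addnS big_nat_recr ?addn_gt0 ?m0//=; apply: le_trans IH _.
    rewrite -addrA lerD2l /e leq_addr.
    have md : 0 < (m + d)%:R :> R by rewrite ltr0n addn_gt0 m0.
    rewrite -[(m + d).+1%:R]natr1; set X : R := (m + d)%:R in md *.
    rewrite -lerBlDr.
    have -> : X^-1 - (X + 1)^-1 = (X * (X + 1))^-1.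
      by field; rewrite !gt_eqF//; lra.
    rewrite lef_pV2 ?posrE ?exprn_gt0 ?mulr_gt0//; last by lra.
    by rewrite expr2 ler_pM2l//; lra.
  have := H (N - m)%N; rewrite subnKC// => /le_trans; apply.
  by rewrite big_nat_recr//= -addrA lerD2l lerDr.
have h : \sum_(x <- s) (k x)%:R^-1 <=
    \sum_(x <- s) (\sum_(1 <= n < N.+1) e (k x) n + N%:R^-1).
  by apply: ler_sum_mem => x xs; apply: tel; exact: ks.
apply: (le_trans h); rewrite big_split/= exchange_big/=; apply: lerD.
  rewrite big_nat [leRHS]big_nat; apply: ler_sum => n; rewrite ltnS => nN.
  rewrite /e -big_mkcond/= big_const_seq iter_addr addr0.
  rewrite -[(_ ^- 2) *+ _]mulr_natl.
  by rewrite ler_wpM2r ?invr_ge0 ?exprn_ge0// kc.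
rewrite big_const_seq count_predT iter_addr addr0 -[_ *+ _]mulr_natl.
rewrite ler_wpM2r ?invr_ge0//.
have := kc N; rewrite N0 leqnn => /(_ isT); rewrite (_ : count _ _ = size s)//.
by apply/eqP; rewrite -all_count; apply/allP => x /ks/andP[].
Qed.

End PowerSums.

(** * Moving frames along a curve and the self-improving average *)

Section Systems.
Context {R : realType}.

(** A curve with dE = A dB, so that the form [X2] has derivative B' X1 along it. Finite differences
    with a quadratic error are the form in which points get moved along the curve. *)
Definition csys (A B E : R -> R) (al be K : R) : Prop :=
  [/\ al < be, 1 <= K & forall x y, al <= x <= be -> al <= y <= be ->
    [/\ `|x - y| <= K * `|A x - A y|, `|A x - A y| <= K * `|x - y|,
        `|x - y| <= K * `|B x - B y|, `|B x - B y| <= K * `|x - y| &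
        `|E y - E x - A x * (B y - B x)| <= K * (x - y) ^+ 2]].

(** If dE = A dB then d(AB - E) = B dA, so the dual frames form a system of the same kind. The
    product of the increments of A and B adds the K^2. *)
Lemma csys_dual A B E al be K : csys A B E al be K ->
  csys (fun x => - B x) (fun x => - A x) (fun x => A x * B x - E x) al be
    (K ^+ 2 + K).
Proof.
move=> [ab K1 H]; have KK : K <= K ^+ 2 + K by rewrite lerDr sqr_ge0.
split => //; first by rewrite (le_trans K1).
move=> x y xJ yJ; have [h1 h2 h3 h4 h5] := H x y xJ yJ.
have neg a b : `|- a - - b| = `|a - b| :> R by rewrite opprK addrC distrC.
split; rewrite ?neg.
- by apply: (le_trans h3); rewrite ler_wpM2r.
- by apply: (le_trans h4); rewrite ler_wpM2r.
- by apply: (le_trans h1); rewrite ler_wpM2r.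
- by apply: (le_trans h2); rewrite ler_wpM2r.
rewrite (_ : _ - _ - _ = (A x - A y) * (B x - B y) -
   (E y - E x - A x * (B y - B x))); last by ring.
apply: (le_trans (ler_normB _ _)); rewrite [leRHS]mulrDl; apply: lerD => //.
rewrite normrM -[(x - y) ^+ 2]real_normK ?num_real// -exprMn expr2.
by apply: ler_pM.
Qed.

Definition X1 (A : R -> R) (x : R) (v : R * R * R) : R := v.1.2 + A x * v.1.1.
Definition X2 (B E : R -> R) (x : R) (v : R * R * R) : R :=
  v.2 + B x * v.1.2 + E x * v.1.1.

(** Norm at most 1 forces |q| <= Q, |X1| <= 1 and |X2| <= 1 / Q. *)
Definition fr (A B E : R -> R) (Q x : R) : frame :=
  Frame (A x) (B x) (E x) Q^-1 1 Q.

Lemma unif_fr A B E Q x : 0 < Q -> unif (fr A B E Q x).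
Proof. by move=> Q0; split; rewrite /= ?invr_gt0// mulr1 mulVf// gt_eqF. Qed.

Lemma dualf_fr A B E Q x : 0 < Q -> dualf (fr A B E Q x) =
  fr (fun x => - B x) (fun x => - A x) (fun x => A x * B x - E x) Q x.
Proof.
move=> Q0; rewrite /dualf /fr /= mulr1 mul1r; congr Frame.
by rewrite mulVf// gt_eqF.
Qed.

Lemma nrm_fr A B E Q x v : nrm (fr A B E Q x) v =
  (v.1.1 / Q) ^+ 2 + X1 A x v ^+ 2 + (Q * X2 B E x v) ^+ 2.
Proof. rewrite /nrm /bil /X1 /X2 /=; ring. Qed.

Lemma X1_move A B E al be K x y v : csys A B E al be K ->
  al <= x <= be -> al <= y <= be ->
  `|X1 A y v - X1 A x v| <= K * `|v.1.1| * `|x - y|.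
Proof.
move=> [_ _ H] xJ yJ; have [_ h _ _ _] := H x y xJ yJ.
rewrite (_ : _ - _ = - ((A x - A y) * v.1.1)); last by rewrite /X1; ring.
rewrite normrN normrM mulrAC; apply: ler_wpM2r => //.
Qed.

(** Taylor expansion to second order: the linear term carries [X1], and the remainder is the error
    allowed by [csys]. *)
Lemma X2_move A B E al be K x y v : csys A B E al be K ->
  al <= x <= be -> al <= y <= be ->
  `|X2 B E y v - X2 B E x v| <=
    K * `|X1 A x v| * `|x - y| + K * `|v.1.1| * `|x - y| ^+ 2.
Proof.
move=> [_ _ H] xJ yJ; have [_ _ _ h1 h2] := H x y xJ yJ.
rewrite (_ : _ - _ = - (X1 A x v * (B x - B y)) +
  v.1.1 * (E y - E x - A x * (B y - B x))); last by rewrite /X1 /X2; ring.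
apply: (le_trans (ler_normD _ _)); apply: lerD.
  by rewrite normrN normrM -mulrA mulrCA; apply: ler_wpM2l.
rewrite normrM (mulrC K) -mulrA; apply: ler_wpM2l => //.
by rewrite real_normK ?num_real.
Qed.

Definition gx (al Q : R) (i : nat) : R := al + i%:R / Q.
Definition ng (al be Q : R) : nat := (Num.truncn ((be - al) * Q)).+1.

Lemma gx_in al be Q i : al < be -> 0 < Q -> (i < ng al be Q)%N ->
  al <= gx al Q i <= be.
Proof.
move=> ab Q0; rewrite ltnS => iN; rewrite /gx lerDl divr_ge0 ?ler0n ?(ltW Q0)//=.
rewrite -lerBrDl ler_pdivrMr//.
have h : 0 <= (be - al) * Q by rewrite mulr_ge0 ?(ltW Q0)// subr_ge0 ltW.
by apply: le_trans (_ : _ <= (Num.truncn ((be - al) * Q))%:R) _;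
  rewrite ?ler_nat// truncn_le.
Qed.

Lemma gx_near al be Q x : 0 < Q -> al <= x <= be ->
  exists2 i, (i < ng al be Q)%N & `|x - gx al Q i| <= Q^-1.
Proof.
move=> Q0 /andP[ax xb]; exists (Num.truncn ((x - al) * Q)).
  by rewrite ltnS le_truncn// ler_pM2r// lerD2r.
have h : 0 <= (x - al) * Q by rewrite mulr_ge0 ?(ltW Q0)// subr_ge0.
set t := Num.truncn _.
have t1 : t%:R <= (x - al) * Q by rewrite truncn_le.
have t2 : (x - al) * Q < t.+1%:R by rewrite -truncn_le_nat.
have -> : x - gx al Q t = ((x - al) * Q - t%:R) / Q.
  by rewrite /gx; field; rewrite gt_eqF.
rewrite normrM [`|Q^-1|]gtr0_norm ?invr_gt0// ler_piMl ?invr_ge0 ?(ltW Q0)//.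
by rewrite ger0_norm ?subr_ge0// lerBlDl -natr1 in t2 *; exact: ltW.
Qed.

Lemma ng_le al be Q : al < be -> 1 <= Q -> (ng al be Q)%:R <= (be - al + 1) * Q.
Proof.
move=> ab Q1; rewrite /ng -natr1 [leRHS]mulrDl mul1r; apply: lerD => //.
by rewrite truncn_le mulr_ge0 ?subr_ge0; lra.
Qed.

Lemma lamF_fr_ge A B E Q x : 1 <= Q -> Q^-1 <= lamF (fr A B E Q x).
Proof.
move=> Q1; have Q0 : 0 < Q by lra.
have Qi : Q^-1 <= 1 by rewrite invf_le1.
have Qi0 : 0 < Q^-1 by rewrite invr_gt0.
apply: lamF_ge; first exact: ltW.
move=> v v0; rewrite /qn nrm_fr.
have [a0|a0] := eqVneq v.1.1 0; last first.
  rewrite -addrA; apply: ler_wpDr; first by rewrite addr_ge0// sqr_ge0.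
  by rewrite exprMn ler_peMl ?sqr_ge0// int_sqr_ge1.
have [b0|b0] := eqVneq v.1.2 0; last first.
  rewrite addrAC; apply: ler_wpDl; first by rewrite addr_ge0// sqr_ge0.
  rewrite /X1 /= a0 mulr0 addr0; apply: le_trans (int_sqr_ge1 b0).
  by rewrite expr2; nra.
apply: ler_wpDl; first by rewrite addr_ge0// sqr_ge0.
have c0 : v.2 != 0.
  by apply: contra v0; move: v a0 b0 => [[a b] c] /= -> -> /eqP ->.
rewrite /X2 /= a0 b0 !mulr0 !addr0 exprMn.
have := int_sqr_ge1 (R := R) c0; set c := _ ^+ 2 => c1.
have : Q^-1 ^+ 2 <= 1 by rewrite expr2; nra.
have : 1 <= Q ^+ 2 by rewrite expr2; nra.
by set q := Q ^+ 2; clearbody c q => *; nra.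
Qed.

Definition invlam_sum A B E al be Q : R :=
  \sum_(i <- iota 0 (ng al be Q)) (lamF (fr A B E Q (gx al Q i)))^-1.

(** The average inverse minimum over the grid is known up to a factor Q^(b - 1). All systems are
    quantified over, because the induction passes to the dual one. *)
Definition lossy (b : R) : Prop := forall A B E al be K, csys A B E al be K ->
  exists2 C : R, 0 < C & forall Q, 1 <= Q ->
    invlam_sum A B E al be Q <= C * Q `^ b.

Lemma lossy2 : lossy 2.
Proof.
move=> A B E al be K [ab K1 H]; exists (be - al + 1); first by lra.
move=> Q Q1; have Q0 : 0 < Q by lra.
apply: (@le_trans _ _ (\sum_(i <- iota 0 (ng al be Q)) Q)).
  apply: ler_sum => i _; rewrite -[leRHS]invrK lef_pV2 ?posrE ?invr_gt0//.
    exact: lamF_fr_ge.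
  exact: lamF_gt0 (unif_fr _ _ _ _ Q0).
rewrite big_const_seq count_predT size_iota iter_addr addr0 -[_ *+ _]mulr_natl.
rewrite powR_mulrn ?(ltW Q0)// expr2 mulrA ler_pM2r//; exact: ng_le.
Qed.

(* Near a grid point x_i the primitive vectors lie in a fixed multiple of the
   unit ball at x_i, so they are counted by the dual minimum there. *)
Lemma primitive_count A B E al be K Y (S : seq ivec) : csys A B E al be K ->
  1 <= Y -> uniq S ->
  (forall v, v \in S -> [/\ exists u, dotp u v = 1, `|(v.1.1)%:~R : R| <= Y &
     exists x, [/\ al <= x <= be, `|X1 A x (rv v)| <= 1 &
                   `|X2 B E x (rv v)| <= Y^-1]]) ->
  (size S)%:R <= 20 ^+ 3 * (4 * K) ^+ 6 *
    invlam_sum (fun x => - B x) (fun x => - A x) (fun x => A x * B x - E x) al be Y.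
Proof.
move=> sys Y1 uS HS; have [ab K1 _] := sys; have Y0 : 0 < Y by lra.
have Hi v : exists i, v \in S -> (i < ng al be Y)%N /\
    qn (fr A B E Y (gx al Y i)) v <= (4 * K) ^+ 2.
  have [vS|vS] := boolP (v \in S); last by exists 0%N.
  have [_ vY [x [xJ x1 x2]]] := HS v vS.
  have [i iN xi] := gx_near Y0 xJ; exists i => _; split => //.
  have gJ := gx_in ab Y0 iN.
  rewrite /qn nrm_fr.
  have h1 := X1_move (rv v) sys xJ gJ; have h2 := X2_move (rv v) sys xJ gJ.
  have d0 : `|x - gx al Y i| * Y <= 1.
    by move: xi; rewrite -[Y^-1]mul1r ler_pdivlMr.
  set d := `|x - gx al Y i| in xi h1 h2 d0.
  have dd : 0 <= d by exact: normr_ge0.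
  set g := gx al Y i in gJ h1 h2 *.
  have KY : K * `|(rv v).1.1| * d <= K.
    rewrite -mulrA ler_piMr//; first by lra.
    apply: le_trans d0; rewrite mulrC ler_wpM2l//.
  have a1 : `|X1 A g (rv v)| <= 2 * K.
    have -> : X1 A g (rv v) = X1 A x (rv v) + (X1 A g (rv v) - X1 A x (rv v)) by ring.
    by apply: (le_trans (ler_normD _ _)); lra.
  have a2 : `|Y * X2 B E g (rv v)| <= 3 * K.
    rewrite normrM gtr0_norm// mulrC -ler_pdivlMr//.
    have -> : X2 B E g (rv v) = X2 B E x (rv v) + (X2 B E g (rv v) - X2 B E x (rv v)) by ring.
    apply: (le_trans (ler_normD _ _)).
    have b1 : K * `|X1 A x (rv v)| * d <= K * Y^-1.
      by apply: ler_pM => //; [rewrite mulr_ge0//; lra|rewrite ler_piMr//; lra].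
    have b2 : K * `|(rv v).1.1| * d ^+ 2 <= K * Y^-1.
      rewrite expr2 mulrA; apply: ler_pM => //.
      by rewrite !mulr_ge0//; lra.
    have b3 : Y^-1 <= K * Y^-1 by rewrite ler_peMl// invr_ge0 ltW.
    by rewrite -mulrA; lra.
  have a0 : `|(rv v).1.1 / Y| <= 1.
    by rewrite normrM normfV [`|Y|]gtr0_norm// ler_pdivrMr// mul1r.
  have sq (t b : R) : `|t| <= b -> t ^+ 2 <= b ^+ 2.
    by move=> tb; rewrite -[t ^+ 2]real_normK ?num_real// ler_sqr ?nnegrE// (le_trans _ tb).
  have := sq _ _ a0; have := sq _ _ a1; have := sq _ _ a2.
  have : 1 <= K ^+ 2 by rewrite expr2; nra.
  by rewrite !exprMn expr1n; lra.
have [gi giP] := choice Hi.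
rewrite mulr_sumr; apply: (@size_le_fibers _ _ _ S gi).
  by move=> v vS; have [iN _] := giP v vS; rewrite mem_iota.
move=> i; rewrite mem_iota /= add0n => iN.
rewrite -size_filter -dualf_fr//.
apply: lattice_count_primitive; first exact: unif_fr.
- exact: filter_uniq.
- by lra.
- move=> v; rewrite mem_filter => /andP[/eqP iE vS].
  have [_ q] := giP v vS; have [p _ _] := HS v vS.
  by rewrite iE in q.
Qed.

Lemma lam_small_coord A B E Q x (e : R) v : 0 < Q -> 0 < e ->
  qn (fr A B E Q x) v < e ^+ 2 ->
  [/\ `|(v.1.1)%:~R : R| <= Q * e, `|X1 A x (rv v)| <= e &
      `|X2 B E x (rv v)| <= e / Q].
Proof.
move=> Q0 e0; rewrite /qn nrm_fr => H.
have s1 := sqr_ge0 ((rv v).1.1 / Q); have s2 := sqr_ge0 (X1 A x (rv v)).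
have s3 := sqr_ge0 (Q * X2 B E x (rv v)).
have h1 : `|(rv v).1.1 / Q| <= e by apply: norm_le_of_sqr; [exact: ltW|lra].
have h2 : `|X1 A x (rv v)| <= e by apply: norm_le_of_sqr; [exact: ltW|lra].
have h3 : `|Q * X2 B E x (rv v)| <= e by apply: norm_le_of_sqr; [exact: ltW|lra].
split => //.
  by move: h1; rewrite normrM normfV [`|Q|]gtr0_norm// ler_pdivrMr// mulrC.
by move: h3; rewrite normrM (gtr0_norm Q0) ler_pdivlMr// mulrC.
Qed.

Lemma lam_small_v0 A B E Q x (e : R) v : 1 <= Q -> 0 < e <= 1 ->
  v != (0, 0, 0) -> qn (fr A B E Q x) v < e ^+ 2 -> v.1.1 != 0.
Proof.
move=> Q1 /andP[e0 e1] v0 H; apply/eqP => a0.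
have Q0 : 0 < Q by lra.
move: H; rewrite /qn nrm_fr /X1 /X2 /= a0 !mulr0 mul0r expr0n add0r !addr0 => H.
have e2 : e ^+ 2 <= 1 by rewrite expr2; nra.
have [b0|b0] := eqVneq v.1.2 0; last first.
  have := int_sqr_ge1 (R := R) b0.
  by have := sqr_ge0 (Q * ((v.2)%:~R + B x * (v.1.2)%:~R)); lra.
move: H; rewrite b0 mulr0 addr0 expr0n add0r exprMn => H.
have c0 : v.2 != 0.
  by apply: contra v0; move: v a0 b0 {H} => [[a b] c] /= -> -> /eqP ->.
have := int_sqr_ge1 (R := R) c0; have : 1 <= Q ^+ 2 by rewrite expr2; nra.
by move: H e2; set c := _%:~R ^+ 2; set q := Q ^+ 2; clearbody c q; nra.
Qed.

(** A small minimum is caused by a primitive vector. One with |v.1.1| = k is short only on a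
    parameter interval of length O(e / k), hence at O(Q e / k) grid points. As e <= 1, vectors with
    k <= n <= Q e satisfy |X2| <= 1 / n and are counted by [primitive_count] at scale n; Abel
    summation over k concludes. *)
Lemma small_lam_count A B E al be K b : csys A B E al be K ->
  1 < b <= 2 -> lossy b ->
  exists2 C : R, 0 < C & forall Q e, 1 <= Q -> 0 < e <= 1 ->
   (size [seq i <- iota 0 (ng al be Q) |
      lamF (fr A B E Q (gx al Q i)) < e])%:R <= C * (Q * e) `^ b.
Proof.
move=> sys /andP[b1 b2] Lb; have [ab K1 H] := sys.
have [C1 C10 HC1] := Lb _ _ _ _ _ _ (csys_dual sys).
pose C2 := 20 ^+ 3 * (4 * K) ^+ 6 * C1.
have C20 : 0 < C2 by rewrite !mulr_gt0 ?exprn_gt0//; clear -K1; lra.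
exists (5 * K * (C2 * ((b - 1)^-1 + 1))).
  rewrite !mulr_gt0//; try (clear -K1; lra).
  by rewrite addr_gt0// invr_gt0; clear -b1; lra.
move=> Q e Q1 e01; have /andP[e0 e1] := e01; have Q0 : 0 < Q by lra.
set S := [seq i <- _ | _].
have [S0|[i0 i0S]] : S = [::] \/ exists i0, i0 \in S.
  by case: (S) => [|i s]; [left|right; exists i; rewrite inE eqxx].
  rewrite S0 /= !mulr_ge0 ?powR_ge0//; try (clear -K1 C10; lra).
  by rewrite addr_ge0// invr_ge0; clear -b1; lra.
have Hv i : exists v : ivec, i \in S -> [/\ v != (0, 0, 0), exists u, dotp u v = 1 &
    qn (fr A B E Q (gx al Q i)) v < e ^+ 2].
  have [iS|iS] := boolP (i \in S); last by exists (0, 0, 0).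
  move: iS; rewrite mem_filter => /andP[li _].
  by have [v [u [v0 uv q]]] := lamF_lt (unif_fr _ _ _ _ Q0) e0 li; exists v => _; split => //; exists u.
have [vi viP] := choice Hv.
have iJ i : i \in S -> al <= gx al Q i <= be.
  by rewrite mem_filter mem_iota /= add0n => /andP[_]; apply: gx_in.
pose V := undup (map vi S).
have VP v : v \in V -> exists2 i, i \in S & v = vi i.
  by rewrite mem_undup => /mapP[i iS ->]; exists i.
have Vc v : v \in V -> [/\ v.1.1 != 0, exists u, dotp u v = 1,
    `|(v.1.1)%:~R : R| <= Q * e & exists x, [/\ al <= x <= be,
      `|X1 A x (rv v)| <= e & `|X2 B E x (rv v)| <= e / Q]].
  move=> /VP[i iS ->]; have [v0 pv q] := viP i iS.
  have [c0 c1 c2] := lam_small_coord Q0 e0 q.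
  split => //; first exact: lam_small_v0 q.
  by exists (gx al Q i); split => //; exact: iJ.
pose k (v : ivec) := absz v.1.1.
have kE v : (k v)%:R = `|(v.1.1)%:~R| :> R by rewrite /k -intr_norm -abszE -pmulrn.
have Qe0 : 0 < Q * e by rewrite mulr_gt0.
pose N := Num.truncn (Q * e).
have NQ : N%:R <= Q * e by rewrite truncn_le ltW.
have kN v : v \in V -> (1 <= k v <= N)%N.
  move=> /Vc[v0 _ vQ _]; apply/andP; split; first by rewrite /k absz_gt0.
  by rewrite leqNgt truncn_lt_nat ?(ltW Qe0)// -leNgt kE.
have step1 : (size S)%:R <= \sum_(v <- V) (5 * K * (Q * e)) * (k v)%:R^-1.
  apply: (@size_le_fibers _ _ _ S vi V).
    by move=> i iS; rewrite mem_undup map_f.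
  move=> v vV; rewrite -size_filter; set s := [seq x <- S | _].
  have k0 : 0 < (k v)%:R :> R.
    by rewrite ltr0n; have /andP[] := kN v vV.
  have kQ : (k v)%:R <= Q * e by have [_ _ h _] := Vc v vV; rewrite kE.
  have us : uniq (map Posz s).
    by rewrite map_inj_uniq ?filter_uniq ?iota_uniq// => x y [].
  have := @size_int_window R (map Posz s) (2 * K * (Q * e) / (k v)%:R) us.
  rewrite size_map => W.
  apply: le_trans (W _ _) _.
  - by rewrite divr_ge0// !mulr_ge0//; clear -K1 Q0 e0; lra.
  - move=> _ _ /mapP[i is_ ->] /mapP[j js ->].
    move: is_ js; rewrite (mem_filter _ i S) (mem_filter _ j S) => /andP[/eqP iE iS] /andP[/eqP jE jS].
    have [_ _ qi] := viP i iS; have [_ _ qj] := viP j jS.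
    rewrite iE in qi; rewrite jE in qj.
    have [_ ci _] := lam_small_coord Q0 e0 qi; have [_ cj _] := lam_small_coord Q0 e0 qj.
    have [h _ _ _ _] := H _ _ (iJ i iS) (iJ j jS).
    rewrite ler_pdivlMr//.
    have dE : gx al Q i - gx al Q j = (i%:R - j%:R) / Q.
      by rewrite /gx; ring.
    have -> : `|(Posz i - Posz j)%:~R| = `|gx al Q i - gx al Q j| * Q.
      rewrite dE normrM normfV [`|Q|]gtr0_norm// divfK ?gt_eqF//.
      by rewrite rmorphB /= -!pmulrn.
    have AA : (k v)%:R * `|A (gx al Q i) - A (gx al Q j)| <= 2 * e.
      rewrite kE -normrM.
      rewrite (_ : _ * _ = X1 A (gx al Q i) (rv v) - X1 A (gx al Q j) (rv v)).
        by apply: (le_trans (ler_normB _ _)); clear -ci cj; lra.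
      by rewrite /X1 /=; ring.
    rewrite mulrAC.
    apply: (@le_trans _ _ (K * `|A (gx al Q i) - A (gx al Q j)| * (k v)%:R * Q)).
      by rewrite ler_pM2r// ler_pM2r.
    rewrite (_ : 2 * K * (Q * e) = K * (2 * e) * Q); last by ring.
    rewrite ler_pM2r// -mulrA ler_wpM2l//; first by clear -K1; lra.
    by rewrite mulrC.
  (* The 1 of the window count is absorbed since k <= Q e, giving 5 = 1 + 4. *)
  - have : 1 <= K * (Q * e) / (k v)%:R.
      by rewrite ler_pdivlMr// mul1r (le_trans kQ)// ler_peMl// ltW.
    by lra.
apply: (le_trans step1); rewrite -mulr_sumr.
have cnt n : (1 <= n <= N)%N -> (count (fun v => (k v <= n)%N) V)%:R <= C2 * n%:R `^ b.
  move=> /andP[n1 nN]; rewrite -size_filter /C2 -[leRHS]mulrA.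
  have n1R : 1 <= n%:R :> R by rewrite ler1n.
  apply: (@le_trans _ _ (20 ^+ 3 * (4 * K) ^+ 6 * invlam_sum (fun x => - B x)
     (fun x => - A x) (fun x => A x * B x - E x) al be n%:R)); last first.
    by rewrite ler_pM2l; [exact: HC1|rewrite mulr_gt0 ?exprn_gt0//; clear -K1; lra].
  apply: primitive_count => //; first by rewrite filter_uniq ?undup_uniq.
  move=> v; rewrite mem_filter => /andP[kn vV].
  have [v0 pv vQ [x [xJ x1 x2]]] := Vc v vV.
  split => //; first by rewrite -kE ler_nat.
  exists x; split => //; first exact: le_trans x1 e1.
  apply: (le_trans x2).
  have nQ : n%:R <= Q * e by apply: le_trans NQ; rewrite ler_nat.
  rewrite -[n%:R^-1]mul1r ler_pdivlMr; last by clear -n1R; lra.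
  rewrite mulrAC ler_pdivrMr// mul1r.
  apply: (@le_trans _ _ (e * (Q * e))); first by rewrite ler_pM2l.
  rewrite mulrCA -expr2 ler_piMr//; first exact: ltW.
  by rewrite expr2; clear -e0 e1; nra.
have N1 : (1 <= N)%N.
  have vV : vi i0 \in V by rewrite mem_undup map_f.
  by have /andP[a b'] := kN _ vV; apply: leq_trans b'.
have NR : 0 < N%:R :> R by rewrite ltr0n.
have := abel_inv kN cnt (fun n => mulr_ge0 (ltW C20) (powR_ge0 _ _)).
move=> ab1.
have Qb : (Q * e) `^ b = (Q * e) * (Q * e) `^ (b - 1).
  rewrite -{2}(powRr1 (ltW Qe0)) -powRDp//.
  by congr (_ `^ _); ring.
rewrite Qb (_ : _ * (_ * _ `^ (b - 1)) = 5 * K * (Q * e) *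
  (C2 * (((b - 1)^-1 + 1) * (Q * e) `^ (b - 1)))); last by clearbody C2; ring.
rewrite ler_pM2l; last by rewrite !mulr_gt0//; clear -K1; lra.
apply: (le_trans ab1).
have pw n : (0 < n)%N -> C2 * n%:R `^ b / n%:R ^+ 2 = C2 * n%:R `^ (- (2 - b)).
  move=> n0; have nR : n%:R != 0 :> R by rewrite pnatr_eq0 -lt0n.
  rewrite -mulrA; congr (_ * _).
  rewrite -powR_mulrn// -powRB ?nR ?implybT//; congr (_ `^ _); ring.
have -> : \sum_(1 <= n < N.+1) C2 * n%:R `^ b / n%:R ^+ 2 =
    C2 * \sum_(1 <= n < N.+1) n%:R `^ (- (2 - b)).
  by rewrite mulr_sumr; apply: eq_big_nat => n /andP[n1 _]; exact: pw.
have -> : C2 * N%:R `^ b / N%:R = C2 * N%:R `^ (b - 1).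
  rewrite -mulrA; congr (_ * _).
  by rewrite -[X in _ / X](powRr1 (ltW NR)) -powRB// (gt_eqF NR) implybT.
rewrite -mulrDr ler_pM2l//.
have a01 : 0 <= 2 - b < 1 by apply/andP; split; clear -b1 b2; lra.
have := powsum N a01; have -> : 1 - (2 - b) = b - 1 by ring.
move=> ps; apply: (le_trans (lerD ps (lexx _))).
have NN : N%:R `^ (b - 1) <= (Q * e) `^ (b - 1).
  by apply: ge0_ler_powR; rewrite ?nnegrE ?ler0n//; clear -b1 Qe0; lra.
rewrite mulrDl mul1r; apply: lerD => //; rewrite mulrC ler_wpM2l// invr_ge0; clear -b1; lra.
Qed.

(** The number of grid points with minimum below 1 / n is both O(Q) and O((Q / n)^b). Its bound by
    the geometric mean with weight s, summed over n <= O(Q), gives Q^(2 - s); the condition b s < 1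
    makes the sum of n^(-b s) grow like Q^(1 - b s). *)
Lemma lossy_step b s : 1 < b <= 2 -> 0 <= s <= 1 -> b * s < 1 -> lossy b ->
  lossy (2 - s).
Proof.
move=> b12 s01 bs Lb A B E al be K sys; have [ab K1 _] := sys.
have /andP[b1 b2] := b12; have /andP[s0 s1] := s01.
have [C3 C30 HC3] := small_lam_count sys b12 Lb.
pose C4 := be - al + 1; have C40 : 0 < C4 by rewrite /C4; lra.
have cbs : 0 < 1 - b * s by lra.
exists (2 * C4 + C4 `^ (1 - s) * C3 `^ s * (2 `^ (1 - b * s) / (1 - b * s))).
  apply: addr_gt0; first by rewrite mulr_gt0.
  by rewrite !mulr_gt0 ?powR_gt0 ?invr_gt0.
move=> Q Q1; have Q0 : 0 < Q by lra.
pose Nq := (Num.truncn Q).+1.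
have QN : Q < Nq%:R by rewrite -truncn_le_nat.
have NQ2 : Nq%:R <= 2 * Q.
  rewrite /Nq -natr1; have : (Num.truncn Q)%:R <= Q by rewrite truncn_le ltW.
  by lra.
pose l i := lamF (fr A B E Q (gx al Q i)).
have lQ i : Q^-1 <= l i by exact: lamF_fr_ge.
have l0 i : 0 < l i by apply: lt_le_trans (lQ i); rewrite invr_gt0.
(* Layer-cake bound. The 2 pays for the fractional part and for the strict inequality, which misses
   one layer when the inverse minimum is an integer. *)
have layer i : (l i)^-1 <= 2 + \sum_(1 <= n < Nq.+1) (if l i < n%:R^-1 then 1 else 0).
  set t := (l i)^-1.
  have t0 : 0 < t by rewrite invr_gt0.
  have tQ : t <= Q by rewrite -[leRHS]invrK lef_pV2 ?posrE ?invr_gt0.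
  set k := Num.truncn t.
  have k1 : k%:R <= t by rewrite truncn_le ltW.
  have k2 : t < k.+1%:R by rewrite -truncn_le_nat.
  have kN : (k <= Nq)%N.
    rewrite ltnW// -(ltr_nat R); apply: le_lt_trans QN; lra.
  rewrite (@big_cat_nat _ _ _ k.-1.+1)//=; last by rewrite ltnS (leq_trans (leq_pred _) kN).
  have : \sum_(1 <= n < k.-1.+1) (if l i < n%:R^-1 then 1 else 0) = k.-1%:R :> R.
    transitivity (\sum_(1 <= n < k.-1.+1) (1 : R)).
      apply: eq_big_nat => n /andP[n1 nk]; rewrite ifT//.
      have nt : n%:R < t.
        by apply: lt_le_trans k1; rewrite ltr_nat; clear -n1 nk; lia.
      rewrite -[l i]invrK ltf_pV2 ?posrE//.
      by rewrite ltr0n.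
    by rewrite sumr_const_nat subn1.
  move=> ->; rewrite addrA.
  have : 0 <= \sum_(k.-1.+1 <= n < Nq.+1)
      (if l i < n%:R^-1 then 1 else 0) :> R.
    by apply: sumr_ge0 => n _; case: ifP.
  have : k%:R <= k.-1%:R + 1 :> R by rewrite natr1 ler_nat leqSpred.
  by move: k2; rewrite -natr1; lra.
rewrite /invlam_sum.
have step : \sum_(i <- iota 0 (ng al be Q)) (l i)^-1 <=
   \sum_(i <- iota 0 (ng al be Q))
     (2 + \sum_(1 <= n < Nq.+1) (if l i < n%:R^-1 then 1 else 0)).
  by apply: ler_sum => i _; exact: layer.
apply: (le_trans step); rewrite big_split exchange_big [leRHS]mulrDl.
have ngC : (ng al be Q)%:R <= C4 * Q by exact: ng_le.
have QQ : Q <= Q `^ (2 - s) by apply: le1r_powR => //; lra.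
apply: lerD.
  rewrite big_const_seq count_predT size_iota iter_addr addr0 -[_ *+ _]mulr_natl.
  apply: (@le_trans _ _ (C4 * Q * 2)); first by rewrite ler_pM2r.
  by rewrite (_ : C4 * Q * 2 = 2 * C4 * Q) ?ler_pM2l ?mulr_gt0//; ring.
have sz n : (1 <= n)%N -> \sum_(i <- iota 0 (ng al be Q))
    (if l i < n%:R^-1 then 1 else 0) <=
    C4 `^ (1 - s) * C3 `^ s * Q `^ (1 - s + b * s) * n%:R `^ (- (b * s)).
  move=> n1; have nR : 0 < n%:R :> R by rewrite ltr0n.
  have n01 : 0 < (n%:R^-1 : R) <= 1.
    by rewrite invr_gt0 nR/= invf_le1// ler1n.
  have := HC3 Q _ Q1 n01; rewrite size_filter => c1.
  rewrite -big_mkcond/= big_const_seq iter_addr addr0.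
  have c2 : (count (fun i => l i < n%:R^-1) (iota 0 (ng al be Q)))%:R <= C4 * Q.
    apply: le_trans ngC; rewrite ler_nat.
    by apply: (leq_trans (count_size _ _)); rewrite size_iota.
  have Qn0 : 0 < Q / n%:R by rewrite divr_gt0.
  have := min_powR (ltW (mulr_gt0 C40 Q0)) (ltW (mulr_gt0 C30 (powR_gt0 b Qn0)))
     s01 c2 c1 (ler0n _ _).
  move=> /le_trans; apply.
  have ni0 : 0 <= n%:R^-1 :> R by case/andP: n01 => /ltW.
  rewrite (@powRM R C4 Q _ (ltW C40) (ltW Q0)).
  rewrite (@powRM R C3 _ _ (ltW C30) (powR_ge0 _ _)) (@powRM R Q _ _ (ltW Q0) ni0).
  rewrite (@powRM R (Q `^ b) _ _ (powR_ge0 _ _) (powR_ge0 _ _)).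
  rewrite -!powRrM [Q `^ (1 - s + b * s)]powRDp//.
  rewrite -[n%:R^-1](powR_inv1 (ltW nR)) -powRrM mulN1r.
  rewrite le_eqVlt; apply/orP; left; apply/eqP; ring.
have step2 : \sum_(1 <= n < Nq.+1) \sum_(i <- iota 0 (ng al be Q))
    (if l i < n%:R^-1 then 1 else 0) <=
  \sum_(1 <= n < Nq.+1) C4 `^ (1 - s) * C3 `^ s * Q `^ (1 - s + b * s) *
    n%:R `^ (- (b * s)).
  by rewrite big_nat [leRHS]big_nat; apply: ler_sum => n /andP[n1 _]; exact: sz.
apply: (le_trans step2); rewrite -mulr_sumr.
have a01 : 0 <= b * s < 1 by rewrite bs andbT mulr_ge0//; lra.
have ps := powsum Nq a01.
have p0 : 0 < C4 `^ (1 - s) * C3 `^ s by rewrite mulr_gt0 ?powR_gt0.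
apply: (@le_trans _ _ (C4 `^ (1 - s) * C3 `^ s * Q `^ (1 - s + b * s) *
   ((2 * Q) `^ (1 - b * s) / (1 - b * s)))).
  rewrite ler_pM2l; last by rewrite mulr_gt0 ?powR_gt0.
  apply: (le_trans ps); rewrite ler_pM2r ?invr_gt0//.
  by apply: ge0_ler_powR; rewrite ?nnegrE ?ler0n//; lra.
rewrite (@powRM R 2 Q _ (ler0n _ 2) (ltW Q0)).
have -> : 2 - s = (1 - s + b * s) + (1 - b * s) by ring.
rewrite [Q `^ (_ + (1 - b * s))]powRDp//.
rewrite le_eqVlt; apply/orP; left; apply/eqP; ring.
Qed.

(** From b = 1 + 2 / m take s = (m - 1) / (m + 1): then b s = 1 - 2 / (m^2 + m) and 2 - s = 1 + 2 /
    (m + 1). The exponents 2, 5/3, 3/2, ... decrease to 1. *)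
Lemma lossy_all (e : R) : 0 < e -> lossy (1 + e).
Proof.
move=> e0.
have H : forall n, lossy (1 + 2 / n.+2%:R).
  elim=> [|n IH].
    rewrite (_ : 1 + 2 / 2%:R = 2); last by rewrite divff// -[1 + 1]/(1 *+ 2).
    exact: lossy2.
  pose m : R := n.+2%:R; have m2 : 2 <= m by rewrite /m ler_nat.
  have mE : n.+3%:R = m + 1 :> R by rewrite -natr1.
  have m10 : 0 < m + 1 by lra.
  have := @lossy_step (1 + 2 / m) ((m - 1) / (m + 1)).
  have -> : 2 - (m - 1) / (m + 1) = 1 + 2 / n.+3%:R.
    by rewrite mE; field; lra.
  apply => //.
  - apply/andP; split; first by rewrite ltrDl divr_gt0//; lra.
    rewrite (_ : 2 = 1 + 1)// lerD2l ler_pdivrMr; lra.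
  - by rewrite divr_ge0 ?ler_pdivrMr//=; lra.
  - rewrite (_ : (1 + 2 / m) * ((m - 1) / (m + 1)) = (m ^+ 2 + m - 2) / (m ^+ 2 + m)).
    2: have m0 : 0 < m by lra.
    2: have mm : 0 < m ^+ 2 + m by rewrite addr_gt0// exprn_gt0.
    2: by clearbody m; field; rewrite !gt_eqF.
    rewrite ltr_pdivrMr; first by lra.
    by nra.
move=> A B E al be K sys.
pose n := Num.truncn (2 / e).
have ne : 2 / n.+2%:R <= e.
  have h : 2 / e < n.+1%:R by rewrite -truncn_le_nat.
  rewrite ler_pdivrMr// mulrC -ler_pdivrMr//.
  apply: le_trans (ltW h) _; by rewrite ler_nat.
have [C C0 HC] := H n _ _ _ _ _ _ sys; exists C => // Q Q1.
apply: (le_trans (HC Q Q1)); by rewrite ler_pM2l//; apply: ler_powR => //; rewrite lerD2l.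
Qed.

End Systems.

(** * The sharp count *)

Section Sharp.
Context {R : realType}.

(** The inhomogeneous shift touches only the numerators. Differences of shifted points are plain
    lattice vectors, so counting in translated balls suffices. *)
Definition shiftv (t1 t2 : R) (v : ivec) : R * R * R := addv (rv v) (0, t1, t2).

Lemma X1_shift_sub A (x t1 t2 : R) (v w : ivec) :
  X1 A x (rv (subv v w)) = X1 A x (shiftv t1 t2 v) - X1 A x (shiftv t1 t2 w).
Proof. rewrite rv_sub /X1 /=; ring. Qed.

Lemma X2_shift_sub B E (x t1 t2 : R) (v w : ivec) :
  X2 B E x (rv (subv v w)) =
    X2 B E x (shiftv t1 t2 v) - X2 B E x (shiftv t1 t2 w).
Proof. rewrite rv_sub /X2 /=; ring. Qed.

Lemma sqr_le_of_norm (t b : R) : `|t| <= b -> t ^+ 2 <= b ^+ 2.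
Proof.
by move=> tb; rewrite -[t ^+ 2]real_normK ?num_real// ler_sqr ?nnegrE// (le_trans _ tb).
Qed.

Lemma grid_window (al a b q : R) (n : nat) : 0 < q -> a <= b ->
  (size [seq i <- iota 0 n | (a - q^-1 <= gx al q i) && (gx al q i <= b + q^-1)])%:R
  <= 5 + 2 * q * (b - a).
Proof.
move=> q0 ab; set s := [seq i <- _ | _].
have us : uniq (map Posz s).
  by rewrite map_inj_uniq ?filter_uniq ?iota_uniq// => x y [].
have := @size_int_window R (map Posz s) (q * (b - a) + 2) us.
rewrite size_map => W; apply: (le_trans (W _ _)); last by lra.
  by rewrite addr_ge0// mulr_ge0 ?subr_ge0// ltW.
move=> _ _ /mapP[i is_ ->] /mapP[j js ->].
move: is_ js; rewrite !mem_filter => /andP[/andP[i1 i2] _] /andP[/andP[j1 j2] _].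
have -> : (Posz i - Posz j)%:~R = (gx al q i - gx al q j) * q :> R.
  rewrite rmorphB /= -!pmulrn /gx; field; exact: lt0r_neq0.
rewrite normrM (gtr0_norm q0) -ler_pdivlMr// mulrDl [q * _]mulrC mulfK ?gt_eqF//.
by rewrite ler_norml; apply/andP; split; move: i1 i2 j1 j2; set u := q^-1; lra.
Qed.

Lemma move_bounds A B E al be K (s q x g t1 t2 : R) (v : ivec) :
  csys A B E al be K -> 0 < q -> 0 < s -> al <= x <= be -> al <= g <= be ->
  `|x - g| <= q^-1 -> `|(v.1.1)%:~R : R| <= 2 * (s * q) ->
  `|X1 A x (shiftv t1 t2 v)| <= s -> `|X2 B E x (shiftv t1 t2 v)| <= s / q ->
  `|X1 A g (shiftv t1 t2 v)| <= 3 * K * s /\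
  `|X2 B E g (shiftv t1 t2 v)| <= 4 * K * (s / q).
Proof.
move=> sys q0 s0 xJ gJ xg v0 x1 x2; have [_ K1 _] := sys.
have h1 := X1_move (shiftv t1 t2 v) sys xJ gJ.
have h2 := X2_move (shiftv t1 t2 v) sys xJ gJ.
have v00 : `|(shiftv t1 t2 v).1.1| <= 2 * (s * q) by rewrite /= addr0.
set w := shiftv t1 t2 v in x1 x2 h1 h2 v00 *.
set d := `|x - g| in xg h1 h2; have d0 : 0 <= d by exact: normr_ge0.
have K0 : 0 < K by lra.
have a1 : K * `|w.1.1| * d <= 2 * K * s.
  rewrite (_ : 2 * K * s = K * (2 * (s * q)) * q^-1); last by field; exact: lt0r_neq0.
  apply: ler_pM => //; first by rewrite mulr_ge0// ltW.
  by rewrite ler_pM2l.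
have Ks : s <= K * s by rewrite ler_peMl// ltW.
split.
  have -> : X1 A g w = X1 A x w + (X1 A g w - X1 A x w) by ring.
  by apply: (le_trans (ler_normD _ _)); lra.
have a2 : K * `|X1 A x w| * d <= K * (s / q).
  rewrite mulrA; apply: ler_pM => //; first by rewrite mulr_ge0// ltW.
  by rewrite ler_pM2l.
have a3 : K * `|w.1.1| * d ^+ 2 <= 2 * K * (s / q).
  rewrite expr2 [leLHS]mulrA [leRHS]mulrA; apply: ler_pM => //.
  by rewrite !mulr_ge0// ltW.
have Ksq : s / q <= K * (s / q) by rewrite ler_peMl// divr_ge0// ltW.
have -> : X2 B E g w = X2 B E x w + (X2 B E g w - X2 B E x w) by ring.
by apply: (le_trans (ler_normD _ _)); lra.
Qed.

(** Each point is charged to a grid point near its parameter. The main term sees only the grid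
    points near [a, b]; the cusp terms are summed over the whole grid and so do not shrink with b -
    a. *)
Lemma sharp_count_raw A B E al be K (s q a b t1 t2 : R) (S : seq ivec) :
  csys A B E al be K -> 1 <= q -> 1 <= s -> al <= a -> a <= b -> b <= be ->
  uniq S ->
  (forall v, v \in S -> `|(v.1.1)%:~R : R| <= 2 * (s * q) /\
     exists x, [/\ a <= x <= b, `|X1 A x (shiftv t1 t2 v)| <= s &
                   `|X2 B E x (shiftv t1 t2 v)| <= s / q]) ->
  (size S)%:R <= 100 * (11 * K) ^+ 3 * (s ^+ 3 * (5 + 2 * q * (b - a)) +
    s ^+ 2 * (invlam_sum A B E al be q + invlam_sum (fun x => - B x)
      (fun x => - A x) (fun x => A x * B x - E x) al be q)).
Proof.
move=> sys q1 s1 ala ab bbe uS HS; have [albe K1 _] := sys.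
have q0 : 0 < q by lra. have s0 : 0 < s by lra.
have Hi v : exists i, v \in S -> [/\ (i < ng al be q)%N,
   (a - q^-1 <= gx al q i) && (gx al q i <= b + q^-1),
   `|X1 A (gx al q i) (shiftv t1 t2 v)| <= 3 * K * s &
   `|X2 B E (gx al q i) (shiftv t1 t2 v)| <= 4 * K * (s / q)].
  have [vS|vS] := boolP (v \in S); last by exists 0%N.
  have [v0 [x [/andP[ax xb] x1 x2]]] := HS v vS.
  have xJ : al <= x <= be by apply/andP; split; lra.
  have [i iN xi] := gx_near q0 xJ; exists i => _.
  have gJ := gx_in albe q0 iN.
  have [m1 m2] := move_bounds sys q0 s0 xJ gJ xi v0 x1 x2; split => //.
  by move: xi; rewrite ler_norml => /andP[? ?]; apply/andP; split; lra.
have [gi giP] := choice Hi.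
set V := [seq i <- iota 0 (ng al be q) |
  (a - q^-1 <= gx al q i) && (gx al q i <= b + q^-1)].
pose l i := lamF (fr A B E q (gx al q i)).
pose l' i := lamF (dualf (fr A B E q (gx al q i))).
have uF i : unif (fr A B E q (gx al q i)) by exact: unif_fr.
have l0 i : 0 < l i by exact: lamF_gt0.
have l0' i : 0 < l' i by apply: lamF_gt0; exact: unif_dual.
(* The coordinates of a difference are at most 4 s, 6 K s and 8 K s, and 16 + 36 + 64 < 11^2. *)
pose D := 11 * K * s.
have D1 : 1 <= D.
  have : 1 * 1 <= K * s by apply: ler_pM.
  by rewrite /D -mulrA; lra.
have D0 : 0 < D by lra.
have step : (size S)%:R <= \sum_(i <- V) 100 * (D ^+ 3 + D / l i + D ^+ 2 / l' i).
  apply: (@size_le_fibers _ _ _ S gi).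
    by move=> v vS; have [iN w _ _] := giP v vS; rewrite mem_filter w mem_iota.
  move=> i iV; rewrite -size_filter; apply: lattice_count => //.
    exact: filter_uniq.
  move=> z z'; rewrite !mem_filter => /andP[/eqP zi zS] /andP[/eqP z'i z'S].
  have [_ _ z1 z2] := giP z zS; have [_ _ z1' z2'] := giP z' z'S.
  rewrite zi in z1 z2; rewrite z'i in z1' z2'.
  have [zq _] := HS z zS; have [zq' _] := HS z' z'S.
  rewrite /qn nrm_fr (X1_shift_sub _ _ t1 t2) (X2_shift_sub _ _ _ t1 t2).
  have b0 : `|(rv (subv z z')).1.1 / q| <= 4 * s.
    rewrite normrM normfV (gtr0_norm q0) ler_pdivrMr// /= rmorphB /=.
    by apply: (le_trans (ler_normB _ _)); lra.
  have b1 : `|X1 A (gx al q i) (shiftv t1 t2 z) - X1 A (gx al q i) (shiftv t1 t2 z')|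
     <= 6 * K * s.
    by apply: (le_trans (ler_normB _ _)); lra.
  have b2 : `|q * (X2 B E (gx al q i) (shiftv t1 t2 z) -
      X2 B E (gx al q i) (shiftv t1 t2 z'))| <= 8 * K * s.
    rewrite normrM (gtr0_norm q0) mulrC -ler_pdivlMr// -mulrA.
    by apply: (le_trans (ler_normB _ _)); lra.
  have := sqr_le_of_norm b0; have := sqr_le_of_norm b1; have := sqr_le_of_norm b2.
  rewrite /D !exprMn.
  have : 1 <= K ^+ 2 by rewrite expr2; nra.
  have s2 : 0 < s ^+ 2 by rewrite exprn_gt0.
  move=> K2; have : s ^+ 2 <= K ^+ 2 * s ^+ 2 by rewrite ler_peMl// ltW.
  by lra.
apply: (le_trans step); rewrite -mulr_sumr -[leRHS]mulrA ler_pM2l//.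
rewrite big_split big_split /=.
have sV (f : nat -> R) : (forall i, 0 <= f i) -> \sum_(i <- V) f i <=
    \sum_(i <- iota 0 (ng al be q)) f i.
  move=> f0; rewrite /V big_filter big_mkcond /=; apply: ler_sum => i _.
  by case: ifP.
have w1 : \sum_(i <- V) D ^+ 3 <= D ^+ 3 * (5 + 2 * q * (b - a)).
  rewrite big_const_seq count_predT iter_addr addr0 -[_ *+ _]mulr_natr.
  by rewrite ler_pM2l ?exprn_gt0//; exact: grid_window.
have w2 : \sum_(i <- V) D / l i <= D * invlam_sum A B E al be q.
  apply: (le_trans (sV _ _)); first by move=> i; rewrite divr_ge0// ltW.
  by rewrite -mulr_sumr.
have w3 : \sum_(i <- V) D ^+ 2 / l' i <= D ^+ 2 * invlam_sum (fun x => - B x)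
      (fun x => - A x) (fun x => A x * B x - E x) al be q.
  apply: (le_trans (sV _ _)); first by move=> i; rewrite divr_ge0 ?exprn_ge0// ltW.
  rewrite -mulr_sumr ler_pM2l ?exprn_gt0// /invlam_sum; apply: ler_sum => i _.
  by rewrite /l' dualf_fr.
have i0 : 0 <= invlam_sum A B E al be q.
  by apply: sumr_ge0 => i _; rewrite invr_ge0 ltW// l0.
have i0' : 0 <= invlam_sum (fun x => - B x)
      (fun x => - A x) (fun x => A x * B x - E x) al be q.
  apply: sumr_ge0 => i _; rewrite invr_ge0 ltW//.
  by apply: lamF_gt0; exact: unif_fr.
apply: (le_trans (lerD (lerD w1 w2) w3)).
set I1 := invlam_sum A B E al be q in i0 *.
set I2 := invlam_sum _ _ _ _ _ _ in i0' *.
rewrite [leRHS]mulrDr -addrA; apply: lerD.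
  by rewrite mulrA -exprMn.
have k11 : 1 <= 11 * K by lra.
have k1 : 11 * K <= (11 * K) ^+ 3 by rewrite -{1}[11 * K]expr1 ler_weXn2l.
have k2 : (11 * K) ^+ 2 <= (11 * K) ^+ 3 by rewrite ler_weXn2l.
have ss : s <= s ^+ 2 by rewrite expr2 ler_peMl// ltW.
rewrite [s ^+ 2 * _]mulrDr [leRHS]mulrDr; apply: lerD; rewrite mulrA ler_wpM2r//.
  by rewrite /D; apply: ler_pM => //; [lra|exact: ltW].
by rewrite /D exprMn; apply: ler_pM => //; rewrite exprn_ge0//; lra.
Qed.

(* The grid has mesh sqrt(d/Q): over such an arc the curve stays within O(d/Q)
   of its tangent line, and at scale sqrt(Q/d) the lattice is unimodular. *)
Lemma sharp_count A B E al be K (eta : R) : csys A B E al be K ->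
  2^-1 <= eta < 1 -> exists C tau : R, [/\ 0 < C, 0 < tau <= 8^-1 &
  forall (Q d a b t1 t2 : R) (S : seq ivec), 2 <= Q -> Q `^ (- eta) <= d -> d <= 2 ->
    al <= a -> a <= b -> b <= be -> uniq S ->
    (forall v, v \in S -> `|(v.1.1)%:~R : R| <= 2 * Q /\
       exists x, [/\ a <= x <= b, `|X1 A x (shiftv t1 t2 v)| <= Num.sqrt (d * Q) &
                   `|X2 B E x (shiftv t1 t2 v)| <= d]) ->
    (size S)%:R <= C * (d * Q ^+ 2) * ((b - a) + Q `^ (- tau))].
Proof.
move=> sys /andP[eta1 eta2]; have [albe K1 _] := sys.
(* This gives s >= Q^(2 tau): one factor Q^tau pays for the loss q^tau in the averages, the other
   leaves Q^(-tau) in the conclusion. *)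
have [tau tauE] : exists tau : R, tau = (1 - eta) / 4 by eexists.
have tau0 : 0 < tau by rewrite tauE; lra.
have e1 : 0 < tau by [].
have [C1 C10 HC1] := lossy_all e1 sys.
have [C2 C20 HC2] := lossy_all e1 (csys_dual sys).
exists (100 * (11 * K) ^+ 3 * (8 + C1 + C2)), tau; split.
- by rewrite !mulr_gt0 ?exprn_gt0//; lra.
- by rewrite tau0/= tauE; lra.
move=> Q d a b t1 t2 S Q2 dQ d2 ala ab bbe uS HS.
have Q0 : 0 < Q by lra. have Q1 : 1 <= Q by lra.
have d0 : 0 < d by apply: lt_le_trans dQ; rewrite powR_gt0.
pose s := Num.sqrt (d * Q); pose q := Num.sqrt (Q / d).
have dQ0 : 0 < d * Q by rewrite mulr_gt0.
have Qd0 : 0 < Q / d by rewrite divr_gt0.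
have s0 : 0 < s by rewrite sqrtr_gt0.
have q0 : 0 < q by rewrite sqrtr_gt0.
have s2 : s ^+ 2 = d * Q by rewrite sqr_sqrtr// ltW.
have q2 : q ^+ 2 = Q / d by rewrite sqr_sqrtr// ltW.
have sq : s * q = Q.
  rewrite /s /q -sqrtrM; last exact: ltW.
  rewrite (_ : d * Q * (Q / d) = Q ^+ 2); last by field; exact: lt0r_neq0.
  by rewrite sqrtr_sqr gtr0_norm.
have sdq : s / q = d.
  rewrite -[s]mulr1 -(divff (lt0r_neq0 q0)) mulrA sq -mulrA -invfM -expr2 q2.
  by field; rewrite !lt0r_neq0.
have sE : Q `^ (2 * tau) <= s.
  rewrite -ler_sqr ?nnegrE ?powR_ge0 ?(ltW s0)// s2 -powR_mulrn ?powR_ge0//.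
  rewrite -powRrM (_ : 2 * tau * 2%:R = - eta + 1); last by rewrite tauE; lra.
  by rewrite powRDp// powRr1 ?(ltW Q0)// ler_pM2r.
have s1 : 1 <= s.
  by apply: le_trans sE; rewrite -[X in X <= _](powRr0 Q); apply: ler_powR => //; lra.
have qQ : q <= Q by rewrite -sq ler_peMl// ltW.
have q1 : 1 <= q.
  rewrite -ler_sqr ?nnegrE ?(ltW q0)// expr1n q2 ler_pdivlMr// mul1r; lra.
have HS' v : v \in S -> `|(v.1.1)%:~R : R| <= 2 * (s * q) /\
     exists x, [/\ a <= x <= b, `|X1 A x (shiftv t1 t2 v)| <= s &
                   `|X2 B E x (shiftv t1 t2 v)| <= s / q].
  by rewrite sq sdq; exact: HS.
apply: (le_trans (sharp_count_raw sys q1 s1 ala ab bbe uS HS')).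
have i1 := HC1 q q1; have i2 := HC2 q q1.
rewrite -[leRHS]mulrA -[leRHS]mulrA ler_pM2l; last by rewrite mulr_gt0 ?exprn_gt0//; lra.
set I1 := invlam_sum A B E al be q in i1 *.
set I2 := invlam_sum _ _ _ _ _ _ in i2 *.
set T := Q `^ (- tau); have T0 : 0 < T by rewrite powR_gt0.
have TQ : Q `^ tau * T = 1 by rewrite /T -powRDp// addrN powRr0.
have f1 : 5 <= 8 * q * T.
  have : 5 * Q `^ tau <= 8 * q.
    pose r := Num.sqrt Q; have r2 : r ^+ 2 = Q by rewrite sqr_sqrtr// ltW.
    have r0 : 0 <= r by exact: sqrtr_ge0.
    have Qr : Q `^ tau <= r.
      rewrite /r -powR12_sqrt ?(ltW Q0)//; apply: ler_powR => //; rewrite tauE; lra.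
    apply: (@le_trans _ _ (5 * r)); first by rewrite ler_pM2l.
    rewrite -ler_sqr ?nnegrE ?mulr_ge0 ?(ltW q0)// !exprMn r2 q2.
    have : Q / 2 <= Q / d by rewrite ler_pM2l// lef_pV2 ?posrE.
    by lra.
  move=> h; have := ler_wpM2r (ltW T0) h.
  by rewrite -[5 * _ * T]mulrA TQ mulr1.
have f2 : q `^ (1 + tau) <= s * (q * T).
  rewrite powRDp// powRr1 ?(ltW q0)// mulrCA ler_pM2l//.
  apply: (@le_trans _ _ (Q `^ tau)).
    by apply: ge0_ler_powR; rewrite ?nnegrE ?(ltW q0) ?(ltW Q0) ?(ltW tau0).
  have := ler_wpM2r (ltW T0) sE; rewrite (_ : 2 * tau = tau + tau); last by ring.
  by rewrite powRDp// -[_ * Q `^ tau * T]mulrA TQ mulr1.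
have dE : d * Q ^+ 2 = s ^+ 3 * q.
  by rewrite -sq -sdq; field; exact: lt0r_neq0.
rewrite dE.
have s30 : 0 < s ^+ 3 by rewrite exprn_gt0.
have g1 : s ^+ 3 * (5 + 2 * q * (b - a)) <= s ^+ 3 * (8 * q * T + 2 * q * (b - a)).
  by rewrite ler_pM2l// lerD2r.
have g2 : s ^+ 2 * (I1 + I2) <= (C1 + C2) * (s ^+ 3 * (q * T)).
  rewrite (_ : (C1 + C2) * (s ^+ 3 * (q * T)) = s ^+ 2 * ((C1 + C2) * (s * (q * T)))).
    rewrite ler_pM2l ?exprn_gt0// mulrDl; apply: lerD.
      by apply: (le_trans i1); rewrite ler_pM2l.
    by apply: (le_trans i2); rewrite ler_pM2l.
  by ring.
apply: (le_trans (lerD g1 g2)).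
have g3 : 0 <= s ^+ 3 * q * (b - a) by rewrite !mulr_ge0 ?subr_ge0// ltW.
have g4 : 0 <= (6 + C1 + C2) * (s ^+ 3 * q * (b - a)) by rewrite mulr_ge0//; lra.
move: g4; set y := b - a; set S3 := s ^+ 3 => g4.
apply: (@le_trans _ _ (S3 * (8 * q * T + 2 * q * y) + (C1 + C2) * (S3 * (q * T)) +
  (6 + C1 + C2) * (S3 * q * y))); first by rewrite lerDl.
by rewrite le_eqVlt; apply/orP; left; apply/eqP; ring.
Qed.

End Sharp.

(** * Ubiquity *)

Section Ubiquity.
Context {R : realType}.

Lemma powR_large (p M : R) : 0 < p -> exists2 Q0 : R, 2 <= Q0 &
  forall Q, Q0 <= Q -> M <= Q `^ p.
Proof.
move=> p0; pose M1 := Num.max M 1.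
have M10 : 0 < M1 by rewrite lt_max ltr01 orbT.
exists (2 + M1 `^ p^-1); first by rewrite lerDl powR_ge0.
move=> Q QM; apply: (@le_trans _ _ M1); first by rewrite le_max lexx.
have -> : M1 = (M1 `^ p^-1) `^ p by rewrite -powRrM mulVf ?powRr1 ?(ltW M10)// gt_eqF.
have h : 0 <= M1 `^ p^-1 by exact: powR_ge0.
by apply: ge0_ler_powR; rewrite ?nnegrE ?(ltW p0)//; lra.
Qed.

(** The frame of the box |q| <= Q / T, |X1| <= T^2 / (d Q), |X2| <= d / T, whose volume does not
    depend on T. Large T sharpens two coordinates at the expense of [X1], which can be corrected
    afterwards by moving the parameter. *)
Definition fu (A B E : R -> R) (T Q d x : R) : frame :=
  Frame (A x) (B x) (E x) (T / Q) (d * Q / T ^+ 2) (T / d).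

Lemma unif_fu A B E T Q d x : 0 < T -> 0 < Q -> 0 < d -> unif (fu A B E T Q d x).
Proof.
move=> T0 Q0 d0; split; rewrite /= ?divr_gt0 ?mulr_gt0 ?exprn_gt0//.
by field; rewrite !lt0r_neq0.
Qed.

Lemma nrm_fu A B E T Q d x v : nrm (fu A B E T Q d x) v =
  (T / Q * v.1.1) ^+ 2 + (d * Q / T ^+ 2 * X1 A x v) ^+ 2 +
  (T / d * X2 B E x v) ^+ 2.
Proof. rewrite /nrm /bil /X1 /X2 /=; ring. Qed.

Lemma nrm_fu_coord A B E T Q d x (e : R) v : 0 < T -> 0 < Q -> 0 < d -> 0 < e ->
  nrm (fu A B E T Q d x) v <= e ^+ 2 ->
  [/\ `|v.1.1| <= e * (Q / T), `|X1 A x v| <= e * (T ^+ 2 / (d * Q)) &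
      `|X2 B E x v| <= e * (d / T)].
Proof.
move=> T0 Q0 d0 e0; rewrite nrm_fu => H.
have s1 := sqr_ge0 (T / Q * v.1.1); have s2 := sqr_ge0 (d * Q / T ^+ 2 * X1 A x v).
have s3 := sqr_ge0 (T / d * X2 B E x v).
have gen (c t : R) : 0 < c -> (c * t) ^+ 2 <= e ^+ 2 -> `|t| <= e * c^-1.
  move=> c0 h; rewrite ler_pdivlMr// mulrC -(gtr0_norm c0) -normrM.
  by apply: norm_le_of_sqr => //; exact: ltW.
have g1 : 0 < T / Q by rewrite divr_gt0.
have g2 : 0 < d * Q / T ^+ 2 by rewrite divr_gt0 ?mulr_gt0 ?exprn_gt0.
have g3 : 0 < T / d by rewrite divr_gt0.
split.
- by have := gen _ _ g1 (_ : _ <= _); rewrite invf_div; apply; lra.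
- by have := gen _ _ g2 (_ : _ <= _); rewrite invf_div; apply; lra.
- by have := gen _ _ g3 (_ : _ <= _); rewrite invf_div; apply; lra.
Qed.

(** Abel summation over the height, with [sharp_count] applied at every height n <= N. Its error
    factor and the least thickness it accepts produce the terms with smaller powers of N. *)
Lemma inv_sum_bound A B E al be K (eta : R) : csys A B E al be K ->
  2^-1 <= eta < 1 -> exists C tau : R, [/\ 0 < C, 0 < tau <= 8^-1 &
  forall (b1 b2 a b : R) (N : nat) (V : seq ivec), 0 <= b1 -> b1 ^+ 2 <= 2^-1 ->
    0 <= b2 -> b2 <= 2^-1 -> al <= a -> a <= b -> b <= be -> uniq V ->
    (forall v, v \in V -> (1 <= absz v.1.1 <= N)%N /\
       exists x, [/\ a <= x <= b, `|X1 A x (rv v)| <= b1 & `|X2 B E x (rv v)| <= b2]) ->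
    (0 < N)%N ->
    \sum_(v <- V) (absz v.1.1)%:R^-1 <= C * (b2 * N%:R * (b - a) +
      b2 * N%:R `^ (1 - tau) + ((b - a) + 1) * N%:R `^ (1 - eta))].
Proof.
move=> sys eta12; have [C [tau [C0 /andP[tau0 tau8] HC]]] := sharp_count sys eta12.
have /andP[eta1 eta2] := eta12.
have e0 : 0 < 1 - eta by lra.
have C2 : 0 < (1 - eta)^-1 by rewrite invr_gt0.
exists (4 * C * (4 + 4 * (1 - eta)^-1)), tau; split => //.
- by rewrite !mulr_gt0//; lra.
- by rewrite tau0.
move=> b1 b2 a b N V b10 b11 b20 b21 ala ab bbe uV HV N0.
(* The thickness at height n: b2 for [X2], b1^2 / n so that sqrt(d Q) dominates b1, and n^(-eta) to
   meet the lower bound in [sharp_count]. *)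
pose D (n : nat) : R := b2 + b1 ^+ 2 / n%:R + n%:R `^ (- eta).
pose c (n : nat) := 4 * C * (D n * n%:R ^+ 2) * ((b - a) + n%:R `^ (- tau)).
have l0 : 0 <= b - a by rewrite subr_ge0.
have D0 n : 0 <= D n.
  by rewrite /D !addr_ge0// ?powR_ge0// divr_ge0// sqr_ge0.
have c0 n : 0 <= c n.
  apply: mulr_ge0; last by apply: addr_ge0 => //; exact: powR_ge0.
  by rewrite !mulr_ge0 ?exprn_ge0 ?(ltW C0) ?D0 ?ler0n.
have kN v : v \in V -> (1 <= absz v.1.1 <= N)%N by move=> /HV[].
have kE (v : ivec) : (absz v.1.1)%:R = `|(v.1.1)%:~R| :> R.
  by rewrite -intr_norm -abszE -pmulrn.
have cnt n : (1 <= n <= N)%N ->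
    (count (fun v : ivec => (absz v.1.1 <= n)%N) V)%:R <= c n.
  move=> /andP[n1 nN]; rewrite -size_filter.
  have n1R : 1 <= n%:R :> R by rewrite ler1n.
  have n0R : 0 < n%:R :> R by rewrite ltr0n.
  have p1 : n%:R `^ (- eta) <= 1.
    rewrite -[leRHS](powRr0 n%:R); apply: ler_powR => //; clear -eta1; lra.
  have bn : b1 ^+ 2 / n%:R <= 2^-1.
    by rewrite ler_pdivrMr// (le_trans b11)// ler_peMr//; lra.
  have pm (p : R) : 0 <= p -> (2 * n%:R) `^ (- p) <= n%:R `^ (- p).
    move=> p0; rewrite !powRN lef_pV2 ?posrE ?powR_gt0//; last by rewrite mulr_gt0.
    by apply: ge0_ler_powR; rewrite ?nnegrE//; clear -n0R; lra.
  have bn0 : 0 <= b1 ^+ 2 / n%:R by rewrite divr_ge0 ?sqr_ge0// ltW.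
  have pe0 : 0 <= n%:R `^ (- eta) :> R by exact: powR_ge0.
  (* Height 2 n rather than n, because [sharp_count] starts at Q = 2. *)
  have := HC (2 * n%:R) (D n) a b 0 0 [seq v <- V | (absz v.1.1 <= n)%N].
  move=> /(_ _ _ _ ala ab bbe) H.
  have : (size [seq v <- V | (absz v.1.1 <= n)%N])%:R <=
      C * (D n * (2 * n%:R) ^+ 2) * (b - a + (2 * n%:R) `^ (- tau)).
    apply: H.
    - by clear -n1R; lra.
    - apply: (le_trans (pm eta _)); first by clear -eta1; lra.
      by rewrite /D; clear -b20 bn0; lra.
    - by rewrite /D; clear -b21 bn p1; lra.
    - exact: filter_uniq.
    move=> v; rewrite mem_filter => /andP[vn vV].
    have [_ [x [xJ x1 x2]]] := HV v vV.
    have sE : shiftv (0 : R) 0 v = rv v by apply: (@vecP R); rewrite /= addr0.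
    split.
      rewrite -kE; have : (absz v.1.1)%:R <= n%:R :> R by rewrite ler_nat.
      by clear -n0R; lra.
    exists x; rewrite sE; split => //; last by rewrite /D; clear -x2 bn0 pe0; lra.
    apply: (le_trans x1); rewrite -(ger0_norm b10) -sqrtr_sqr; apply: ler_wsqrtr.
    apply: (@le_trans _ _ (b1 ^+ 2 / n%:R * (2 * n%:R))).
      rewrite mulrCA divfK ?gt_eqF//; have := sqr_ge0 b1; clear; lra.
    by rewrite ler_pM2r; [rewrite /D; clear -b20 pe0; lra|rewrite mulr_gt0].
  move=> /le_trans; apply; rewrite /c.
  rewrite (_ : C * (D n * (2 * n%:R) ^+ 2) = 4 * C * (D n * n%:R ^+ 2)); last by ring.
  rewrite ler_wpM2l// ?lerD2l ?pm//; last exact: ltW.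
  by rewrite !mulr_ge0// ?exprn_ge0//; exact: ltW.
apply: (le_trans (abel_inv kN cnt c0)).
have N1R : 1 <= N%:R :> R by rewrite ler1n.
have N0R : 0 < N%:R :> R by rewrite ltr0n.
have sumE : \sum_(1 <= n < N.+1) c n / n%:R ^+ 2 <= 4 * C *
   (b2 * N%:R * (b - a) + 2 * (b2 * N%:R `^ (1 - tau)) +
    2 * (1 - eta)^-1 * ((b - a + 1) * N%:R `^ (1 - eta))).
  have t1 : 0 <= tau < 1 by apply/andP; split; clear -tau0 tau8; lra.
  have t2 : 0 <= eta < 1 by apply/andP; split; clear -eta1 eta2; lra.
  have ps1 := powsum N t1; have ps2 := powsum N t2.
  apply: (@le_trans _ _ (\sum_(1 <= n < N.+1) 4 * C * (b2 * (b - a) +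
    b2 * n%:R `^ (- tau) + 2 * (b - a + 1) * n%:R `^ (- eta)))).
    rewrite big_nat [leRHS]big_nat; apply: ler_sum => n /andP[n1 _].
    have n1R : 1 <= n%:R :> R by rewrite ler1n.
    have n0R : 0 < n%:R :> R by rewrite ltr0n.
    have -> : c n / n%:R ^+ 2 = 4 * C * (D n * ((b - a) + n%:R `^ (- tau))).
      by rewrite /c; field; exact: lt0r_neq0.
    rewrite ler_pM2l ?mulr_gt0//.
    have pt : n%:R `^ (- tau) <= 1.
      by rewrite -[leRHS](powRr0 n%:R); apply: ler_powR => //; clear -tau0; lra.
    have pt0 : 0 <= n%:R `^ (- tau) :> R by exact: powR_ge0.
    have pe0 : 0 < n%:R `^ (- eta) :> R by exact: powR_gt0.
    have be1 : b1 ^+ 2 / n%:R <= n%:R `^ (- eta).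
      apply: (@le_trans _ _ n%:R^-1); first by rewrite ler_piMl ?invr_ge0//; clear -b11; lra.
      rewrite -powR_inv1 ?(ltW n0R)//; apply: ler_powR => //; clear -eta2; lra.
    rewrite /D -addrA mulrDl mulrDr; apply: lerD; first exact: lexx.
    apply: (@le_trans _ _ ((2 * n%:R `^ (- eta)) * (b - a + 1))).
      apply: ler_pM; [|clear -l0 pt0; lra|clear -be1; lra|clear -pt; lra].
      by rewrite addr_ge0// ?powR_ge0// divr_ge0 ?sqr_ge0// ltW.
    by rewrite le_eqVlt; apply/orP; left; apply/eqP; ring.
  rewrite -mulr_sumr ler_pM2l ?mulr_gt0// !big_split /= -!mulr_sumr.
  apply: lerD; first apply: lerD.
  - by rewrite sumr_const_nat subn1 /= -[_ *+ _]mulr_natl; rewrite le_eqVlt; apply/orP; left; apply/eqP; ring.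
  - rewrite mulrCA; apply: ler_wpM2l => //; apply: (le_trans ps1).
    rewrite ler_pdivrMr; last by clear -tau8; lra.
    have := powR_ge0 N%:R (1 - tau); set y := _ `^ _ => y0.
    by nra.
  - rewrite (_ : 2 * (1 - eta)^-1 * _ = 2 * (b - a + 1) * (N%:R `^ (1 - eta) / (1 - eta))).
      by apply: ler_wpM2l => //; clear -l0; lra.
    by ring.
have endE : c N / N%:R <= 4 * C * (b2 * N%:R * (b - a) + b2 * N%:R `^ (1 - tau) +
    2 * ((b - a + 1) * N%:R `^ (1 - eta))).
  have pt : N%:R `^ (- tau) <= 1.
    by rewrite -[leRHS](powRr0 N%:R); apply: ler_powR => //; clear -tau0; lra.
  have pt0 : 0 <= N%:R `^ (- tau) :> R by exact: powR_ge0.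
  have tE : N%:R `^ (1 - tau) = N%:R * N%:R `^ (- tau) by rewrite powRDp// powRr1 ?(ltW N0R).
  have eE : N%:R `^ (1 - eta) = N%:R * N%:R `^ (- eta) by rewrite powRDp// powRr1 ?(ltW N0R).
  have pe0 : 0 < N%:R `^ (- eta) :> R by exact: powR_gt0.
  have -> : c N / N%:R = 4 * C * (D N * N%:R * ((b - a) + N%:R `^ (- tau))).
    by rewrite /c; field; exact: lt0r_neq0.
  rewrite ler_pM2l ?mulr_gt0// tE eE.
  have be1 : b1 ^+ 2 / N%:R <= N%:R `^ (- eta).
    apply: (@le_trans _ _ N%:R^-1); first by rewrite ler_piMl ?invr_ge0//; clear -b11; lra.
    rewrite -powR_inv1 ?(ltW N0R)//; apply: ler_powR => //; clear -eta2; lra.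
  rewrite /D -(addrA b2) mulrDl mulrDl; apply: lerD.
    by rewrite le_eqVlt; apply/orP; left; apply/eqP; ring.
  apply: (@le_trans _ _ ((2 * N%:R `^ (- eta)) * N%:R * (b - a + 1))).
    apply: ler_pM; [|clear -l0 pt0; lra|rewrite ler_pM2r//; clear -be1; lra|clear -pt; lra].
    by rewrite mulr_ge0// ?addr_ge0// ?powR_ge0 ?divr_ge0 ?sqr_ge0 ?ler0n.
  by rewrite le_eqVlt; apply/orP; left; apply/eqP; ring.
apply: (le_trans (lerD sumE endE)).
rewrite -mulrDr -[leRHS]mulrA ler_pM2l ?mulr_gt0//.
have z1 : 0 <= b2 * N%:R * (b - a) by rewrite !mulr_ge0.
have z2 : 0 <= b2 * N%:R `^ (1 - tau) by rewrite mulr_ge0// powR_ge0.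
have z3 : 0 <= (b - a + 1) * N%:R `^ (1 - eta).
  by rewrite mulr_ge0 ?powR_ge0//; clear -l0; lra.
move: z1 z2 z3; set y1 := b2 * _ * _; set y2 := b2 * _ `^ _; set y3 := (_ + 1) * _.
have := C2; set iv := (1 - eta)^-1; clearbody iv y1 y2 y3 => *.
have : 0 <= iv * y1 by rewrite mulr_ge0// ltW.
have : 0 <= iv * y2 by rewrite mulr_ge0// ltW.
have : 0 <= iv * y3 by rewrite mulr_ge0// ltW.
by lra.
Qed.

Definition mid (a sg : R) (i : nat) : R := a + (i%:R + 2^-1) * sg.

Lemma mid_in a b sg i : 0 < sg -> a <= b -> (i < Num.truncn ((b - a) / sg))%N ->
  a + sg / 2 <= mid a sg i /\ mid a sg i <= b - sg / 2.
Proof.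
move=> s0 ab iN; rewrite /mid; split.
  by rewrite lerD2l [leLHS]mulrC ler_pM2r// lerDr ler0n.
have h : 0 <= (b - a) / sg by rewrite divr_ge0 ?subr_ge0// ltW.
have : i.+1%:R <= (b - a) / sg.
  apply: (@le_trans _ _ (Num.truncn ((b - a) / sg))%:R); first by rewrite ler_nat.
  by rewrite truncn_le.
by rewrite ler_pdivlMr// -natr1 !mulrDl; lra.
Qed.

(* A point where the minimum is < c carries an integer vector; such vectors are
   rare by the sharp count, each being responsible for O(cQ/(T|q|)) points. *)
Lemma bad_grid A B E al be K (eta : R) : csys A B E al be K ->
  2^-1 <= eta < 1 -> exists2 c : R, 0 < c <= 2^-1 &
  forall T a b, 1 <= T -> al <= a -> a < b -> b <= be ->
  exists2 Q0 : R, 2 <= Q0 & forall Q d : R, Q0 <= Q -> Q `^ (- eta) <= d -> d <= 1 ->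
    (size [seq i <- iota 0 (Num.truncn ((b - a) / (K * T ^+ 3 / (d * Q ^+ 2)))) |
       lamF (fu A B E T Q d (mid a (K * T ^+ 3 / (d * Q ^+ 2)) i)) < c])%:R <=
    (b - a) / (K * T ^+ 3 / (d * Q ^+ 2)) / 4.
Proof.
move=> sys /andP[eta1 eta2]; have [albe K1 Hs] := sys.
have K0 : 0 < K by lra.
(* An exponent strictly between eta and 1: as d Q >= Q^(1 - eta), the error N^(1 - et') is smaller
   by a power of Q. *)
have [et' et'E] : exists et' : R, et' = (1 + eta) / 2 by eexists.
have et'12 : 2^-1 <= et' < 1 by rewrite et'E; apply/andP; split; lra.
have [C [tau [C0 /andP[tau0 tau8] HC]]] := inv_sum_bound sys et'12.
(* Ensures 40 C K c <= 1, which makes the main term at most half of the target. *)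
pose c := (2 + 40 * C * K)^-1.
have CK : 0 < C * K by rewrite mulr_gt0.
have c0 : 0 < c by rewrite invr_gt0; lra.
have c2 : c <= 2^-1 by rewrite lef_pV2 ?posrE; clear -CK; lra.
have cCK : c * (40 * C * K) <= 1.
  rewrite mulrC ler_pdivrMr; clear -CK; lra.
exists c; first by rewrite c0.
move=> T a b T1 ala ab bbe.
have T0 : 0 < T by exact: lt_le_trans T1.
have l0 : 0 < b - a by rewrite subr_gt0.
(* The factor gained from large Q in the two error terms; each then takes at most a quarter of the
   target. *)
pose M := 80 * C * K * T ^+ 2 * ((b - a) + 1) / (b - a) + 1.
have M1 : 1 <= M.
  have l1 : 0 <= b - a + 1 by apply: addr_ge0 => //; exact: ltW.
  by rewrite lerDr divr_ge0 ?(ltW l0)// !mulr_ge0 ?exprn_ge0 ?(ltW C0) ?(ltW K0) ?(ltW T0).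
have e10 : 0 < 1 - eta by rewrite subr_gt0.
have e30 : 0 < et' - eta by rewrite et'E; clear -eta2; lra.
have [Q1 Q12 H1] := powR_large (2 * T ^+ 2) e10.
have [Q2 Q22 H2] := powR_large M tau0.
have [Q3 Q32 H3] := powR_large M e30.
exists (Q1 + Q2 + Q3); first by clear -Q12 Q22 Q32; lra.
move=> Q d QQ dQ d1.
have Q0 : 0 < Q by clear -QQ Q12 Q22 Q32; lra.
have d0 : 0 < d by apply: lt_le_trans dQ; rewrite powR_gt0.
have dQ1 : Q `^ (1 - eta) <= d * Q.
  by rewrite addrC powRDp// powRr1 ?(ltW Q0)// ler_pM2r.
set sg := K * T ^+ 3 / (d * Q ^+ 2).
have sg0 : 0 < sg by rewrite divr_gt0 ?mulr_gt0 ?exprn_gt0.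
set S := [seq i <- _ | _].
have uF x : unif (fu A B E T Q d x) by exact: unif_fu.
pose b1 := c * (T ^+ 2 / (d * Q)); pose b2 := c * (d / T).
have dQ0 : 0 < d * Q by rewrite mulr_gt0.
have b10 : 0 < b1 by rewrite mulr_gt0 ?divr_gt0 ?exprn_gt0.
have b20 : 0 < b2 by rewrite mulr_gt0 ?divr_gt0.
have tdq : T ^+ 2 / (d * Q) <= 2^-1.
  have h : 2 * T ^+ 2 <= Q `^ (1 - eta) by apply: H1; clear -QQ Q22 Q32; lra.
  by rewrite ler_pdivrMr//; clear -h dQ1; lra.
have b11 : b1 <= 2^-1.
  apply: le_trans tdq; apply: ler_piMl; last by clear -c2; lra.
  by rewrite divr_ge0 ?exprn_ge0// ltW.
have b21 : b2 <= 2^-1.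
  apply: le_trans c2; apply: ler_piMr; first exact: ltW.
  by rewrite ler_pdivrMr// mul1r (le_trans d1).
have [S0|[i0 i0S]] : S = [::] \/ exists i0, i0 \in S.
  by case: (S) => [|i s]; [left|right; exists i; rewrite inE eqxx].
  by rewrite S0 /=; apply: divr_ge0 => //; apply: divr_ge0; exact: ltW.
have Hv i : exists v : ivec, i \in S -> v != (0, 0, 0) /\
    qn (fu A B E T Q d (mid a sg i)) v < c ^+ 2.
  have [iS|iS] := boolP (i \in S); last by exists (0, 0, 0).
  move: iS; rewrite mem_filter => /andP[li _].
  by have [v [u [v0 uv q]]] := lamF_lt (uF _) c0 li; exists v => _; split.
have [vi viP] := choice Hv.
have iJ i : i \in S -> a <= mid a sg i <= b.
  rewrite mem_filter mem_iota /= add0n => /andP[_ iN].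
  have [m1 m2] := mid_in sg0 (ltW ab) iN.
  by clear -m1 m2 sg0; apply/andP; split; lra.
pose V := undup (map vi S).
have Vc v : v \in V -> [/\ v.1.1 != 0, `|(v.1.1)%:~R : R| <= c * (Q / T) &
   exists x, [/\ a <= x <= b, `|X1 A x (rv v)| <= b1 & `|X2 B E x (rv v)| <= b2]].
  rewrite mem_undup => /mapP[i iS ->]; have [v0 q] := viP i iS.
  have [n0 n1 n2] := nrm_fu_coord T0 Q0 d0 c0 (ltW q).
  split => //; last by exists (mid a sg i); split => //; exact: iJ.
  apply/eqP => z; move: n1 n2; rewrite /X1 /X2 /= z !mulr0 !addr0 => n1 n2.
  have y0 : (vi i).1.2 = 0.
    by apply: (@int_small R); apply: (le_lt_trans (le_trans n1 b11)); clear; lra.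
  have x0 : (vi i).2 = 0.
    apply: (@int_small R); move: n2; rewrite y0 mulr0 addr0 => n2.
    by apply: (le_lt_trans (le_trans n2 b21)); clear; lra.
  move: v0; rewrite (_ : vi i = (0, 0, 0)) ?eqxx//.
  exact: vecP.
pose k (v : ivec) := absz v.1.1.
have kE v : (k v)%:R = `|(v.1.1)%:~R| :> R by rewrite /k -intr_norm -abszE -pmulrn.
have Y0 : 0 < c * (Q / T) by rewrite mulr_gt0 ?divr_gt0.
set Y := c * (Q / T) in Vc Y0.
pose N := Num.truncn Y.
have NY : N%:R <= Y by rewrite truncn_le ltW.
have kN v : v \in V -> (1 <= k v <= N)%N.
  move=> /Vc[v0 vQ _]; apply/andP; split; first by rewrite /k absz_gt0.
  by rewrite leqNgt truncn_lt_nat ?(ltW Y0)// -leNgt kE.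
have step1 : (size S)%:R <= \sum_(v <- V) (5 * Y) * (k v)%:R^-1.
  apply: (@size_le_fibers _ _ _ S vi V).
    by move=> i iS; rewrite mem_undup map_f.
  move=> v vV; rewrite -size_filter; set s := [seq x <- S | _].
  have k0 : 0 < (k v)%:R :> R.
    by rewrite ltr0n; have /andP[] := kN v vV.
  have kQ : (k v)%:R <= Y by have [_ h _] := Vc v vV; rewrite kE.
  have us : uniq (map Posz s).
    by rewrite map_inj_uniq ?filter_uniq ?iota_uniq// => x y [].
  have := @size_int_window R (map Posz s) (2 * Y / (k v)%:R) us.
  rewrite size_map => W.
  apply: le_trans (W _ _) _.
  - by rewrite divr_ge0// mulr_ge0// ltW.
  - move=> _ _ /mapP[i is_ ->] /mapP[j js ->].
    move: is_ js; rewrite (mem_filter _ i S) (mem_filter _ j S) => /andP[/eqP iE iS] /andP[/eqP jE jS].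
    have [_ qi] := viP i iS; have [_ qj] := viP j jS.
    rewrite iE in qi; rewrite jE in qj.
    have [_ ci _] := nrm_fu_coord T0 Q0 d0 c0 (ltW qi).
    have [_ cj _] := nrm_fu_coord T0 Q0 d0 c0 (ltW qj).
    have iI : al <= mid a sg i <= be.
      by have /andP[g1 g2] := iJ i iS; rewrite (le_trans ala g1) (le_trans g2 bbe).
    have jI : al <= mid a sg j <= be.
      by have /andP[g1 g2] := iJ j jS; rewrite (le_trans ala g1) (le_trans g2 bbe).
    have [h _ _ _ _] := Hs _ _ iI jI.
    rewrite ler_pdivlMr//.
    have -> : `|(Posz i - Posz j)%:~R| = `|mid a sg i - mid a sg j| / sg.
      rewrite /mid (_ : _ - _ = (i%:R - j%:R) * sg); last by ring.
      rewrite normrM (gtr0_norm sg0) mulfK ?gt_eqF//.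
      by rewrite rmorphB /= -!pmulrn.
    have AA : (k v)%:R * `|A (mid a sg i) - A (mid a sg j)| <= 2 * b1.
      rewrite kE -normrM.
      rewrite (_ : _ * _ = X1 A (mid a sg i) (rv v) - X1 A (mid a sg j) (rv v)).
        by apply: (le_trans (ler_normB _ _)); rewrite mulr_natl mulr2n; exact: lerD.
      by rewrite /X1 /=; ring.
    rewrite mulrAC ler_pdivrMr//.
    apply: (@le_trans _ _ (K * (2 * b1))).
      apply: (@le_trans _ _ (K * `|A (mid a sg i) - A (mid a sg j)| * (k v)%:R)).
        by rewrite ler_pM2r.
      by rewrite -mulrA ler_pM2l// mulrC.
    rewrite /b1 /Y /sg le_eqVlt; apply/orP; left; apply/eqP.
    by field; rewrite !lt0r_neq0.
  - have : 1 <= Y / (k v)%:R by rewrite ler_pdivlMr// mul1r.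
    rewrite -(mulrA 2 Y) -(mulrA 5 Y); set u := Y / _; clearbody u; clear; lra.
have vV : vi i0 \in V by rewrite mem_undup map_f.
have N1 : (1 <= N)%N by have /andP[x y] := kN _ vV; apply: leq_trans y.
have NR : 0 < N%:R :> R by rewrite ltr0n.
have sumV : \sum_(v <- V) (k v)%:R^-1 <= C * (b2 * N%:R * (b - a) +
      b2 * N%:R `^ (1 - tau) + ((b - a) + 1) * N%:R `^ (1 - et')).
  apply: (HC b1 b2 a b N V) => //; try exact: ltW; [|exact: undup_uniq|].
    have b11' : b1 <= 1 by apply: (le_trans b11); rewrite invf_le1 ?ler1n.
    by rewrite expr2; apply: le_trans b11; exact: ler_piMl (ltW b10) b11'.
  by move=> v vV'; split; [exact: kN|have [_ _] := Vc v vV'].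
have YQ : Y <= Q.
  apply: (@le_trans _ _ (Q / T)); last by rewrite ler_pdivrMr// ler_peMr// ltW.
  by apply: ler_piMl; [rewrite divr_ge0// ltW|clear -c2; lra].
have NQ : N%:R <= Q := le_trans NY YQ.
have Np (p : R) : 0 <= p -> N%:R `^ p <= Q `^ p.
  by move=> p0; apply: ge0_ler_powR; rewrite ?nnegrE ?ler0n ?(ltW Q0).
apply: (le_trans step1); rewrite -mulr_sumr.
have goalE : (b - a) / sg / 4 = 5 * Y * ((b - a) * (d * Q) / (20 * K * c * T ^+ 2)).
  by rewrite /sg /Y; field; rewrite !lt0r_neq0.
rewrite goalE ler_pM2l; last by rewrite mulr_gt0.
apply: (le_trans sumV).
have e1 : C * (b2 * N%:R * (b - a)) <= 2^-1 * ((b - a) * (d * Q) / (20 * K * c * T ^+ 2)).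
  apply: (@le_trans _ _ (C * (b2 * Y * (b - a)))).
    by rewrite ler_pM2l// ler_pM2r// ler_pM2l.
  rewrite /b2 /Y (_ : C * _ = (c * c * c * (40 * C * K)) *
     (2^-1 * ((b - a) * (d * Q) / (20 * K * c * T ^+ 2)))); last first.
    by field; rewrite !lt0r_neq0.
  rewrite ler_piMl//.
    have g0 : 0 < (b - a) * (d * Q) / (20 * K * c * T ^+ 2).
      by rewrite divr_gt0 ?mulr_gt0 ?exprn_gt0.
    by apply: mulr_ge0 => //; exact: ltW.
  have c1 : c <= 1 by clear -c2; lra.
  rewrite -(mulrA (c * c)); apply: mulr_ile1 => //.
  - by rewrite mulr_ge0 ?ltW.
  - by rewrite !mulr_ge0 ?(ltW c0) ?(ltW C0) ?(ltW K0).
  - by apply: mulr_ile1; rewrite ?(ltW c0).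
have W0 : 0 < (b - a) * (d * Q) / (20 * K * T ^+ 2).
  by rewrite divr_gt0 ?mulr_gt0 ?exprn_gt0.
have M0 : 0 < M by exact: lt_le_trans M1.
have Mb : 80 * C * K * T ^+ 2 * ((b - a) + 1) <= M * (b - a).
  by rewrite -ler_pdivrMr// /M lerDl.
have MM : C * ((b - a) + 1) * (d * Q) / M <= 4^-1 * ((b - a) * (d * Q) / (20 * K * T ^+ 2)).
  rewrite ler_pdivrMr// (_ : _ * M = M * (b - a) * (d * Q) / (80 * K * T ^+ 2)); last first.
    by field; rewrite !lt0r_neq0.
  rewrite ler_pdivlMr; last by rewrite !mulr_gt0 ?exprn_gt0.
  rewrite (_ : C * _ * _ * _ = (80 * C * K * T ^+ 2 * ((b - a) + 1)) * (d * Q)); last by ring.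
  by rewrite ler_pM2r.
have cW : (b - a) * (d * Q) / (20 * K * T ^+ 2) <= (b - a) * (d * Q) / (20 * K * c * T ^+ 2).
  rewrite ler_pM2l ?mulr_gt0// lef_pV2 ?posrE ?mulr_gt0 ?exprn_gt0//.
  rewrite ler_pM2r ?exprn_gt0// ler_piMr//; last by clear -c2; lra.
  by rewrite mulr_ge0// ltW.
have e2 : C * (b2 * N%:R `^ (1 - tau)) <= C * ((b - a) + 1) * (d * Q) / M.
  have -> : C * ((b - a) + 1) * (d * Q) / M = C * (((b - a) + 1) * (d * (Q / M))) by ring.
  rewrite ler_pM2l//.
  have QM : M <= Q `^ tau by apply: H2; clear -Q12 Q32 QQ; lra.
  have dQM : 0 <= d * (Q / M).
    by rewrite mulr_ge0 ?divr_ge0 ?(ltW d0) ?(ltW Q0) ?(ltW M0).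
  apply: (@le_trans _ _ (d * (Q / M))); last by apply: ler_peMl => //; clear -l0; lra.
  have b2d : b2 <= d.
    apply: (@le_trans _ _ (d / T)).
      by apply: ler_piMl; [rewrite divr_ge0// ltW|clear -c2; lra].
    by rewrite ler_pdivrMr// ler_peMr// ltW.
  apply: ler_pM; rewrite ?powR_ge0 ?(ltW b20)//.
  apply: (@le_trans _ _ (Q `^ (1 - tau))); first by apply: Np; clear -tau8; lra.
  rewrite powRDp// powRr1 ?(ltW Q0)// ler_pM2l// powRN lef_pV2 ?posrE ?powR_gt0//.
have e3 : C * (((b - a) + 1) * N%:R `^ (1 - et')) <= C * ((b - a) + 1) * (d * Q) / M.
  have -> : C * ((b - a) + 1) * (d * Q) / M = C * (((b - a) + 1) * (d * Q / M)) by ring.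
  rewrite ler_pM2l// ler_pM2l; last by clear -l0; lra.
  apply: (@le_trans _ _ (Q `^ (1 - et'))); first by apply: Np; rewrite et'E; clear -eta2; lra.
  rewrite ler_pdivlMr//.
  have QM : M <= Q `^ (et' - eta) by apply: H3; clear -Q12 Q22 QQ; lra.
  apply: (@le_trans _ _ (Q `^ (1 - et') * Q `^ (et' - eta))).
    by rewrite ler_pM2l ?powR_gt0.
  by rewrite -powRDp// (_ : 1 - et' + (et' - eta) = 1 - eta)//; ring.
rewrite !(mulrDr C); clear -e1 e2 e3 MM cW; lra.
Qed.

(** At a good grid point the covering radius is bounded, so a lattice point lies near the real
    triple with denominator 3 Q / 2 at which both forms vanish. The hypothesis on the values of [A]
    then moves the parameter to an exact zero of [X1], with little change in [X2]. *)
Lemma ubiquity A B E al be K (eta : R) : csys A B E al be K ->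
  2^-1 <= eta < 1 ->
  (forall x r y, 0 < r -> al <= x - r -> x + r <= be -> K * `|y - A x| <= r ->
     exists2 xi, `|xi - x| <= r & A xi = y) ->
  exists2 kap : R, 0 < kap & forall a b, al <= a -> a < b -> b <= be ->
  exists2 Q0 : R, 2 <= Q0 & forall Q d t1 t2 : R, Q0 <= Q -> Q `^ (- eta) <= d -> d <= 1 ->
  exists s : seq nat, [/\ uniq s,
    forall i, i \in s -> (i < Num.truncn ((b - a) / (kap / (d * Q ^+ 2))))%N,
    (b - a) / (kap / (d * Q ^+ 2)) / 2 <= (size s)%:R &
    forall i, i \in s -> exists (v : ivec) (xi : R), [/\
      `|xi - mid a (kap / (d * Q ^+ 2)) i| <= kap / (d * Q ^+ 2) / 4,
      Q <= (v.1.1)%:~R <= 2 * Q, X1 A xi (shiftv t1 t2 v) = 0 &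
      `|X2 B E xi (shiftv t1 t2 v)| <= d / 2]].
Proof.
move=> sys eta12 ivt; have [albe K1 Hs] := sys; have K0 : 0 < K by lra.
have /andP[eta1 eta2] := eta12.
have [c /andP[c0 c2] Hc] := bad_grid sys eta12.
(* T / 8 = 3 / c^2 exceeds sqrt 7 / c^2, the covering radius from [lattice_cover]; measured in the
   box of [fu], the denominator is then off by at most Q / 8. *)
have [T TE] : exists T : R, T = 24 / c ^+ 2 by eexists.
have c20 : 0 < c ^+ 2 by rewrite exprn_gt0.
have c21 : c ^+ 2 <= 1 by rewrite expr2; nra.
have T1 : 1 <= T by rewrite TE ler_pdivlMr// mul1r; lra.
have T0 : 0 < T by lra.
have cT : 3 / c ^+ 2 = T / 8 by rewrite TE; field; exact: lt0r_neq0.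
have [kap kapE] : exists k : R, k = K * T ^+ 3 by eexists.
have kap0 : 0 < kap by rewrite kapE mulr_gt0 ?exprn_gt0.
exists kap => // a b ala ab bbe.
have [Q1 Q12 H1] := Hc T a b T1 ala ab bbe.
have l0 : 0 < b - a by rewrite subr_gt0.
have e10 : 0 < 1 - eta by rewrite subr_gt0.
have [Q2 Q22 H2] := powR_large (K * kap ^+ 2 + 1) e10.
have q30 : 0 <= 4 * kap / (b - a) by rewrite divr_ge0 ?mulr_ge0// ltW.
exists (Q1 + Q2 + 4 * kap / (b - a)); first by clear -Q12 Q22 q30; lra.
move=> Q d t1 t2 QQ dQ d1.
have Q0 : 0 < Q by clear -QQ Q12 Q22 q30; lra.
have d0 : 0 < d by apply: lt_le_trans dQ; rewrite powR_gt0.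
have dQ1 : Q `^ (1 - eta) <= d * Q.
  by rewrite addrC powRDp// powRr1 ?(ltW Q0)// ler_pM2r.
have dQ0 : 0 < d * Q by rewrite mulr_gt0.
have QQ1 : Q1 <= Q by clear -QQ Q22 q30; lra.
have := H1 Q d QQ1 dQ d1; rewrite -kapE => bad.
set sg := kap / (d * Q ^+ 2) in bad *.
have sg0 : 0 < sg by rewrite divr_gt0 ?mulr_gt0 ?exprn_gt0.
set n := Num.truncn ((b - a) / sg) in bad *.
exists [seq i <- iota 0 n | ~~ (lamF (fu A B E T Q d (mid a sg i)) < c)].
have kd : K * kap ^+ 2 + 1 <= d * Q.
  by apply: le_trans dQ1; apply: H2; clear -QQ Q12 q30; lra.
have dQ1' : 1 <= d * Q by have := mulr_ge0 (ltW K0) (sqr_ge0 kap); clear -kd; lra.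
split.
- by rewrite filter_uniq// iota_uniq.
- by move=> i; rewrite mem_filter mem_iota /= add0n => /andP[].
- have nE : (size [seq i <- iota 0 n | ~~ (lamF (fu A B E T Q d (mid a sg i)) < c)])%:R
      + (size [seq i <- iota 0 n | lamF (fu A B E T Q d (mid a sg i)) < c])%:R = n%:R :> R.
    rewrite -natrD !size_filter addnC; congr _%:R.
    by rewrite -[RHS](size_iota 0 n); exact: count_predC.
  have nl : (b - a) / sg < n%:R + 1 by rewrite natr1 -truncn_le_nat.
  (* Rounding down the number of cells and losing a quarter to bad points still leaves half once
     there are 4 cells. *)
  have n4 : 4 <= (b - a) / sg.
    rewrite /sg invf_div mulrA ler_pdivlMr//.
    apply: (@le_trans _ _ ((b - a) * Q)).
      have : 4 * kap / (b - a) <= Q by clear -QQ Q12 Q22; lra.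
      by rewrite ler_pdivrMr// [(b - a) * Q]mulrC.
    by rewrite ler_pM2l// expr2 mulrA ler_peMl//; exact: ltW.
  by clear -nE nl n4 bad; lra.
move=> i; rewrite mem_filter mem_iota /= add0n => /andP[lc iN].
have [m1 m2] := mid_in sg0 (ltW ab) iN.
set x := mid a sg i in lc m1 m2 *.
have uF : unif (fu A B E T Q d x) by exact: unif_fu.
have Hq v : v != (0, 0, 0) -> c ^+ 2 <= qn (fu A B E T Q d x) v.
  move=> v0; have := lamF_le uF v0; move: lc; rewrite -leNgt => lc l2.
  have cs := le_trans lc l2.
  rewrite -[leRHS]sqr_sqrtr ?qn_ge0// ler_sqr ?nnegrE ?sqrtr_ge0//; exact: ltW.
(* The target has its denominator in the middle of [Q, 2 Q] and numerators that annihilate both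
   shifted forms at [x]. *)
pose y0 : R := 3 / 2 * Q; pose y1 := - (A x * y0) - t1.
pose y2 := - (B x * (y1 + t1)) - E x * y0 - t2.
have c01 : 0 < c <= 1 by rewrite c0/=; clear -c2; lra.
have [z Hz] := lattice_cover uF c01 Hq (y0, y1, y2).
have Hz' : nrm (fu A B E T Q d x) (subv (rv z) (y0, y1, y2)) <= (T / 8) ^+ 2.
  apply: (le_trans Hz); rewrite -cT expr_div_n -exprM.
  by rewrite ler_pM2r ?invr_gt0 ?exprn_gt0//; clear; lra.
have T80 : 0 < T / 8 by rewrite divr_gt0.
have [w0 w1 w2] := nrm_fu_coord T0 Q0 d0 T80 Hz'.
have x1E : X1 A x (subv (rv z) (y0, y1, y2)) = X1 A x (shiftv t1 t2 z).
  by rewrite /X1 /= /y1; ring.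
have x2E : X2 B E x (subv (rv z) (y0, y1, y2)) = X2 B E x (shiftv t1 t2 z).
  by rewrite /X2 /= /y2 /y1; ring.
rewrite x1E in w1; rewrite x2E in w2.
have {w0}w0 : `|(z.1.1)%:~R - y0| <= Q / 8.
  by apply: (le_trans w0); rewrite le_eqVlt; apply/orP; left; apply/eqP; field; exact: lt0r_neq0.
have {w1}w1 : `|X1 A x (shiftv t1 t2 z)| <= T ^+ 3 / (8 * (d * Q)).
  by apply: (le_trans w1); rewrite le_eqVlt; apply/orP; left; apply/eqP; field; rewrite !lt0r_neq0.
have {w2}w2 : `|X2 B E x (shiftv t1 t2 z)| <= d / 8.
  by apply: (le_trans w2); rewrite le_eqVlt; apply/orP; left; apply/eqP; field; rewrite !lt0r_neq0.
have zQ : Q <= (z.1.1)%:~R <= 2 * Q.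
  by move: w0; rewrite ler_norml /y0 => /andP[u1 u2]; clear -u1 u2 Q0; apply/andP; split; lra.
have /andP[zQ1 zQ2] := zQ.
set q : R := (z.1.1)%:~R in w0 zQ zQ1 zQ2.
have q0 : 0 < q := lt_le_trans Q0 zQ1.
set W := shiftv t1 t2 z in w1 w2 *.
have Wq : W.1.1 = q by rewrite /= addr0.
have sg4 : 0 < sg / 4 by rewrite divr_gt0.
have r1 : al <= x - sg / 4 by clear -m1 ala sg0; lra.
have r2 : x + sg / 4 <= be by clear -m2 bbe sg0; lra.
have [|xi xi1 xi2] := ivt x (sg / 4) (A x - X1 A x W / q) sg4 r1 r2.
  rewrite addrAC subrr add0r normrN normrM normfV (gtr0_norm q0) mulrA ler_pdivrMr//.
  apply: (@le_trans _ _ (K * (T ^+ 3 / (8 * (d * Q))))); first by rewrite ler_pM2l.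
  apply: (@le_trans _ _ (sg / 4 * Q)); last by rewrite ler_pM2l.
  rewrite /sg kapE (_ : K * _ = 2^-1 * (K * T ^+ 3 / (d * Q ^+ 2) / 4 * Q)).
    have u0 : 0 <= sg / 4 * Q := mulr_ge0 (ltW sg4) (ltW Q0).
    by rewrite -kapE -/sg; apply: ler_piMl => //; rewrite invf_le1 ?ler1n.
  by field; rewrite !lt0r_neq0.
exists z, xi; split => //.
  have -> : X1 A xi W = X1 A x W + (A xi - A x) * W.1.1 by rewrite /X1; ring.
  by rewrite xi2 Wq; field; exact: lt0r_neq0.
have xJ : al <= x <= be by clear -r1 r2 sg4; apply/andP; split; lra.
have xiJ : al <= xi <= be.
  by move: xi1; rewrite ler_norml => /andP[u1 u2]; clear -u1 u2 r1 r2; apply/andP; split; lra.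
have mv := X2_move W sys xJ xiJ.
have -> : X2 B E xi W = X2 B E x W + (X2 B E xi W - X2 B E x W) by ring.
apply: (le_trans (ler_normD _ _)).
rewrite distrC in xi1.
have u1 : K * `|X1 A x W| * `|x - xi| <= K * (T ^+ 3 / (8 * (d * Q))) * (sg / 4).
  apply: ler_pM => //; first by rewrite mulr_ge0// ltW.
  by rewrite ler_pM2l.
have u2 : K * `|W.1.1| * `|x - xi| ^+ 2 <= K * (2 * Q) * (sg / 4) ^+ 2.
  apply: ler_pM => //; first by rewrite mulr_ge0// ltW.
    by rewrite ler_pM2l// Wq gtr0_norm.
  by rewrite ler_sqr ?nnegrE// ltW.
have v1 : K * (T ^+ 3 / (8 * (d * Q))) * (sg / 4) = kap ^+ 2 / (32 * (d ^+ 2 * Q ^+ 3)).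
  by rewrite /sg kapE; field; rewrite !lt0r_neq0.
have v2 : K * (2 * Q) * (sg / 4) ^+ 2 = K * kap ^+ 2 / (8 * (d ^+ 2 * Q ^+ 3)).
  by rewrite /sg; field; rewrite !lt0r_neq0.
pose P := d ^+ 2 * Q ^+ 3.
have P0 : 0 < P by rewrite mulr_gt0 ?exprn_gt0.
have kP : K * kap ^+ 2 / P <= d.
  rewrite ler_pdivrMr//.
  have -> : d * P = (d * Q) * (d * Q) * (d * Q) by rewrite /P; ring.
  have : 1 * 1 * (K * kap ^+ 2) <= (d * Q) * (d * Q) * (d * Q).
    have kd' : K * kap ^+ 2 <= d * Q by apply: le_trans kd; rewrite lerDl.
    by apply: ler_pM; rewrite ?mulr_ge0 ?exprn_ge0 ?(ltW K0) ?(ltW kap0)//; exact: ler_pM.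
  by rewrite !mul1r.
have kP' : kap ^+ 2 / P <= d.
  by apply: le_trans kP; rewrite ler_pM2r ?invr_gt0//; apply: ler_peMl => //; exact: sqr_ge0.
have e1 : kap ^+ 2 / (32 * (d ^+ 2 * Q ^+ 3)) = 32^-1 * (kap ^+ 2 / P).
  by rewrite /P; field; rewrite !lt0r_neq0.
have e2 : K * kap ^+ 2 / (8 * (d ^+ 2 * Q ^+ 3)) = 8^-1 * (K * kap ^+ 2 / P).
  by rewrite /P; field; rewrite !lt0r_neq0.
rewrite v1 e1 in u1; rewrite v2 e2 in u2.
by clear -u1 u2 mv w2 kP kP' d0; lra.
Qed.

End Ubiquity.

(** * Content of limsup sets *)

Section Packing.
Context {R : realType}.

Lemma pack_sorted (T : eqType) (xi rad : T -> R) (s : seq T) (p : T) :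
  path (fun x y => xi x <= xi y) p s -> uniq (p :: s) -> (forall x, 0 <= rad x) ->
  (forall x y, x \in p :: s -> y \in p :: s -> x != y ->
     rad x + rad y <= `|xi x - xi y|) ->
  \sum_(x <- s) rad x <= xi (last p s) - xi p.
Proof.
elim: s p => [|q s IH] p /=; first by rewrite big_nil subrr.
move=> /andP[pq qs] /andP[pn un] rad0 sep; rewrite big_cons.
have pqn : p != q by apply: contra pn => /eqP ->; rewrite inE eqxx.
have := sep p q; rewrite !inE !eqxx !orbT => /(_ isT isT pqn).
rewrite distrC ger0_norm ?subr_ge0// => h1.
have h2 : \sum_(x <- s) rad x <= xi (last q s) - xi q.
  by apply: IH => // x y xs ys; apply: sep; rewrite inE ?xs ?ys orbT.
by have := rad0 p; lra.
Qed.

(** In sorted order each gap is at least the radius at its right end, so all radii but the first add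
    up to at most W; the first adds another W. *)
Lemma packing_bound (T : eqType) (xi rad : T -> R) (s : seq T) (W : R) : uniq s ->
  (forall x, 0 <= rad x) -> 0 <= W ->
  (forall x y, x \in s -> y \in s -> x != y -> rad x + rad y <= `|xi x - xi y|) ->
  (forall x y, x \in s -> y \in s -> `|xi x - xi y| <= W) ->
  (forall x, x \in s -> rad x <= W) -> \sum_(x <- s) rad x <= 2 * W.
Proof.
move=> us rad0 W0 sep close radW.
pose le := fun x y => xi x <= xi y.
have tot : total le by move=> x y; exact: le_total.
have ps : perm_eq s (sort le s) by rewrite perm_sym perm_sort.
rewrite (perm_big _ ps).
have := sort_sorted tot s; have := mem_sort le s; have := sort_uniq le s.
case: (sort le s) => [|p s'] u m srt; first by rewrite big_nil mulr_ge0.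
have us' : uniq (p :: s') by rewrite u.
rewrite big_cons /=.
have h1 : \sum_(x <- s') rad x <= xi (last p s') - xi p.
  by apply: pack_sorted => // x y; rewrite !m; exact: sep.
have pS : p \in s by rewrite -m inE eqxx.
have lS : last p s' \in s by rewrite -m mem_last.
have h2 := radW p pS; have h3 := close _ _ lS pS.
have h4 := ler_norm (xi (last p s') - xi p).
by lra.
Qed.

Lemma count_has_le (T U : eqType) (q : T -> U -> bool) (s : seq T) (P : seq U) :
  (count (fun i => has (q i) P) s)%:R <= \sum_(p <- P) (count (q^~ p) s)%:R :> R.
Proof.
elim: P => [|p P IH]; first by rewrite big_nil (eq_count (a2 := pred0)) ?count_pred0.
rewrite big_cons.
have -> : count (fun i => has (q i) (p :: P)) s =
    count (predU (q^~ p) (fun i => has (q i) P)) s by exact: eq_count.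
apply: (@le_trans _ _ ((count (q^~ p) s)%:R + (count (fun i => has (q i) P) s)%:R)).
  by rewrite -natrD ler_nat -count_predUI leq_addr.
by rewrite lerD2l.
Qed.

Lemma window_arith (w : R) : 1 + 2 * (2 * w + 3 / 4) <= 3 + 4 * w.
Proof. by lra. Qed.

Lemma centres_close (x y p m1 m2 t1 t sg : R) : `|x - p| < t1 + t -> `|y - p| < t1 + t ->
  `|x - m1| <= sg / 4 -> `|y - m2| <= sg / 4 -> t <= sg / 8 ->
  `|m1 - m2| <= 2 * t1 + 3 / 4 * sg.
Proof.
rewrite !ltr_norml !ler_norml => /andP[? ?] /andP[? ?] /andP[? ?] /andP[? ?] ?.
by apply/andP; split; lra.
Qed.

Lemma centres_apart (x y m1 m2 t sg : R) : sg <= `|m1 - m2| ->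
  `|x - m1| <= sg / 4 -> `|y - m2| <= sg / 4 -> t <= sg / 8 -> 2 * t <= `|x - y|.
Proof.
move=> d a1 a2 ts; have : `|m1 - m2| <= `|x - y| + sg / 2; last by have := normr_ge0 (x - m1); lra.
have -> : m1 - m2 = (x - y) - (x - m1) + (y - m2) by ring.
apply: (le_trans (ler_normD _ _)).
by have := ler_normB (x - y) (x - m1); lra.
Qed.

Lemma centre_inside (a b x m t r sg : R) : `|x - m| <= sg / 4 -> a + sg / 2 <= m ->
  m <= b - sg / 2 -> t <= sg / 8 -> r <= t / 2 -> 0 < r -> a <= x - r /\ x + r <= b.
Proof. by rewrite ler_norml => /andP[? ?] *; split; lra. Qed.

Lemma record_arith (x y z : R) : x <= 2 * y -> 96 * y <= z -> x * 48 <= z.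
Proof. by lra. Qed.

Lemma packing_arith (b n s p s' z : R) : s - (3 * p + 4 * n * z) <= s' ->
  b * n / 2 <= s -> p <= b * (n / 48) -> n * z <= n * (b / 64) -> 0 < b * n ->
  b * n / 4 <= s'.
Proof. by rewrite -(mulrA 4) !mulrA (mulrC n b) => *; lra. Qed.

(** Either infinitely many terms reach [c] and contribute [c] each, or truncation alters only
    finitely many terms. *)
Lemma unbounded_min (x : nat -> R) (c : R) : 0 < c -> (forall t, 0 <= x t) ->
  (forall M, exists n, M <= \sum_(0 <= t < n) x t) ->
  forall M, exists n, M <= \sum_(0 <= t < n) Num.min (x t) c.
Proof.
move=> c0 x0 div M.
have mono m n : (m <= n)%N -> \sum_(0 <= t < m) Num.min (x t) c <=
    \sum_(0 <= t < n) Num.min (x t) c.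
  move=> mn; rewrite (@big_cat_nat _ _ _ m 0 n)//= lerDl sumr_ge0// => i _.
  by rewrite le_min x0 ltW.
have [H|H] := pselect (forall m, exists2 t, (m <= t)%N & c <= x t).
  have Hk : forall k, exists n, k%:R * c <= \sum_(0 <= t < n) Num.min (x t) c.
    elim=> [|k [n IH]]; first by exists 0%N; rewrite mul0r big_geq.
    have [t nt ct] := H n; exists t.+1; rewrite big_nat_recr//=.
    rewrite -natr1 mulrDl mul1r; apply: lerD; first exact: le_trans IH (mono _ _ nt).
    by rewrite le_min ct lexx.
  have [n Hn] := Hk (Num.truncn (`|M| / c)).+1; exists n; apply: le_trans Hn.
  rewrite -ler_pdivrMr//; apply: (@le_trans _ _ (`|M| / c)).
    by rewrite ler_pM2r ?invr_gt0// ler_norm.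
  by apply: ltW; rewrite -truncn_le_nat.
have [m Hm] : exists m, forall t, (m <= t)%N -> x t < c.
  apply: contrapT => H'; apply: H => m; apply: contrapT => H2; apply: H'; exists m => t mt.
  by rewrite ltNge; apply/negP => ct; apply: H2; exists t.
have [n Hn] := div (`|M| + \sum_(0 <= t < m) x t).
have [nm|mn] := leqP n m.
  have : \sum_(0 <= t < n) x t <= \sum_(0 <= t < m) x t.
    by rewrite (@big_cat_nat _ _ _ n 0 m)//= lerDl sumr_ge0.
  move=> h; exists 0%N; rewrite big_geq//; have := ler_norm M; have := normr_ge0 M; lra.
exists n.
have E : \sum_(m <= t < n) Num.min (x t) c = \sum_(m <= t < n) x t.
  by apply: eq_big_nat => t /andP[mt _]; rewrite min_l// ltW// Hm.
rewrite (@big_cat_nat _ _ _ m 0 n) ?(ltnW mn)//= E.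
have : 0 <= \sum_(0 <= t < m) Num.min (x t) c.
  by rewrite sumr_ge0// => i _; rewrite le_min x0 ltW.
move: Hn; rewrite (@big_cat_nat _ _ _ m 0 n) ?(ltnW mn)//=.
by have := ler_norm M; lra.
Qed.

End Packing.

(** * Geometrically growing subsequences of levels *)

Section Records.
Context {R : realType} (Tt : pred nat) (N : nat -> R) (L : R).

(** The value of [N] at the last record before [n], and 0 if there is none. A record is at least L
    times the previous one. *)
Fixpoint best (n : nat) : R :=
  if n is m.+1 then (if Tt m && (L * best m <= N m) then N m else best m) else 0.

Definition isrec t := Tt t && (L * best t <= N t).

Lemma record_count n : 2 <= L -> (forall t, 0 < N t) ->
  0 <= best n /\ \sum_(0 <= t < n | isrec t) N t <= 2 * best n.
Proof.
move=> L2 N0; elim: n => [|n [b0 IH]]; first by rewrite big_geq// mulr0.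
rewrite big_mkcond big_nat_recr//= -big_mkcond /= -/(isrec n).
case: ifP => [|_]; last by rewrite addr0.
move=> /andP[_ r]; have := N0 n; split; first exact: ltW.
have : 2 * best n <= L * best n by rewrite ler_wpM2r.
by lra.
Qed.

(* A non-record level is dominated by the last record before it; summing the
   levels attached to one record converges by the tail hypothesis. *)
Lemma record_divergence (hh : nat -> R) (C : R) : 0 <= L -> 0 <= C ->
  (forall t, 0 < N t) -> (forall t, 0 < hh t) ->
  (forall t n, Tt t -> \sum_(t <= j < n) hh j <= C * hh t) -> forall n,
  \sum_(0 <= t < n | Tt t) N t * hh t <=
  (1 + L * C) * \sum_(0 <= t < n | isrec t) N t * hh t.
Proof.
move=> L0 C0 N0 h0 tail n.
(* The second summand is a potential: it bounds in advance the contribution of all later levels as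
   long as no new record occurs. *)
have H : forall k, (k <= n)%N -> 0 <= best k /\
  \sum_(0 <= t < k | Tt t) N t * hh t + L * best k * \sum_(k <= j < n) hh j <=
  (1 + L * C) * \sum_(0 <= t < k | isrec t) N t * hh t.
  elim=> [|k IH] kn; first by rewrite [X in X + _]big_geq// [X in _ <= _ * X]big_geq//= !mulr0 mul0r addr0.
  have [b0 {}IH] := IH (ltnW kn).
  have tl : \sum_(k <= j < n) hh j = hh k + \sum_(k.+1 <= j < n) hh j.
    by rewrite big_ltn.
  have tl0 : 0 <= \sum_(k.+1 <= j < n) hh j.
    by rewrite sumr_ge0// => j _; exact: ltW.
  rewrite big_mkcond big_nat_recr//= -big_mkcond /=.
  rewrite [X in _ <= _ * X]big_mkcond big_nat_recr//= -big_mkcond /= /isrec.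
  have Nk := N0 k; have hk := h0 k.
  have [Tk|Tk] := boolP (Tt k) => /=; last first.
    rewrite !addr0; split => //; apply: le_trans IH; rewrite lerD2l.
    by rewrite ler_wpM2l ?mulr_ge0// tl lerDr ltW.
  have [rk|rk] := leP (L * best k) (N k).
    split; first exact: ltW.
    have tk := tail k n Tk.
    have LN : L * N k * \sum_(k.+1 <= j < n) hh j <= L * N k * (C * hh k).
      by rewrite ler_wpM2l ?mulr_ge0 ?(ltW Nk)//; apply: le_trans tk; rewrite tl lerDr ltW.
    have : 0 <= L * best k * \sum_(k <= j < n) hh j.
      by rewrite !mulr_ge0// sumr_ge0// => j _; exact: ltW.
    move: IH LN; rewrite mulrDr; set X := \sum_(k <= j < n) _; set Y := \sum_(k.+1 <= j < n) _.
    set S1 := \sum_(_ <= _ < _ | Tt _) _; set S2 := \sum_(_ <= _ < _ | _) _.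
    move=> IH LN Z; have -> : (1 + L * C) * (N k * hh k) = N k * hh k + L * N k * (C * hh k) by ring.
    by lra.
  rewrite addr0; split => //; apply: le_trans IH; rewrite -addrA lerD2l tl mulrDr lerD2r.
  by rewrite ler_wpM2r ?ltW.
have [_] := H n (leqnn n).
have -> : \sum_(n <= j < n) hh j = 0 by rewrite big_geq.
by rewrite mulr0 addr0.
Qed.

End Records.

(** * Nested intervals escaping a cheap cover *)

Section Cantor.
Context {R : realType} (al be : R) (Tt : pred nat) (N rho : nat -> R)
  (E : nat -> R -> Prop) (h : R -> R).
Context (h_pos : forall r, 0 < r -> 0 < h r)
  (h_mono : forall r s, 0 < r -> r <= s -> h r <= h s)
  (h_dec : forall r s, 0 < r -> r <= s -> h s * r <= h r * s)
  (h_inf : forall M, exists2 r0, 0 < r0 & forall r, 0 < r -> r <= r0 -> M * r <= h r)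
  (h_zero : forall e, 0 < e -> exists2 r, 0 < r & h r < e)
  (N_pos : forall t, 0 < N t) (rho_pos : forall t, 0 < rho t)
  (N_inf : forall M, exists t0, forall t, (t0 <= t)%N -> M <= N t)
  (tail : exists2 C, 0 < C & forall t n, Tt t ->
     \sum_(t <= j < n) h (rho j) <= C * h (rho t))
  (div : forall M, exists n, M <= \sum_(0 <= t < n | Tt t) N t * h (rho t))
  (UB : forall a b, al <= a -> a < b -> b <= be -> exists t0, forall t, (t0 <= t)%N ->
     Tt t -> exists s : seq nat, [/\ uniq s,
       forall i, i \in s -> (i < Num.truncn ((b - a) / (N t)^-1))%N,
       (b - a) / (N t)^-1 / 2 <= (size s)%:R &
       forall i, i \in s -> exists2 xi, `|xi - mid a (N t)^-1 i| <= (N t)^-1 / 4 &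
         forall x, `|x - xi| <= rho t -> al <= x <= be -> E t x]).

Let rec := isrec Tt N 96.

(** [E t] is known on balls of radius [rho t], but separation is asked at radius comparable to g
    h(rho t), as for the enlarged balls of the mass transference principle. The cap by the mesh
    keeps centres of one level apart; [thin] is the radius on which the descent continues. *)
Definition thick (g : R) (t : nat) : R :=
  Num.min (g / 32 * h (rho t)) ((N t)^-1 / 8).
Definition thin (g : R) (t : nat) : R := Num.min (rho t) (thick g t / 2).

Lemma thick_gt0 g t : 0 < g -> 0 < thick g t.
Proof.
move=> g0; rewrite lt_min; apply/andP; split; last by rewrite divr_gt0 ?invr_gt0.
by rewrite mulr_gt0 ?divr_gt0// h_pos.
Qed.

Lemma thin_gt0 g t : 0 < g -> 0 < thin g t.
Proof. by move=> g0; rewrite lt_min rho_pos divr_gt0// thick_gt0. Qed.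

Lemma thick_le g t : thick g t <= (N t)^-1 / 8.
Proof. by rewrite ge_min lexx orbT. Qed.

Lemma thin_le g t : thin g t <= thick g t / 2.
Proof. by rewrite ge_min lexx orbT. Qed.

(** When [thin] is not [rho] itself but half of [thick], the inequality comes from h(r) / r being
    large for small r. *)
Lemma thick_h g : 0 < g -> exists t0, forall t, (t0 <= t)%N ->
  thick g t <= g / 32 * h (thin g t).
Proof.
move=> g0; have [r0 r00 hr] := h_inf (64 / g).
have [t0 Ht] := N_inf r0^-1; exists t0 => t tt.
rewrite /thin; have [le|lt] := leP (rho t) (thick g t / 2).
  by rewrite /thick ge_min lexx.
have T0 := thick_gt0 t g0; set T := thick g t in lt T0 *.
have Tr : T / 2 <= r0.
  have := thick_le g t; rewrite -/T => TN.
  have Nr : (N t)^-1 <= r0 by rewrite -[leRHS]invrK lef_pV2 ?posrE ?invr_gt0// Ht.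
  have := N_pos t; rewrite -invr_gt0; lra.
have T20 : 0 < T / 2 by rewrite divr_gt0.
have := hr _ T20 Tr => H.
have g32 : 0 < g / 32 by rewrite divr_gt0.
have := ler_wpM2l (ltW g32) H.
by have -> : g / 32 * (64 / g * (T / 2)) = T by field; exact: lt0r_neq0.
Qed.

(** Divergence survives restriction to records, removal of finitely many levels, and truncation at N
    t / (8 N t) = 1 / 8. *)
Lemma record_unbounded g t1 : 0 < g -> forall M, exists n,
  M <= \sum_(0 <= t < n) (if rec t && (t1 <= t)%N then N t * thick g t else 0).
Proof.
move=> g0; have [C C0 HC] := tail.
have D0 : 0 < 1 + 96 * C by rewrite addr_gt0// mulr_gt0.
have hr0 t : 0 < h (rho t) by exact: h_pos.
have recd := @record_divergence R Tt N 96 (fun t => h (rho t)) C (ler0n _ _) (ltW C0)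
  N_pos hr0 HC.
pose x t := if rec t && (t1 <= t)%N then g / 32 * (N t * h (rho t)) else 0.
have x0 t : 0 <= x t.
  by rewrite /x; case: ifP => // _; rewrite !mulr_ge0 ?invr_ge0 ?(ltW g0) ?(ltW (N_pos t)) ?(ltW (hr0 t)).
have xdiv M : exists n, M <= \sum_(0 <= t < n) x t.
  pose S1 := \sum_(0 <= t < t1) g / 32 * (N t * h (rho t)).
  have S10 : 0 <= S1.
    by rewrite sumr_ge0// => t _; rewrite !mulr_ge0 ?invr_ge0 ?(ltW g0) ?(ltW (N_pos t)) ?(ltW (hr0 t)).
  have [n Hn] := div ((1 + 96 * C) * ((M + S1) / (g / 32))).
  exists n; have := le_trans Hn (recd n); rewrite ler_pM2l// ler_pdivrMr ?divr_gt0//.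
  rewrite mulr_suml => H.
  have H2 : \sum_(0 <= t < n | rec t) N t * h (rho t) * (g / 32) <=
     \sum_(0 <= t < n) x t + S1.
    have -> : \sum_(0 <= t < n | rec t) N t * h (rho t) * (g / 32) =
       \sum_(0 <= t < n) x t + \sum_(0 <= t < n)
        (if rec t && (t < t1)%N then g / 32 * (N t * h (rho t)) else 0).
      rewrite -big_split /= big_mkcond /=; apply: eq_bigr => t _; rewrite /x.
      by case: (rec t); case: leqP => _ /=; rewrite ?addr0 ?add0r// mulrC.
    rewrite lerD2l.
    have pos t : 0 <= (if rec t && (t < t1)%N then g / 32 * (N t * h (rho t)) else 0).
      by case: ifP => // _; rewrite !mulr_ge0 ?invr_ge0 ?(ltW g0) ?(ltW (N_pos t)) ?(ltW (hr0 t)).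
    apply: (@le_trans _ _ (\sum_(0 <= t < maxn n t1)
       (if rec t && (t < t1)%N then g / 32 * (N t * h (rho t)) else 0))).
      by rewrite (@big_cat_nat _ _ _ n 0 (maxn n t1)) ?leq_maxl//= lerDl sumr_ge0.
    rewrite (@big_cat_nat _ _ _ t1 0 (maxn n t1)) ?leq_maxr//=.
    rewrite [X in _ + X]big1_seq ?addr0; last first.
      move=> t /andP[_]; rewrite mem_index_iota => /andP[tt _].
      by rewrite ltnNge tt andbF.
    apply: ler_sum => t _; case: ifP => // _.
    by rewrite !mulr_ge0 ?invr_ge0 ?(ltW g0) ?(ltW (N_pos t)) ?(ltW (hr0 t)).
  by lra.
move=> M; have c8 : 0 < 8^-1 :> R by rewrite invr_gt0.
have [n Hn] := unbounded_min c8 x0 xdiv M; exists n; apply: (le_trans Hn).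
apply: ler_sum => t _; rewrite /x; case: ifP => _; last by rewrite ge_min lexx.
have Nt := N_pos t.
rewrite /thick minr_pMr ?(ltW Nt)// mulrCA.
have -> : N t * ((N t)^-1 / 8) = 8^-1 by rewrite mulrA mulfV ?gt_eqF// mul1r.
by rewrite lexx.
Qed.

(** Levels are treated in order until the total thickness reaches (b - a) / 64. Before that, each
    earlier centre spoils at most 3 + 4 N thick of the new ones; growth by 96 between records and
    the bound on the thickness make either part at most (b - a) N / 16, so of (b - a) N / 2 centres
    at least (b - a) N / 4 remain. *)
Lemma packing a b g t1 : al <= a -> a < b -> b <= be -> 0 < g ->
  exists P : seq (nat * R), [/\ uniq P, (b - a) / 64 <= \sum_(p <- P) thick g p.1,
    forall p, p \in P -> [/\ (t1 <= p.1)%N, a <= p.2 - thin g p.1,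
       p.2 + thin g p.1 <= b &
       forall x, p.2 - thin g p.1 <= x <= p.2 + thin g p.1 -> E p.1 x] &
    forall p q, p \in P -> q \in P -> p != q ->
       thick g p.1 + thick g q.1 <= `|p.2 - q.2|].
Proof.
move=> ala ab bbe g0; have l0 : 0 < b - a by rewrite subr_gt0.
have [t0 Ht0] := UB ala ab bbe.
pose t2 := maxn t0 t1.
have L96 : 2 <= 96 :> R by rewrite ler_nat.
have T0 t : 0 < thick g t by exact: thick_gt0.
have IH : forall n, exists P : seq (nat * R), [/\ uniq P,
    (b - a) / 64 <= \sum_(p <- P) thick g p.1 \/
    (b - a) / 4 * \sum_(0 <= t < n) (if rec t && (t2 <= t)%N then N t * thick g t else 0)
      <= \sum_(p <- P) thick g p.1,
    (size P)%:R <= (b - a) * \sum_(0 <= t < n | rec t) N t,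
    (forall p, p \in P -> [/\ (p.1 < n)%N, (t1 <= p.1)%N, a <= p.2 - thin g p.1,
       p.2 + thin g p.1 <= b &
       forall x, p.2 - thin g p.1 <= x <= p.2 + thin g p.1 -> E p.1 x]) &
    forall p q, p \in P -> q \in P -> p != q ->
       thick g p.1 + thick g q.1 <= `|p.2 - q.2| ].
  elim=> [|n [P [uP dP sP aP pP]]].
    exists [::]; split => //; last by rewrite big_geq// mulr0.
    by right; rewrite big_geq// mulr0 big_nil.
  have keep : (b - a) / 64 <= \sum_(p <- P) thick g p.1 \/ ~~ (rec n && (t2 <= n)%N) ->
     exists P : seq (nat * R), [/\ uniq P,
    (b - a) / 64 <= \sum_(p <- P) thick g p.1 \/
    (b - a) / 4 * \sum_(0 <= t < n.+1) (if rec t && (t2 <= t)%N then N t * thick g t else 0)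
      <= \sum_(p <- P) thick g p.1,
    (size P)%:R <= (b - a) * \sum_(0 <= t < n.+1 | rec t) N t,
    (forall p, p \in P -> [/\ (p.1 < n.+1)%N, (t1 <= p.1)%N, a <= p.2 - thin g p.1,
       p.2 + thin g p.1 <= b &
       forall x, p.2 - thin g p.1 <= x <= p.2 + thin g p.1 -> E p.1 x]) &
    forall p q, p \in P -> q \in P -> p != q ->
       thick g p.1 + thick g q.1 <= `|p.2 - q.2| ].
    move=> K; exists P; split => //.
    - case: K => [K|nr]; first by left.
      by rewrite big_nat_recr//= (negbTE nr) addr0.
    - apply: (le_trans sP); rewrite ler_pM2l// [leRHS]big_mkcond big_nat_recr//= -big_mkcond/=.
      by rewrite lerDl; case: ifP => // _; exact: ltW.
    - by move=> p /aP[p1 ? ? ? ?]; split => //; exact: ltnW.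
  have [big|small] := leP ((b - a) / 64) (\sum_(p <- P) thick g p.1).
    by apply: keep; left.
  have [/andP[rn tn]|nr] := boolP (rec n && (t2 <= n)%N); last by apply: keep; right.
  have tn0 : (t0 <= n)%N by apply: leq_trans tn; exact: leq_maxl.
  have tn1 : (t1 <= n)%N by apply: leq_trans tn; exact: leq_maxr.
  have Tn : Tt n by case/andP: rn.
  have [s [us sN ss sx]] := Ht0 n tn0 Tn.
  have Nn := N_pos n.
  set sg := (N n)^-1 in sN ss sx.
  have sg0 : 0 < sg by rewrite invr_gt0.
  have [xi xiP] : {xi : nat -> R & forall i, i \in s -> `|xi i - mid a sg i| <= sg / 4 /\
      (forall x, `|x - xi i| <= rho n -> al <= x <= be -> E n x)}.
    apply: (choice (P := fun i x0 => i \in s -> `|x0 - mid a sg i| <= sg / 4 /\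
      (forall x, `|x - x0| <= rho n -> al <= x <= be -> E n x))) => i.
    have [is_|is_] := boolP (i \in s); last by exists 0.
    by have [x0 x1 x2] := sx i is_; exists x0.
  have TR : thick g n <= sg / 8 by exact: thick_le.
  have tr : thin g n <= thick g n / 2 by exact: thin_le.
  have tr0 : 0 < thin g n by exact: thin_gt0.
  pose bad i (p : nat * R) := `|xi i - p.2| < thick g p.1 + thick g n.
  pose s' := [seq i <- s | ~~ has (bad i) P].
  have midE i j : mid a sg i - mid a sg j = (i%:R - j%:R) * sg by rewrite /mid; ring.
  have kill p : (count (bad^~ p) s)%:R <= 3 + 4 * (thick g p.1 * N n).
    rewrite -size_filter; set k := [seq i <- s | _].
    have uk : uniq (map Posz k).
      by rewrite map_inj_uniq ?filter_uniq// => x y [].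
    have := @size_int_window R (map Posz k) (2 * (thick g p.1 * N n) + 3 / 4) uk.
    rewrite size_map => W.
    have pN : 0 <= thick g p.1 * N n by rewrite mulr_ge0// ltW.
    apply: (le_trans (W _ _)).
    - by rewrite addr_ge0 ?divr_ge0// mulr_ge0.
    - move=> _ _ /mapP[i ik ->] /mapP[j jk ->].
      move: ik jk; rewrite !mem_filter => /andP[bi is_] /andP[bj js].
      have [mi _] := xiP i is_; have [mj _] := xiP j js.
      have -> : `|(Posz i - Posz j)%:~R| = `|mid a sg i - mid a sg j| * N n.
        rewrite midE normrM (gtr0_norm sg0) -mulrA mulVf ?gt_eqF// mulr1.
        by rewrite rmorphB /= -!pmulrn.
      have dd : `|mid a sg i - mid a sg j| <= 2 * thick g p.1 + 3 / 4 * sg.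
        exact: centres_close bi bj mi mj TR.
      have := ler_wpM2r (ltW Nn) dd; rewrite mulrDl -!mulrA mulVf ?gt_eqF//.
      by rewrite mulr1.
    - exact: window_arith.
  have cnt : (size s)%:R - (3 * (size P)%:R + 4 * N n * \sum_(p <- P) thick g p.1) <=
     (size s')%:R.
    have e1 : (size s)%:R = (count (fun i => has (bad i) P) s)%:R + (size s')%:R :> R.
      by rewrite size_filter -natrD (count_predC (fun i => has (bad i) P)).
    have e2 := @count_has_le R _ _ bad s P.
    have e3 : \sum_(p <- P) (count (bad^~ p) s)%:R <=
        3 * (size P)%:R + 4 * N n * \sum_(p <- P) thick g p.1.
      apply: (@le_trans _ _ (\sum_(p <- P) (3 + 4 * (thick g p.1 * N n)))).
        by apply: ler_sum => p _; exact: kill.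
      rewrite big_split/= big_const_seq count_predT iter_addr addr0 -[_ *+ _]mulr_natr.
      rewrite lerD2l mulr_sumr le_eqVlt; apply/orP; left; apply/eqP.
      by apply: eq_bigr => p _; ring.
    by rewrite lerBlDr e1 addrC lerD2l (le_trans e2 e3).
  have recn : \sum_(0 <= t < n | rec t) N t <= N n / 48.
    have [bn rc] := record_count Tt n L96 N_pos.
    case/andP: rn => _ rb; rewrite ler_pdivlMr//.
    exact: record_arith rc rb.
  have cnt' : (b - a) * N n / 4 <= (size s')%:R.
    have ss' : (b - a) * N n / 2 <= (size s)%:R by move: ss; rewrite /sg invrK.
    have p1 : (size P)%:R <= (b - a) * (N n / 48).
      by apply: (le_trans sP); rewrite ler_pM2l.
    have p2 : N n * \sum_(p <- P) thick g p.1 <= N n * ((b - a) / 64).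
      by rewrite ler_pM2l// ltW.
    have bN : 0 < (b - a) * N n by rewrite mulr_gt0.
    exact: packing_arith cnt ss' p1 p2 bN.
  pose P' := [seq (n, xi i) | i <- s'].
  have s's i : i \in s' -> i \in s by rewrite mem_filter => /andP[].
  have sep i j : i \in s -> j \in s -> i != j -> 2 * thick g n <= `|xi i - xi j|.
    move=> is_ js ij; have [mi _] := xiP i is_; have [mj _] := xiP j js.
    have d : sg <= `|mid a sg i - mid a sg j|.
      rewrite midE normrM (gtr0_norm sg0) ler_peMl ?(ltW sg0)//.
      rewrite -[i%:R]/(Posz i)%:~R -[j%:R]/(Posz j)%:~R -rmorphB.
      by apply: int_norm_ge1; rewrite subr_eq0.
    exact: centres_apart d mi mj TR.
  have uP' : uniq P'.
    rewrite map_inj_in_uniq ?filter_uniq// => i j /s's is_ /s's js [xij].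
    have [//|/(sep _ _ is_ js) le] := eqVneq i j; exfalso.
    by move: le; rewrite xij subrr normr0 leNgt mulr_gt0.
  have aP' p : p \in P' -> exists2 i, i \in s' & p = (n, xi i).
    by move=> /mapP[i is_ ->]; exists i.
  exists (P ++ P'); split.
  - rewrite cat_uniq uP uP' andbT /=; apply/hasPn => p /aP'[i _ ->].
    by apply/negP => /aP[] /=; rewrite ltnn.
  - have sumP' : \sum_(p <- P') thick g p.1 = (size s')%:R * thick g n.
      rewrite /P' big_map /= big_const_seq count_predT iter_addr addr0.
      by rewrite -[_ *+ _]mulr_natl.
    rewrite big_cat /= sumP'; case: dP => [dP|dP]; first by move: small; rewrite ltNge dP.
    right; rewrite big_nat_recr//= rn tn /= mulrDr; apply: lerD => //.
    by rewrite mulrA ler_pM2r// mulrAC.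
  - rewrite size_cat natrD big_mkcond big_nat_recr//= -big_mkcond /= rn mulrDr.
    apply: lerD => //; rewrite size_map.
    apply: (@le_trans _ _ (size s)%:R); first by rewrite ler_nat size_filter count_size.
    have sub : {subset s <= iota 0 (Num.truncn ((b - a) / sg))}.
      by move=> i /sN; rewrite mem_iota.
    have := uniq_leq_size us sub; rewrite size_iota => le.
    apply: (@le_trans _ _ (Num.truncn ((b - a) / sg))%:R); first by rewrite ler_nat.
    by rewrite /sg invrK truncn_le mulr_ge0 ?(ltW l0) ?(ltW Nn).
  - move=> p; rewrite mem_cat => /orP[/aP[p1 ? ? ? ?]|/aP'[i /s's is_ ->]].
      by split => //; exact: ltnW.
    have [mi Ei] := xiP i is_.
    have [m1 m2] := mid_in sg0 (ltW ab) (sN i is_).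
    have rr : thin g n <= rho n by rewrite ge_min lexx.
    have [q1 q2] := centre_inside mi m1 m2 TR tr tr0.
    split => //= x /andP[x1 x2]; apply: Ei.
      by apply: le_trans rr; rewrite ler_norml lerBrDr addrC x1 lerBlDl.
    by rewrite (le_trans ala (le_trans q1 x1)) (le_trans (le_trans x2 q2) bbe).
  move=> p q; rewrite !mem_cat => /orP[pP1|/aP'[i is_ ->]] /orP[qP1|/aP'[j js ->]] pq.
  - exact: pP.
  - move: js; rewrite mem_filter => /andP[/hasPn /(_ p pP1) + _].
    by rewrite /bad -leNgt distrC.
  - move: is_; rewrite mem_filter => /andP[/hasPn /(_ q qP1) + _].
    by rewrite /bad -leNgt addrC.
  - have ij : i != j by apply: contra pq => /eqP ->.
    by have := sep i j (s's _ is_) (s's _ js) ij; rewrite /= mulr_natl mulr2n.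
(* A sum of 1 / 16 over records, times (b - a) / 4, is the required (b - a) / 64. *)
have [n Hn] := record_unbounded t2 g0 (16^-1).
have [P [uP dP _ aP pP]] := IH n.
exists P; split => //.
  case: dP => // dP; apply: le_trans dP.
  have l40 : 0 < (b - a) / 4 by rewrite divr_gt0.
  have := ler_wpM2l (ltW l40) Hn; lra.
by move=> p /aP[? ? ? ? ?].
Qed.

Lemma nneseries_ge_term (f : nat -> \bar R) i : (forall j, 0 <= f j)%E ->
  (f i <= \sum_(0 <= j <oo) f j)%E.
Proof.
move=> f0; apply: le_trans (nneseries_lim_ge i.+1 (fun n _ _ => f0 n)).
by rewrite big_nat_recr//= leeDr// sume_ge0.
Qed.

Definition meets (V : nat -> R -> Prop) i u v : Prop := exists2 x, u <= x <= v & V i x.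

Definition cost (V : nat -> R -> Prop) (a : nat -> R) u v : \bar R :=
  (\sum_(0 <= i <oo) (if `[< meets V i u v >] then a i else 0)%:E)%E.

(** [g] is an exchange rate: an interval may afford its length divided by 256 g. The last clause
    bounds a single set by its own price at this rate; it is what allows a set that meets several
    children to be charged for them. *)
Definition cheap V (dd a : nat -> R) (u v g : R) : Prop :=
  [/\ al <= u, u < v, v <= be, 0 < g & (cost V a u v < ((v - u) / 256 / g)%:E)%E /\
    forall i, meets V i u v -> 0 < dd i -> dd i <= g * h (dd i)].

(* If every child met too expensive sets, charging each set to the children it
   meets would bound the total thickness of the children by the cost. *)
Lemma cheap_child (V : nat -> R -> Prop) (dd a : nat -> R) u v g n :
  (forall i, 0 <= dd i) ->
  (forall i x y, V i x -> V i y -> `|x - y| <= dd i) ->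
  (forall i, 0 < a i) -> (forall i, 0 < dd i -> h (dd i) <= a i) ->
  cheap V dd a u v g -> exists u' v' g' t,
  [/\ cheap V dd a u' v' g', u <= u' /\ v' <= v, v' - u' <= (v - u) / 2,
     (cost V a u' v' < (h (v' - u'))%:E)%E &
     (n <= t)%N /\ forall x, u' <= x <= v' -> E t x].
Proof.
move=> dd0 Vd a0 ah [alu uv vbe g0 [cuv dg]].
have l0 : 0 < v - u by rewrite subr_gt0.
have [t3 Ht3] := thick_h g0.
have [t4 Ht4] := N_inf (v - u)^-1.
have [P [uP sP aP pP]] := packing (maxn n (maxn t3 t4)) alu uv vbe g0.
pose Im i (p : nat * R) := meets V i (p.2 - thin g p.1) (p.2 + thin g p.1).
have T0 t : 0 < thick g t by exact: thick_gt0.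
have r0 t : 0 < thin g t by exact: thin_gt0.
have tr t : thin g t <= thick g t / 2 by exact: thin_le.
have Iuv i p : p \in P -> Im i p -> meets V i u v.
  move=> /aP[_ p1 p2 _] [x /andP[x1 x2] Vx]; exists x => //.
  by rewrite (le_trans p1 x1) (le_trans x2 p2).
have [[p pIn Hp]|none] := pselect (exists2 p : nat * R, p \in P &
   (cost V a (p.2 - thin g p.1)%R (p.2 + thin g p.1)%R < (thick g p.1 / (4 * g))%:E)%E).
  have [tp p1 p2 pE] := aP p pIn.
  move: tp; rewrite !geq_max => /and3P[tn tt3 tt4].
  have hth := Ht3 _ tt3.
  set T := thick g p.1 in Hp hth; set q := thin g p.1 in Hp p1 p2 pE hth.
  have q0 : 0 < q by exact: r0.
  have TT0 : 0 < T by exact: T0.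
  have qT : q <= T / 2 by exact: tr.
  have len : (p.2 + q) - (p.2 - q) = 2 * q by ring.
  (* The new rate makes the child's budget 2 q / (256 g') equal to T / (4 g). *)
  exists (p.2 - q), (p.2 + q), (q * g / (32 * T)), p.1; split.
  - split => //; first exact: le_trans alu p1.
    + by rewrite ltrD2l; apply: (lt_trans _ q0); rewrite oppr_lt0.
    + exact: le_trans p2 vbe.
    + by rewrite divr_gt0 ?mulr_gt0.
    split.
      rewrite len (_ : 2 * q / 256 / (q * g / (32 * T)) = T / (4 * g)); first exact: Hp.
      by field; rewrite !lt0r_neq0.
    move=> i mi di.
    have ai : a i < T / (4 * g).
      rewrite -lte_fin; apply: le_lt_trans Hp.
      apply: le_trans (nneseries_ge_term i _); first by rewrite asboolT.
      by move=> j; rewrite lee_fin; case: ifP => // _; exact: ltW.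
    have hq : 32 * T / g <= h q.
      by rewrite ler_pdivrMr// mulrC -ler_pdivlMr//; move: hth; rewrite mulrAC (mulrC g).
    (* A met set wider than q would cost at least h(q) >= 32 T / g, more than all sets meeting the
       child together. For narrower ones h(r) / r is at least h(q) / q. *)
    have [dq|qd] := leP (dd i) q; last first.
      have := h_mono q0 (ltW qd) => hm; have := ah i di => hd.
      have : T / (4 * g) <= 32 * T / g.
        rewrite -subr_ge0 (_ : _ - _ = (127 / 4) * (T / g)); last by field; exact: lt0r_neq0.
        by rewrite mulr_ge0// divr_ge0 ?ltW.
      by lra.
    have hd := h_dec di dq.
    rewrite mulrC mulrA ler_pdivlMr ?mulr_gt0//.
    have : dd i * (32 * T) <= dd i * (h q * g).
      by rewrite ler_pM2l// -ler_pdivrMr.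
    move=> /le_trans; apply.
    rewrite mulrA (mulrC (dd i)) [leRHS]mulrA.
    by apply: ler_wpM2r => //; exact: ltW.
  - by split.
  - rewrite len.
    have N1 : (N p.1)^-1 <= v - u.
      by rewrite -[leRHS]invrK lef_pV2 ?posrE ?invr_gt0// Ht4.
    have := thick_le g p.1; rewrite -/T => TN.
    have N0 : 0 < (N p.1)^-1 by rewrite invr_gt0.
    by lra.
  - rewrite len; apply: (lt_le_trans Hp); rewrite lee_fin.
    have q2 : q <= 2 * q by lra.
    apply: (@le_trans _ _ (h q)); last exact: h_mono.
    have hq : 32 * T / g <= h q.
      by rewrite ler_pdivrMr// mulrC -ler_pdivlMr//; move: hth; rewrite mulrAC (mulrC g).
    apply: le_trans hq.
    rewrite -subr_ge0 (_ : _ - _ = (127 / 4) * (T / g)); last by field; exact: lt0r_neq0.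
    by rewrite mulr_ge0// divr_ge0 ?ltW.
  - by split.
exfalso.
(* A set meeting one child is charged to it at four times its cost. A set meeting several is charged
   to each at that child's full share, thickness over g. *)
pose mu i := (1 < count (fun p => `[< Im i p >]) P)%N.
pose b i (p : nat * R) : R :=
  if `[< Im i p >] then (if mu i then thick g p.1 / g else 4 * a i) else 0.
have b0 i p : 0 <= b i p.
  rewrite /b; case: ifP => // _; case: ifP => _; first by rewrite divr_ge0 ?ltW.
  by rewrite mulr_ge0 ?ltW.
have fail p : p \in P -> ((thick g p.1 / g)%:E <= \sum_(0 <= i <oo) (b i p)%:E)%E.
  move=> pIn.
  have [[i mi mui]|nomu] := pselect (exists2 i, Im i p & mu i).
    apply: le_trans (nneseries_ge_term i _); last by move=> j; rewrite lee_fin.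
    by rewrite /b asboolT// mui.
  have -> : (\sum_(0 <= i <oo) (b i p)%:E)%E =
      ((4 : R)%:E * cost V a (p.2 - thin g p.1)%R (p.2 + thin g p.1)%R)%E.
    rewrite /cost -nneseriesZl; last first.
      by move=> i _; rewrite lee_fin; case: ifP => // _; exact: ltW.
    apply: eq_eseriesr => i _; rewrite -EFinM /b -/(Im i p); congr (_%:E).
    case: ifP => [/asboolP mi|_]; last by rewrite mulr0.
    by case: ifP => // mui; exfalso; apply: nomu; exists i.
  have : ((thick g p.1 / (4 * g))%:E <=
      cost V a (p.2 - thin g p.1)%R (p.2 + thin g p.1)%R)%E.
    by rewrite leNgt; apply/negP => Hp; apply: none; exists p.
  move=> H; apply: (@le_trans _ _ ((4 : R)%:E * (thick g p.1 / (4 * g))%:E)%E).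
    by rewrite -EFinM lee_fin le_eqVlt; apply/orP; left; apply/eqP; field; exact: lt0r_neq0.
  by rewrite lee_pmul2l// lte_fin.
have colsum i : \sum_(p <- P) b i p <= 4 * (if `[< meets V i u v >] then a i else 0).
  have [[p pIn mi]|nom] := pselect (exists2 p : nat * R, p \in P & Im i p); last first.
    rewrite big1_seq; first by rewrite mulr_ge0//; case: ifP => // _; exact: ltW.
    move=> p /andP[_ pIn]; rewrite /b asboolF// => mi; apply: nom; by exists p.
  rewrite asboolT; last exact: Iuv mi.
  have -> : \sum_(p <- P) b i p = \sum_(p <- [seq p <- P | `[< Im i p >]])
      (if mu i then thick g p.1 / g else 4 * a i).
    by rewrite big_filter [RHS]big_mkcond.
  have [mui|] := boolP (mu i); last first.
    rewrite -leqNgt => c1; rewrite big_const_seq count_predT size_filter iter_addr addr0 -[_ *+ _]mulr_natl.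
    rewrite ler_piMl ?mulr_ge0 ?(ltW (a0 i))//.
    by rewrite -[leRHS]/(1%:R) ler_nat.
  set Q := [seq p <- P | _].
  have uQ : uniq Q by rewrite filter_uniq.
  have sQ : (1 < size Q)%N by rewrite size_filter.
  have QP x : x \in Q -> x \in P /\ Im i x.
    by rewrite mem_filter => /andP[/asboolP].
  (* Centres are separated by the sum of the thicknesses and [thin] is at most half of [thick], so a
     set meeting two children has diameter at least half that sum. *)
  have cl x y : x \in Q -> y \in Q ->
      `|x.2 - y.2| <= dd i + (thick g x.1 + thick g y.1) / 2.
    move=> /QP[_ [x' /andP[x1 x2] Vx]] /QP[_ [y' /andP[y1 y2] Vy]].
    have := Vd i _ _ Vx Vy; rewrite ler_norml => /andP[d1 d2].
    have tx := tr x.1; have ty := tr y.1.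
    by rewrite ler_norml; apply/andP; split; lra.
  have rd x y : x \in Q -> y \in Q -> x != y -> thick g x.1 + thick g y.1 <= 2 * dd i.
    move=> xQ yQ xy; have := cl x y xQ yQ.
    have [xP _] := QP x xQ; have [yP _] := QP y yQ.
    by have := pP x y xP yP xy; lra.
  have ex x : x \in Q -> exists2 y, y \in Q & x != y.
    move=> xQ; apply: contrapT => H.
    have all1 y : y \in Q -> y = x.
      by move=> yQ; apply: contrapT => yx; apply: H; exists y => //; apply/eqP => xy; apply: yx.
    move: uQ sQ all1; case: (Q) => [//|y1 [//|y2 Q']] /= /andP[y12 _] _ all1.
    by move: y12; rewrite (all1 y1) ?inE ?eqxx// (all1 y2) ?inE ?eqxx ?orbT.
  have rx x : x \in Q -> thick g x.1 <= 2 * dd i.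
    move=> xQ; have [y yQ xy] := ex x xQ.
    by have := rd x y xQ yQ xy; have := T0 y.1; lra.
  have pQ : p \in Q by rewrite mem_filter pIn andbT; apply/asboolP.
  have di : 0 < dd i by have := rx p pQ; have := T0 p.1; lra.
  have pk : \sum_(x <- Q) thick g x.1 <= 2 * (2 * dd i).
    apply: (@packing_bound R _ (fun x => x.2) (fun x => thick g x.1)) => //.
    - by move=> x; exact: ltW.
    - by rewrite mulr_ge0.
    - by move=> x y /QP[xP _] /QP[yP _]; exact: pP.
    - move=> x y xQ yQ; have [<-|xy] := eqVneq x y; first by rewrite subrr normr0 mulr_ge0.
      by have := cl x y xQ yQ; have := rd x y xQ yQ xy; lra.
  have dgi := dg i (Iuv i p pIn mi) di.
  have hai := ah i di.
  rewrite -mulr_suml ler_pdivrMr//.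
  have : g * h (dd i) <= g * a i by rewrite ler_pM2l.
  by lra.
have H1 : ((\sum_(p <- P) thick g p.1 / g)%:E <= (4 : R)%:E * cost V a u v)%E.
  rewrite -sumEFin.
  apply: (@le_trans _ _ (\sum_(p <- P) \sum_(0 <= i <oo) (b i p)%:E)%E).
    rewrite big_seq [leRHS]big_seq; apply: lee_sum => p pIn; exact: fail.
  rewrite -nneseries_sum; last by move=> i p _; rewrite lee_fin.
  rewrite /cost -nneseriesZl; last first.
    by move=> i _; rewrite lee_fin; case: ifP => // _; exact: ltW.
  apply: lee_nneseries => [i _ _|i _]; first by rewrite sumEFin lee_fin sumr_ge0.
  by rewrite sumEFin -EFinM lee_fin; exact: colsum.
have H2 : ((4 : R)%:E * cost V a u v < ((v - u) / 64 / g)%:E)%E.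
  have -> : (v - u) / 64 / g = 4 * ((v - u) / 256 / g) by field; exact: lt0r_neq0.
  by rewrite EFinM lte_pmul2l// lte_fin.
have := le_lt_trans H1 H2; rewrite lte_fin -mulr_suml ltr_pM2r ?invr_gt0// => H3.
by lra.
Qed.

(** The common point of the nested intervals lies in infinitely many [E t], hence in some covering
    set. That set has a fixed positive cost, whereas the cost of sets meeting the k-th interval is
    below h of its length, which tends to 0. *)
Lemma limsup_content (G : R) : al < be -> 0 < G -> exists2 d0 : R, 0 < d0 &
  forall (V : nat -> R -> Prop) (dd a : nat -> R),
  (forall i, 0 <= dd i) ->
  (forall i x y, V i x -> V i y -> `|x - y| <= dd i) ->
  (forall i, dd i <= d0) ->
  (forall i, 0 < a i) -> (forall i, 0 < dd i -> h (dd i) <= a i) ->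
  (forall x, al <= x <= be -> (forall n, exists2 t, (n <= t)%N & E t x) ->
     exists i, V i x) ->
  (G%:E <= \sum_(0 <= i <oo) (a i)%:E)%E.
Proof.
move=> albe G0; have l0 : 0 < be - al by rewrite subr_gt0.
(* At this rate the whole arc can afford exactly G; [d0] is then chosen so that h(r) >= r / g up to
   [d0]. *)
pose g := (be - al) / 256 / G.
have g0 : 0 < g by rewrite !divr_gt0.
have [d0 d00 Hd] := h_inf g^-1.
exists d0 => // V dd a dd0 Vd ddd a0 ah cov.
rewrite leNgt; apply/negP => sumG.
pose st := (R * R * R * nat)%type.
pose Inv (s : st) := cheap V dd a s.1.1.1 s.1.1.2 s.1.2.
pose Rel (s s' : st) := Inv s -> [/\ Inv s',
   s.1.1.1 <= s'.1.1.1 /\ s'.1.1.2 <= s.1.1.2,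
   s'.1.1.2 - s'.1.1.1 <= (s.1.1.2 - s.1.1.1) / 2,
   (cost V a s'.1.1.1 s'.1.1.2 < (h (s'.1.1.2 - s'.1.1.1))%:E)%E &
   (s.2 < s'.2)%N /\ forall x, s'.1.1.1 <= x <= s'.1.1.2 -> E s'.2 x].
have step (s : st) : {s' : st | Rel s s'}.
  apply: cid; have [IS|NI] := pselect (Inv s); last by exists s.
  have [u' [v' [g' [t [c1 c2 c3 c4 c5]]]]] := cheap_child s.2.+1 dd0 Vd a0 ah IS.
  by exists (u', v', g', t).
have [F [F0 FS]] := dependent_choice step (al, be, g, 0%N).
have Inv0 : Inv (F 0%N).
  rewrite F0; split => //=; split.
    apply: (@le_lt_trans _ _ (\sum_(0 <= i <oo) (a i)%:E)%E).
      apply: lee_nneseries => [i _ _|i _]; rewrite lee_fin; case: ifP => // _; exact: ltW.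
    apply: (lt_le_trans sumG); rewrite lee_fin /g le_eqVlt; apply/orP; left; apply/eqP.
    by field; rewrite !lt0r_neq0.
  move=> i _ di; rewrite -ler_pdivrMl// ; exact: Hd.
have InvF k : Inv (F k) by elim: k => // k IH; have [] := FS k IH.
pose u k := (F k).1.1.1; pose v k := (F k).1.1.2.
have uS k : u k <= u k.+1 by have [_ []] := FS k (InvF k).
have vS k : v k.+1 <= v k by have [_ []] := FS k (InvF k).
have uv k : u k < v k by have [] := InvF k.
have lenS k : v k.+1 - u k.+1 <= (v k - u k) / 2 by have [_ _] := FS k (InvF k).
have um m k : u m <= u (m + k)%N.
  by elim: k => [|k IH]; rewrite ?addn0// addnS; apply: le_trans IH (uS _).
have vm m k : v (m + k)%N <= v m.
  by elim: k => [|k IH]; rewrite ?addn0// addnS; apply: le_trans (vS _) IH.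
have uvm m k : u m <= v k.
  have := um m k; have := vm k m; rewrite addnC => h1 h2.
  by apply: (le_trans h2); apply: le_trans h1; exact: ltW.
pose x := sup (range u).
have hs : has_sup (range u).
  by split; [exists (u 0%N), 0%N|exists (v 0%N) => _ [m _ <-]; exact: uvm].
have xu k : u k <= x by apply: ub_le_sup; [exact: hs.2|exists k].
have xv k : x <= v k.
  by apply: sup_le_ub => [|_ [m _ <-]]; [exact: hs.1|exact: uvm].
have lenk k : v k - u k <= (be - al) / 2 ^+ k.
  elim: k => [|k IH]; first by rewrite /v /u F0 /= expr0 divr1.
  apply: (le_trans (lenS k)); rewrite exprSr invfM mulrA.
  by rewrite ler_pM2r ?invr_gt0.
have tS k : ((F k).2 < (F k.+1).2)%N by have [_ _ _ _ []] := FS k (InvF k).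
have tk k : (k <= (F k).2)%N.
  by elim: k => // k IH; exact: leq_ltn_trans IH (tS k).
have xE k : E (F k.+1).2 x.
  by have [_ _ _ _ [_]] := FS k (InvF k); apply; rewrite xu xv.
have xJ : al <= x <= be.
  by have := xu 0%N; have := xv 0%N; rewrite /u /v F0 /= => -> ->.
have [i Vi] : exists i, V i x.
  apply: cov => // m; exists (F m.+1).2; last exact: xE.
  exact: leq_trans (leqnSn m) (tk _).
have [r r0 hr] := h_zero (a0 i).
have [k Hk] : exists k, (be - al) / 2 ^+ k <= r.
  exists (Num.truncn ((be - al) / r)).+1; rewrite ler_pdivrMr ?exprn_gt0//.
  rewrite mulrC -ler_pdivrMr//.
  apply: (@le_trans _ _ ((Num.truncn ((be - al) / r)).+1%:R)).
    by apply: ltW; rewrite -truncn_le_nat.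
  by rewrite -natrX ler_nat ltnW// ltn_expl.
have [_ _ _ ck _] := FS k (InvF k).
have : a i < h (v k.+1 - u k.+1).
  rewrite -lte_fin; apply: le_lt_trans ck.
  apply: le_trans (nneseries_ge_term i _).
    by rewrite asboolT//; exists x => //; rewrite -/(u k.+1) -/(v k.+1) xu xv.
  by move=> j; rewrite lee_fin; case: ifP => // _; exact: ltW.
have lr : v k.+1 - u k.+1 <= r.
  apply: (le_trans (lenS k)); apply: le_trans Hk; apply: le_trans (lenk k).
  by have := uv k; lra.
have l1 : 0 < v k.+1 - u k.+1 by rewrite subr_gt0.
have := h_mono l1 lr; lra.
Qed.

End Cantor.

(** * Null sets *)

Section NullSets.
Context {R : realType} (h : R -> R).
Context (h_pos : forall r, 0 < r -> 0 < h r)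
  (h_mono : forall r s, 0 < r -> r <= s -> h r <= h s)
  (h_dec : forall r s, 0 < r -> r <= s -> h s * r <= h r * s).

Lemma ler_sum_subset (T : eqType) (s s' : seq T) (F : T -> R) :
  uniq s -> uniq s' -> {subset s <= s'} -> (forall x, 0 <= F x) ->
  \sum_(x <- s) F x <= \sum_(x <- s') F x.
Proof.
move=> us us' ss F0.
have p : perm_eq s' (s ++ [seq x <- s' | x \notin s]).
  apply: uniq_perm => // [|x].
    rewrite cat_uniq us filter_uniq// andbT /=; apply/hasPn => x.
    by rewrite mem_filter => /andP[].
  rewrite mem_cat mem_filter; case: (boolP (x \in s)) => //= xs.
  exact: ss.
by rewrite (perm_big _ p) big_cat /= lerDl sumr_ge0.
Qed.

Lemma gauge_ge0 r : 0 <= gauge h r.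
Proof. by rewrite /gauge; case: ifP => // r0; rewrite ltW// h_pos. Qed.

Lemma gauge_le r s : 0 <= r -> r <= s -> gauge h r <= gauge h s.
Proof.
move=> r0 rs; rewrite {1}/gauge; case: ifP => [r1|_]; last exact: gauge_ge0.
by rewrite /gauge (lt_le_trans r1 rs) h_mono.
Qed.

Lemma gauge_scale L r : 1 <= L -> 0 <= r -> gauge h (L * r) <= L * gauge h r.
Proof.
move=> L1; have L0 : 0 < L by exact: lt_le_trans L1.
rewrite le_eqVlt => /predU1P[<-|r0]; first by rewrite mulr0 /gauge ltxx mulr0.
rewrite /gauge r0 mulr_gt0//.
have := @h_dec r (L * r) r0; rewrite ler_peMl ?(ltW r0)// => /(_ isT).
by rewrite [h r * _]mulrA ler_pM2r// (mulrC L (h r)).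
Qed.

Section Metric.
Context {X : Type} (d : X -> X -> R).
Context (d0 : forall x y, 0 <= d x y).

Lemma hausdorff_measure_ge0 (A : set X) : (0 <= hausdorff_measure d h A)%E.
Proof.
apply: le_ereal_sup_tmp; exists (hausdorff_content d h 1 A).
  by exists 1 => //=; rewrite ltr01.
apply: le_ereal_inf_tmp => _ [U _ <-].
by apply: nneseries_ge0 => i _ _; rewrite lee_fin gauge_ge0.
Qed.

Lemma diam_le (U : set X) r x y : (diam d U <= r%:E)%E -> U x -> U y -> d x y <= r.
Proof.
move=> Ur Ux Uy; rewrite -lee_fin; apply: le_trans Ur.
by apply: ereal_sup_ubound; exists (x, y).
Qed.

Lemma fine_diam (U : set X) r : 0 <= r -> (diam d U <= r%:E)%E ->
  [/\ 0 <= fine (diam d U), fine (diam d U) <= r &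
      forall x y, U x -> U y -> d x y <= fine (diam d U)].
Proof.
move=> r0 Ur; have [[x Ux]|U0] := pselect (exists x, U x); last first.
  have UE : U = set0 by apply/seteqP; split => // x Ux; apply: U0; exists x.
  have -> : diam d U = -oo%E.
    by rewrite /diam UE set0X image_set0 ereal_sup0.
  by split => //= x y Ux; exfalso; apply: U0; exists x.
have D0 : (0 <= diam d U)%E.
  apply: (@le_trans _ _ (d x x)%:E); first by rewrite lee_fin.
  by apply: ereal_sup_ubound; exists (x, x).
have Df : diam d U = (fine (diam d U))%:E.
  rewrite fineK// ge0_fin_numE//; apply: le_lt_trans Ur _; exact: ltry.
split; [exact: fine_ge0|by rewrite -lee_fin -Df|].
by move=> y z Uy Uz; apply: diam_le Uy Uz; rewrite -Df.
Qed.

(** Trades extended diameters and infinite series for real bounds [r i] and finite sums;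
    [null_intro] is the way back. *)
Lemma null_cover (A : set X) e dl : hausdorff_measure d h A = 0%E -> 0 < e -> 0 < dl ->
  exists (U : nat -> set X) (r : nat -> R), [/\ A `<=` \bigcup_i U i,
    forall i, 0 <= r i <= dl, forall i x y, U i x -> U i y -> d x y <= r i &
    forall s, uniq s -> \sum_(i <- s) gauge h (r i) <= e].
Proof.
move=> A0 e0 dl0.
have : (hausdorff_content d h dl A < e%:E)%E.
  apply: (@le_lt_trans _ _ 0%E); last by rewrite lte_fin.
  by rewrite -A0; apply: ereal_sup_ubound; exists dl.
move=> /ereal_inf_lt[_ [U [AU Ud] <-] Ue].
exists U, (fun i => fine (diam d (U i))).
have fd i := fine_diam (ltW dl0) (Ud i).
split => //.
- by move=> i; have [-> ->] := fd i.
- by move=> i; have [_ _] := fd i.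
move=> s us; pose n := (\max_(i <- s) i).+1.
apply: (@le_trans _ _ (\sum_(i <- index_iota 0 n) gauge h (fine (diam d (U i))))).
  apply: ler_sum_subset => //; first exact: iota_uniq.
    by move=> i si; rewrite mem_index_iota /= ltnS leq_bigmax_seq.
  by move=> i; exact: gauge_ge0.
rewrite -lee_fin -sumEFin; apply: le_trans (ltW Ue).
by apply: nneseries_lim_ge => i _ _; rewrite lee_fin gauge_ge0.
Qed.

(** A general countable index admits covers by pairs or integer triples. Natural numbers that code
    nothing receive the empty set, which costs 0. *)
Lemma null_intro (T : countType) (A : set X) :
  (forall e dl, 0 < e -> 0 < dl -> exists (U : T -> set X) (r : T -> R),
    [/\ A `<=` \bigcup_i U i,
    forall i, 0 <= r i <= dl, forall i x y, U i x -> U i y -> d x y <= r i &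
    forall s, uniq s -> \sum_(i <- s) gauge h (r i) <= e]) ->
  hausdorff_measure d h A = 0%E.
Proof.
move=> H; apply/eqP; rewrite eq_le hausdorff_measure_ge0 andbT.
apply: ge_ereal_sup => _ [dl /= dl0 <-]; apply/lee_addgt0Pr => e e0; rewrite add0e.
have [U [r [AU rd Ur sr]]] := H e dl e0 dl0.
pose U' n := if pickle_inv n is Some t then U t else set0.
have Udiam n : (diam d (U' n) <= (oapp r 0 (@pickle_inv T n))%:E)%E.
  rewrite /U'; case: (pickle_inv n) => [t|] /=.
    by apply: ge_ereal_sup => _ [[x y] [/= Ux Uy] <-]; rewrite lee_fin; exact: Ur Ux Uy.
  by rewrite /diam set0X image_set0 ereal_sup0 leNye.
have r0 n : 0 <= oapp r 0 (@pickle_inv T n).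
  by case: (pickle_inv n) => [t|] //=; have /andP[] := rd t.
apply: (@le_trans _ _ (\sum_(0 <= i <oo) (gauge h (fine (diam d (U' i))))%:E)%E).
  apply: ereal_inf_lbound; exists U' => //; split.
    move=> x /AU[t _ Ux]; exists (pickle t) => //.
    by rewrite /U' pickleK_inv.
  move=> n; apply: le_trans (Udiam n) _; rewrite lee_fin.
  by case: (pickle_inv n) => [t|] /=; [have /andP[] := rd t|exact: ltW].
apply: lime_le.
  by apply: is_cvg_nneseries => i _ _; rewrite lee_fin gauge_ge0.
apply: nearW => n; rewrite sumEFin lee_fin.
apply: (@le_trans _ _ (\sum_(0 <= i < n) oapp (fun t => gauge h (r t)) 0 (@pickle_inv T i))).
  apply: ler_sum => i _; have [a b _] := fine_diam (r0 i) (Udiam i).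
  apply: le_trans (gauge_le a b) _; case: (pickle_inv i) => //=.
  by rewrite /gauge ltxx.
rewrite -big_pmap; apply: sr; apply: pmap_uniq (iota_uniq _ _).
exact: pickle_invK.
Qed.

Lemma null_subset (A B : set X) : A `<=` B ->
  hausdorff_measure d h B = 0%E -> hausdorff_measure d h A = 0%E.
Proof.
move=> AB B0; apply: (@null_intro nat) => e dl e0 dl0.
have [U [r [BU rd Ur sr]]] := null_cover B0 e0 dl0.
by exists U, r; split => // x /AB /BU.
Qed.

Lemma sum_geometric_half (e : R) n : 0 <= e ->
  \sum_(0 <= k < n) e / 2 ^+ k.+1 <= e.
Proof.
move=> e0; suff -> : \sum_(0 <= k < n) e / 2 ^+ k.+1 = e - e / 2 ^+ n.
  by rewrite lerBlDr lerDl divr_ge0.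
elim: n => [|n IH]; first by rewrite big_geq// expr0 divr1 subrr.
rewrite big_nat_recr//= IH exprS; field.
by rewrite lt0r_neq0// exprn_gt0.
Qed.

Lemma null_bigcup_nat (A : nat -> set X) :
  (forall k, hausdorff_measure d h (A k) = 0%E) ->
  hausdorff_measure d h (\bigcup_k A k) = 0%E.
Proof.
move=> A0; apply: (@null_intro (nat * nat)%type) => e dl e0 dl0.
have ek k : 0 < e / 2 ^+ k.+1 by rewrite divr_gt0// exprn_gt0.
have [Ur HUr] : {Ur : nat -> (nat -> set X) * (nat -> R) &
  forall k, [/\ A k `<=` \bigcup_i (Ur k).1 i,
    forall i, 0 <= (Ur k).2 i <= dl,
    forall i x y, (Ur k).1 i x -> (Ur k).1 i y -> d x y <= (Ur k).2 i &
    forall s, uniq s -> \sum_(i <- s) gauge h ((Ur k).2 i) <= e / 2 ^+ k.+1]}.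
  apply: (choice (P := fun k (Ur : (nat -> set X) * (nat -> R)) =>
   [/\ A k `<=` \bigcup_i Ur.1 i, forall i, 0 <= Ur.2 i <= dl,
    forall i x y, Ur.1 i x -> Ur.1 i y -> d x y <= Ur.2 i &
    forall s, uniq s -> \sum_(i <- s) gauge h (Ur.2 i) <= e / 2 ^+ k.+1])) => k.
  by have [U [r H]] := null_cover (A0 k) (ek k) dl0; exists (U, r).
exists (fun p => (Ur p.1).1 p.2), (fun p => (Ur p.1).2 p.2); split.
- move=> x [k _ Ax]; have [cov _ _ _] := HUr k.
  by have [i _ Ui] := cov x Ax; exists (k, i).
- by move=> [k i]; have [_ + _ _] := HUr k; apply.
- by move=> [k i]; have [_ _ + _] := HUr k; apply.
move=> s us.
pose m := (\max_(p <- s) maxn p.1 p.2).+1.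
pose s' := [seq (i1, i2) | i1 <- index_iota 0 m, i2 <- index_iota 0 m].
apply: (@le_trans _ _ (\sum_(p <- s') gauge h ((Ur p.1).2 p.2))).
  apply: ler_sum_subset => //.
  - by apply: allpairs_uniq; rewrite ?iota_uniq// => -[a b] [a' b'].
  - move=> [a b] ps; apply/allpairsP; exists (a, b); rewrite /= !mem_index_iota /= !ltnS.
    have : (maxn a b <= \max_(p <- s) maxn p.1 p.2)%N.
      exact: (@leq_bigmax_seq _ s predT (fun p => maxn p.1 p.2) (a, b)).
    by rewrite geq_max => /andP[-> ->].
  - by move=> p; exact: gauge_ge0.
rewrite /s' big_allpairs /=.
apply: le_trans (sum_geometric_half m (ltW e0)).
apply: ler_sum => k _; have [_ _ _] := HUr k; apply; exact: iota_uniq.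
Qed.

Lemma null_set0 : hausdorff_measure d h set0 = 0%E.
Proof.
apply: (@null_intro nat) => e dl e0 dl0; exists (fun _ => set0), (fun _ => 0).
split => // [i|s _]; first by rewrite lexx ltW.
by rewrite big1 ?ltW// => i _; rewrite /gauge ltxx.
Qed.

Lemma null_bigcup (T : countType) (A : T -> set X) :
  (forall k, hausdorff_measure d h (A k) = 0%E) ->
  hausdorff_measure d h (\bigcup_k A k) = 0%E.
Proof.
move=> A0.
apply: (@null_subset _ (\bigcup_n oapp A set0 (@pickle_inv T n))).
  by move=> x [t _ Ax]; exists (pickle t) => //; rewrite pickleK_inv.
apply: null_bigcup_nat => n; case: (pickle_inv n) => [t|] /=; first exact: A0.
exact: null_set0.
Qed.

Lemma null_setU (A B : set X) : hausdorff_measure d h A = 0%E ->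
  hausdorff_measure d h B = 0%E -> hausdorff_measure d h (A `|` B) = 0%E.
Proof.
move=> A0 B0; apply: (@null_subset _ (\bigcup_(b : bool) (if b then A else B))).
  by move=> x [Ax|Bx]; [exists true|exists false].
by apply: null_bigcup => -[].
Qed.

Lemma null_subsingleton (A : set X) : (forall x, d x x = 0) ->
  (forall x y, A x -> A y -> x = y) -> hausdorff_measure d h A = 0%E.
Proof.
move=> dxx A1; apply: (@null_intro nat) => e dl e0 dl0.
exists (fun _ => A), (fun _ => 0); split => //.
- by move=> x Ax; exists 0%N.
- by move=> _; rewrite lexx ltW.
- by move=> _ x y Ax Ay; rewrite (A1 x y Ax Ay) dxx.
- by move=> s _; rewrite big1 ?ltW// => i _; rewrite /gauge ltxx.
Qed.

End Metric.

Lemma dist1_ge0 (x y : R) : 0 <= dist1 x y.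
Proof. exact: normr_ge0. Qed.

Lemma dist2_ge0 (x y : R * R) : 0 <= dist2 x y.
Proof. exact: sqrtr_ge0. Qed.

Lemma dist2xx (x : R * R) : dist2 x x = 0.
Proof. by rewrite /dist2 !subrr expr0n addr0 sqrtr0. Qed.

Lemma dist2_ge1 (x y : R * R) : `|x.1 - y.1| <= dist2 x y.
Proof. by rewrite /dist2 -sqrtr_sqr ler_wsqrtr// lerDl sqr_ge0. Qed.

Lemma dist2_le (x y : R * R) : dist2 x y <= `|x.1 - y.1| + `|x.2 - y.2|.
Proof.
rewrite /dist2 -(ler_pXn2r (ltn0Sn 1)) ?nnegrE ?sqrtr_ge0 ?addr_ge0//.
rewrite sqr_sqrtr ?addr_ge0 ?sqr_ge0// [leRHS]sqrrD !real_normK ?num_real//.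
by rewrite addrAC lerDl mulrn_wge0// mulr_ge0.
Qed.

Lemma null_graph (f : R -> R) (A : set R) (K : R) : 0 <= K ->
  (forall x y, A x -> A y -> `|f x - f y| <= K * `|x - y|) ->
  hausdorff_measure dist1 h A = 0%E ->
  hausdorff_measure dist2 h [set (x, f x) | x in A] = 0%E.
Proof.
move=> K0 fK A0; apply: (null_intro dist2_ge0 (T := nat)) => e dl e0 dl0.
have K1 : 0 < 1 + K by lra.
have K11 : 1 <= 1 + K by lra.
have [U [r [AU rd Ur sr]]] := null_cover dist1_ge0 A0 (divr_gt0 e0 K1) (divr_gt0 dl0 K1).
exists (fun i => [set (x, f x) | x in A `&` U i]), (fun i => (1 + K) * r i); split.
- by move=> _ [x Ax <-]; have [i _ Ui] := AU x Ax; exists i => //; exists x.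
- move=> i; have /andP[r0 r1] := rd i; rewrite mulr_ge0 ?(ltW K1)//=.
  by rewrite mulrC -ler_pdivlMr.
- move=> i _ _ [x [Ax Ux] <-] [y [Ay Uy] <-].
  apply: le_trans (dist2_le _ _) _ => /=.
  apply: (@le_trans _ _ ((1 + K) * `|x - y|)).
    by rewrite mulrDl mul1r lerD2l fK.
  by rewrite ler_pM2l//; exact: Ur Ux Uy.
- move=> s us; apply: (@le_trans _ _ (\sum_(i <- s) (1 + K) * gauge h (r i))).
    by apply: ler_sum => i _; apply: gauge_scale => //; have /andP[] := rd i.
  by rewrite -mulr_sumr mulrC -ler_pdivlMr// sr.
Qed.

(** For small r the gauge dominates r, so a cover of small cost would have small total length,
    against Lebesgue measure. *)
Lemma interval_not_null (a b : R) : a < b ->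
  (exists2 r0, 0 < r0 & forall r, 0 < r -> r <= r0 -> r <= h r) ->
  hausdorff_measure dist1 h [set x | a <= x <= b] != 0%E.
Proof.
move=> ab [r0 r00 hr]; apply/eqP => A0.
have e0 : 0 < (b - a) / 4 by rewrite divr_gt0// subr_gt0.
have [U [r [AU rd Ur sr]]] := null_cover dist1_ge0 A0 e0 r00.
have [c Hc] : {c : nat -> R & forall i x, U i x -> `|x - c i| <= r i}.
  apply: (choice (P := fun i c => forall x, U i x -> `|x - c| <= r i)) => i.
  have [[c Uc]|U0] := pselect (exists c, U i c).
    by exists c => x Ux; exact: Ur.
  by exists 0 => x Ux; exfalso; apply: U0; exists x.
pose F i : set R := `[c i - r i, c i + r i]%classic.
have cov : `[a, b]%classic `<=` \bigcup_i F i.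
  move=> x /=; rewrite in_itv /= => xab; have [i _ Ui] := AU x xab; exists i => //.
  rewrite /F /= in_itv /=; have := Hc i x Ui; rewrite ler_norml => /andP[? ?].
  by apply/andP; split; lra.
have /= := measure_sigma_subadditive (@lebesgue_measure R)
  (fun n => measurable_itv _) (measurable_itv _) cov.
rewrite lebesgue_measure_itv /= lte_fin ab => H.
have {H} : ((b - a)%:E <= \sum_(0 <= i <oo) (2 * r i)%:E)%E.
  rewrite EFinB; apply: (le_trans H); apply: lee_nneseries => [i _ _|i _].
    exact: measure_ge0.
  rewrite lebesgue_measure_itv /=; case: ifP => _.
    by rewrite -EFinB lee_fin; lra.
  by rewrite lee_fin mulr_ge0//; have /andP[] := rd i.
apply/negP; rewrite -ltNge.
apply: (@le_lt_trans _ _ ((b - a) / 2)%:E); last by rewrite lte_fin; lra.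
have r2 i : 0 <= 2 * r i by rewrite mulr_ge0//; have /andP[] := rd i.
apply: lime_le.
  by apply: is_cvg_nneseries => i _ _; rewrite lee_fin.
apply: nearW => n; rewrite sumEFin lee_fin.
apply: (@le_trans _ _ (\sum_(0 <= i < n) 2 * gauge h (r i))).
  apply: ler_sum => i _; rewrite ler_pM2l//; have /andP[ri ri'] := rd i.
  rewrite /gauge; case: ifP => [rp|]; first exact: hr.
  by move=> /negbT; rewrite -leNgt.
rewrite -mulr_sumr; have := sr (index_iota 0 n) (iota_uniq _ _); lra.
Qed.

End NullSets.

(** * Dyadic condensation *)

Section Condensation.
Context {R : realType}.

Lemma unbounded_tail (w : nat -> R) (T : pred nat) t2 : (forall t, 0 <= w t) ->
  (forall M, exists n, M <= \sum_(0 <= t < n | T t) w t) ->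
  forall M, exists n, M <= \sum_(0 <= t < n | T t && (t2 <= t)%N) w t.
Proof.
move=> w0 div M; have [n Hn] := div (M + \sum_(0 <= t < t2) w t); exists n.
move: Hn; rewrite [X in _ <= X -> _](bigID (fun t => (t2 <= t)%N)) /=.
have : \sum_(0 <= t < n | T t && ~~ (t2 <= t)%N) w t <= \sum_(0 <= t < t2) w t.
  rewrite -big_filter; apply: ler_sum_subset => //.
  - by rewrite filter_uniq// iota_uniq.
  - exact: iota_uniq.
  - by move=> t; rewrite mem_filter !mem_index_iota -ltnNge => /andP[/andP[_ ->]].
by lra.
Qed.

Lemma sum_by_level (T : eqType) (k : T -> nat) (G : nat -> R) (s : seq T) m n :
  (forall v, v \in s -> (m <= k v < n)%N) ->
  \sum_(v <- s) G (k v) = \sum_(m <= t < n) (count (fun v => k v == t) s)%:R * G t.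
Proof.
elim: s => [|v s IH] H; first by rewrite big_nil big1// => t _; rewrite mul0r.
rewrite big_cons IH; last by move=> w ws; apply: H; rewrite inE ws orbT.
have -> : \sum_(m <= t < n) (count (fun v => k v == t) (v :: s))%:R * G t =
   \sum_(m <= t < n) ((k v == t)%:R * G t + (count (fun v => k v == t) s)%:R * G t).
  by apply: eq_bigr => t _; rewrite /= natrD mulrDl.
rewrite big_split /=; congr (_ + _).
rewrite (bigD1_seq (k v)) ?iota_uniq//=; last first.
  by rewrite mem_index_iota; apply: H; rewrite inE eqxx.
rewrite eqxx mul1r big1 ?addr0// => t; rewrite eq_sym => /negbTE ->.
by rewrite mul0r.
Qed.

Lemma bounded_tail (a : nat -> R) (B : R) : (forall q, 0 <= a q) ->
  (forall n, \sum_(0 <= q < n) a q <= B) ->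
  forall e, 0 < e -> exists n0, forall m n, (n0 <= m)%N -> \sum_(m <= q < n) a q <= e.
Proof.
move=> a0 aB e e0; pose S n := \sum_(0 <= q < n) a q.
have hs : has_sup (range S) by split; [exists (S 0%N), 0%N|exists B => _ [n _ <-]; exact: aB].
have [_ [n0 _ <-] Hn0] := sup_adherent e0 hs.
exists n0 => m n nm.
have [mn|nm'] := leqP m n; last by rewrite big_geq ?ltW// ltnW.
have : S n <= sup (range S) by apply: ub_le_sup; [exact: hs.2|exists n].
have : S n0 <= S m by rewrite /S (@big_cat_nat _ _ _ n0 0 m)//= lerDl sumr_ge0.
have : S n = S m + \sum_(m <= q < n) a q by rewrite /S (@big_cat_nat _ _ _ m 0 n).
by lra.
Qed.

Definition volume (h : R -> R) (mu nu : nat -> R) q := q%:R * h (mu q / q%:R) * nu q.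

Context (h : R -> R) (h_pos : forall r, 0 < r -> 0 < h r)
  (h_mono : forall r s, 0 < r -> r <= s -> h r <= h s).
Context (mu nu : nat -> R) (mu_pos : forall q, (0 < q)%N -> 0 < mu q)
  (nu_pos : forall q, (0 < q)%N -> 0 < nu q)
  (mu_dec : forall p q, (0 < p <= q)%N -> mu q <= mu p)
  (nu_dec : forall p q, (0 < p <= q)%N -> nu q <= nu p).

Let a := volume h mu nu.

Lemma volume_bounds p q s : (0 < p <= q)%N -> (q <= s)%N ->
  p%:R * h (mu s / s%:R) * nu s <= a q <= s%:R * h (mu p / p%:R) * nu p.
Proof.
move=> /andP[p0 pq] qs; have q0 : (0 < q)%N by exact: leq_trans pq.
have s0 : (0 < s)%N by exact: leq_trans qs.
have P x : (0 < x)%N -> 0 < mu x / x%:R by move=> x0; rewrite divr_gt0 ?mu_pos ?ltr0n.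
have D x y : (0 < x <= y)%N -> mu y / y%:R <= mu x / x%:R.
  move=> /andP[x0 xy]; have y0 : (0 < y)%N by exact: leq_trans xy.
  apply: ler_pM; rewrite ?(ltW (mu_pos _)) ?invr_ge0//.
    by rewrite mu_dec// x0.
  by rewrite lef_pV2 ?posrE ?ltr0n// ler_nat.
have H x y : (0 < x <= y)%N -> h (mu y / y%:R) <= h (mu x / x%:R).
  by move=> xy; apply: h_mono; [apply: P; case/andP: xy => x0; exact: leq_trans|exact: D].
have H0 x : (0 < x)%N -> 0 <= h (mu x / x%:R) by move=> x0; rewrite ltW// h_pos// P.
have N0 x : (0 < x)%N -> 0 <= nu x by move=> x0; rewrite ltW// nu_pos.
by apply/andP; split; (apply: ler_pM; rewrite ?mulr_ge0 ?H0 ?N0//;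
  [apply: ler_pM; rewrite ?H0 ?ler_nat ?H ?p0 ?q0 ?s0//|
   by rewrite nu_dec// ?p0 ?q0]).
Qed.

Lemma sum_const_nat_le m n (F : nat -> R) c : (m <= n)%N ->
  (forall q, (m <= q < n)%N -> F q <= c) -> \sum_(m <= q < n) F q <= (n - m)%:R * c.
Proof.
move=> mn H; rewrite mulr_natl -sumr_const_nat.
by rewrite big_nat [leRHS]big_nat; apply: ler_sum => q; exact: H.
Qed.

Lemma sum_const_nat_ge m n (F : nat -> R) c : (m <= n)%N ->
  (forall q, (m <= q < n)%N -> c <= F q) -> (n - m)%:R * c <= \sum_(m <= q < n) F q.
Proof.
move=> mn H; rewrite mulr_natl -sumr_const_nat.
by rewrite big_nat [leRHS]big_nat; apply: ler_sum => q; exact: H.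
Qed.

Lemma expn2D n : (2 ^ n.+1 - 2 ^ n = 2 ^ n)%N.
Proof. by rewrite expnS mul2n -addnn addnK. Qed.

(** The argument of [h] keeps 2^t under a value of [mu] at 2^(t+1): this matches denominators
    between 2^t and 2^(t+1) in the divergence argument. *)
Lemma volume_block_le t :
  \sum_(2 ^ t.+1 <= q < 2 ^ t.+2) a q <=
  8 * (4 ^+ t * nu (2 ^ t.+1) * h (mu (2 ^ t.+1) / 2 ^+ t)).
Proof.
apply: (@le_trans _ _ ((2 ^ t.+2 - 2 ^ t.+1)%N%:R *
   ((2 ^ t.+2)%:R * h (mu (2 ^ t.+1) / (2 ^ t.+1)%:R) * nu (2 ^ t.+1)))).
  apply: sum_const_nat_le; first by rewrite leq_exp2l.
  move=> q /andP[q1 q2].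
  have pq : (0 < 2 ^ t.+1 <= q)%N by rewrite expn_gt0.
  by have /andP[] := volume_bounds pq (ltnW q2).
rewrite expn2D !natrX.
have p2 : 0 < 2 ^+ t :> R by rewrite exprn_gt0.
have -> : 4 ^+ t = 2 ^+ t * 2 ^+ t :> R by rewrite -exprMn -natrM.
have n0 : 0 < nu (2 ^ t.+1) by rewrite nu_pos// expn_gt0.
have m0 : 0 < mu (2 ^ t.+1) by rewrite mu_pos// expn_gt0.
have -> : forall x y : R, 2 ^+ t.+1 * (2 ^+ t.+2 * x * y) = 8 * (2 ^+ t * 2 ^+ t * y * x).
  by move=> x y; rewrite !exprS; ring.
rewrite !ler_pM2l ?mulr_gt0//; apply: h_mono; first by rewrite divr_gt0 ?exprn_gt0.
by rewrite ler_pM2l// lef_pV2 ?posrE ?exprn_gt0// ler_eXn2l ?ltr1n.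
Qed.

(** The block is open on the left and closed on the right, so the functions at its right end are a
    lower bound throughout; only the factor q is estimated by the left end. *)
Lemma volume_block_ge t :
  4 ^+ t.+1 * nu (2 ^ t.+1) * h (mu (2 ^ t.+1) / 2 ^+ t.+1) <=
  4 * \sum_((2 ^ t).+1 <= q < (2 ^ t.+1).+1) a q.
Proof.
apply: (@le_trans _ _ (4 * (((2 ^ t.+1).+1 - (2 ^ t).+1)%N%:R *
   ((2 ^ t)%:R * h (mu (2 ^ t.+1) / (2 ^ t.+1)%:R) * nu (2 ^ t.+1))))); last first.
  rewrite ler_pM2l//; apply: sum_const_nat_ge; first by rewrite ltnS leq_exp2l.
  move=> q /andP[q1 q2].
  have pq : (0 < 2 ^ t <= q)%N by rewrite expn_gt0 (ltnW q1).
  by have /andP[] := volume_bounds pq q2.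
rewrite subSS expn2D !natrX.
have -> : 4 ^+ t.+1 = 4 * (2 ^+ t * 2 ^+ t) :> R by rewrite exprS -exprMn -natrM.
by rewrite le_eqVlt; apply/orP; left; apply/eqP; ring.
Qed.

Lemma volume_dyadic_unbounded : (forall M, exists n, M <= \sum_(1 <= q < n) a q) ->
  forall M, exists n, M <= \sum_(0 <= t < n)
    4 ^+ t * nu (2 ^ t.+1) * h (mu (2 ^ t.+1) / 2 ^+ t).
Proof.
move=> div M; have [n Hn] := div (8 * `|M| + a 1%N); exists n.
have a0 q : (0 < q)%N -> 0 <= a q.
  by move=> q0; rewrite /a /volume !mulr_ge0 ?(ltW (nu_pos q0))// ltW// h_pos// divr_gt0 ?mu_pos ?ltr0n.
have blk m : \sum_(1 <= q < 2 ^ m.+1) a q <= a 1%N + 8 * \sum_(0 <= t < m)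
    4 ^+ t * nu (2 ^ t.+1) * h (mu (2 ^ t.+1) / 2 ^+ t).
  elim: m => [|m IH]; first by rewrite expn1 big_nat1 big_geq// mulr0 addr0.
  rewrite (@big_cat_nat _ _ _ (2 ^ m.+1)) ?expn_gt0 ?leq_exp2l//=.
  by rewrite big_nat_recr//= mulrDr addrA; apply: lerD => //; exact: volume_block_le.
have n2 : (n <= 2 ^ n.+1)%N by apply: ltnW; apply: leq_trans (ltn_expl n.+1 _).
have : \sum_(1 <= q < n) a q <= \sum_(1 <= q < 2 ^ n.+1) a q.
  have [n0|n0] := posnP n.
    rewrite n0 [leLHS]big_geq// big_nat sumr_ge0// => q /andP[q0 _]; exact: a0.
  rewrite [leRHS](@big_cat_nat _ _ _ n)//= lerDl big_nat sumr_ge0// => q /andP[q0 _].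
  by apply: a0; exact: leq_trans q0.
by have := blk n; have := ler_norm M; lra.
Qed.

Lemma volume_dyadic_tail (B : R) : (forall n, \sum_(1 <= q < n) a q <= B) ->
  forall e, 0 < e -> exists t1, forall T,
  \sum_(t1 <= t < T) 4 ^+ t * nu (2 ^ t) * h (mu (2 ^ t) / 2 ^+ t) <= e.
Proof.
move=> aB e e0; pose b q := if (0 < q)%N then a q else 0.
have b0 q : 0 <= b q.
  rewrite /b; case: ifP => // q0.
  by rewrite /a /volume !mulr_ge0 ?(ltW (nu_pos q0))// ltW// h_pos// divr_gt0 ?mu_pos ?ltr0n.
have bE m n : (0 < m)%N -> \sum_(m <= q < n) b q = \sum_(m <= q < n) a q.
  move=> m0; apply: eq_big_nat => q /andP[q1 _]; rewrite /b ifT//; exact: leq_trans q1.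
have bB n : \sum_(0 <= q < n) b q <= B.
  case: n => [|n]; first by rewrite big_geq//; have := aB 0%N; rewrite big_geq.
  by rewrite big_ltn// /b /= add0r -/b bE.
have e4 : 0 < e / 4 by rewrite divr_gt0.
have [n0 Hn0] := bounded_tail b0 bB e4.
exists n0.+1 => T.
have blk m : \sum_(n0.+1 <= t < n0.+1 + m) 4 ^+ t * nu (2 ^ t) * h (mu (2 ^ t) / 2 ^+ t) <=
    4 * \sum_((2 ^ n0).+1 <= q < (2 ^ (n0 + m)).+1) a q.
  elim: m => [|m IH]; first by rewrite !addn0 !big_geq// mulr0.
  rewrite addnS big_nat_recr ?leq_addr//=.
  rewrite [X in _ <= _ * X](@big_cat_nat _ _ _ (2 ^ (n0 + m)).+1) ?ltnS ?leq_exp2l ?leq_addr//=;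
    last by rewrite addnS leqnSn.
  by rewrite mulrDr; apply: lerD => //; rewrite addSn addnS; exact: volume_block_ge.
have [nT|nT] := leqP n0.+1 T; last by rewrite big_geq ?ltW// ltnW.
rewrite -(subnKC nT); apply: (le_trans (blk _)).
rewrite -bE// mulrC -ler_pdivlMr//; apply: Hn0.
by rewrite ltnW// ltnS ltnW// ltn_expl.
Qed.

(** After k steps with 2^-k <= l1 the radius has shrunk by l1 and [h] by l2. Hence the tail S
    satisfies S <= k h(rho t) + l2 S. *)
Lemma regular_tail (rho : nat -> R) r0 l1 l2 : 0 < l1 -> 0 < l2 < 1 ->
  (forall r, 0 < r < r0 -> h (l1 * r) <= l2 * h r) ->
  (forall t, 0 < rho t) -> (forall t, rho t.+1 <= rho t / 2) ->
  exists2 C, 0 < C & forall t n, rho t < r0 ->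
    \sum_(t <= j < n) h (rho j) <= C * h (rho t).
Proof.
move=> l10 /andP[l20 l21] reg rho0 half.
have rhok j k : rho (j + k)%N <= rho j / 2 ^+ k.
  elim: k => [|k IH]; first by rewrite addn0 expr0 divr1.
  rewrite addnS; apply: (le_trans (half _)); rewrite exprSr invfM mulrA.
  by rewrite ler_pM2r ?invr_gt0.
have [k Hk] : exists k, (2 ^+ k)^-1 <= l1.
  exists (Num.truncn l1^-1).+1; rewrite -[leRHS]invrK lef_pV2 ?posrE ?exprn_gt0 ?invr_gt0//.
  apply: (@le_trans _ _ ((Num.truncn l1^-1).+1%:R)).
    by apply: ltW; rewrite -truncn_le_nat.
  by rewrite -natrX ler_nat ltnW// ltn_expl.
have d0 : 0 < 1 - l2 by lra.
exists (k.+1%:R / (1 - l2)); first by rewrite divr_gt0.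
move=> t n rt; set S := \sum_(t <= j < n) _.
have hr j : 0 < h (rho j) by exact: h_pos.
have mono j : (t <= j)%N -> rho j <= rho t.
  move=> tj; rewrite -(subnKC tj); apply: (le_trans (rhok _ _)).
  rewrite ler_pdivrMr ?exprn_gt0// ler_peMr ?(ltW (rho0 _))//.
  by rewrite exprn_ege1// ler1n.
have [tn|nt] := leqP t n; last first.
  by rewrite /S big_geq ?(ltnW nt)// mulr_ge0 ?divr_ge0 ?(ltW d0) ?(ltW (hr _)).
have h1 : S <= \sum_(t <= j < n + k) h (rho j).
  rewrite (@big_cat_nat _ _ _ n) ?leq_addr//= lerDl sumr_ge0// => j _; exact: ltW.
have h2 : \sum_(t <= j < n + k) h (rho j) <= k%:R * h (rho t) + l2 * S.
  rewrite (@big_cat_nat _ _ _ (t + k)) ?leq_addr ?leq_add2r//=; apply: lerD.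
    have := @sum_const_nat_le t (t + k) (fun j => h (rho j)) (h (rho t)) (leq_addr _ _).
    rewrite addKn; apply => q /andP[tq _]; apply: h_mono => //; exact: mono.
  rewrite big_addn addnK /S mulr_sumr big_nat [leRHS]big_nat.
  apply: ler_sum => j /andP[tj _].
  apply: (@le_trans _ _ (h (l1 * rho j))).
    apply: h_mono => //; apply: (le_trans (rhok _ _)).
    by rewrite mulrC ler_pM2r.
  by apply: reg; rewrite rho0 (le_lt_trans (mono j tj)).
rewrite mulrAC ler_pdivlMr// -natr1 mulrDl mul1r.
by have := hr t; lra.
Qed.

End Condensation.

(** * Measure on an arc *)

Section ArcMeasure.
Context {R : realType} (h : R -> R).
Context (h_pos : forall r, 0 < r -> 0 < h r)
  (h_mono : forall r s, 0 < r -> r <= s -> h r <= h s)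
  (h_dec : forall r s, 0 < r -> r <= s -> h s * r <= h r * s)
  (h_inf : forall M, exists2 r0, 0 < r0 & forall r, 0 < r -> r <= r0 -> M * r <= h r)
  (h_zero : forall e, 0 < e -> exists2 r, 0 < r & h r < e).

Definition decr_null (psi : nat -> R) : Prop :=
  [/\ forall q, (0 < q)%N -> 0 < psi q,
      forall p q, (0 < p <= q)%N -> psi q <= psi p &
      forall e, 0 < e -> exists n, forall q, (n <= q)%N -> psi q <= e].

Definition approx1 (psi : nat -> R) (th : R) (q : nat) (x : R) : Prop :=
  exists p : int, `|q%:R * x - th - p%:~R| < psi q.

Lemma decr_null_max psi1 psi2 : decr_null psi1 -> decr_null psi2 ->
  decr_null (fun q => Num.max (psi1 q) (psi2 q)).
Proof.
move=> [p1 d1 l1] [p2 d2 l2]; split.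
- by move=> q q0; rewrite lt_max p1.
- by move=> p q pq; rewrite ge_max !le_max d1// d2// orbT.
- move=> e e0; have [n1 H1] := l1 e e0; have [n2 H2] := l2 e e0.
  by exists (maxn n1 n2) => q; rewrite geq_max => /andP[q1 q2]; rewrite ge_max H1// H2.
Qed.

Lemma decr_null_min psi1 psi2 : decr_null psi1 -> decr_null psi2 ->
  decr_null (fun q => Num.min (psi1 q) (psi2 q)).
Proof.
move=> [p1 d1 l1] [p2 d2 l2]; split.
- by move=> q q0; rewrite lt_min p1// p2.
- by move=> p q pq; rewrite le_min !ge_min d1// d2// orbT.
- move=> e e0; have [n1 H1] := l1 e e0.
  by exists n1 => q q1; rewrite ge_min H1.
Qed.

Lemma dyadic_small psi e : decr_null psi -> 0 < e ->
  exists t0, forall t, (t0 <= t)%N -> psi (2 ^ t)%N <= e.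
Proof.
move=> [_ _ l] e0; have [n H] := l e e0; exists n => t nt; apply: H.
by apply: (leq_trans nt); rewrite ltnW// ltn_expl.
Qed.

Lemma pow2_large (M : R) : exists t0, forall t, (t0 <= t)%N -> M <= 2 ^+ t.
Proof.
exists (Num.truncn `|M|).+1 => t tt; apply: (le_trans (ler_norm M)).
apply: (@le_trans _ _ ((Num.truncn `|M|).+1%:R)).
  by apply: ltW; rewrite -truncn_le_nat.
by rewrite -natrX ler_nat (leq_trans tt)// ltnW// ltn_expl.
Qed.

Lemma near_mid (a b x m sg : R) : 0 < sg -> `|x - m| <= sg / 4 -> a + sg / 2 <= m ->
  m <= b - sg / 2 -> a <= x /\ x <= b.
Proof. by rewrite ler_norml => ? /andP[? ?] *; split; lra. Qed.

Lemma approx_arith (m M x y : R) : 0 < m -> m <= M -> x <= m / 4 -> y <= M / 2 ->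
  x < m /\ x + y < M.
Proof. by move=> *; split; lra. Qed.

(** The counting lemmas take exponents from 1/2 on; enlarging the exponent only weakens the lower
    bound on the larger function. *)
Lemma powR_max_half (eta : R) : eta < 1 -> exists2 eta1, 2^-1 <= eta1 < 1 &
  forall x : R, 1 <= x -> x `^ (- eta1) <= x `^ (- eta).
Proof.
move=> e1; exists (Num.max eta 2^-1).
  by rewrite le_max lexx orbT /= gt_max e1 invf_lt1// ltr1n.
move=> x x1; apply: ler_powR => //.
by rewrite lerN2 le_max lexx.
Qed.

(** The cover is indexed by triples (q, p1, p2). Each owns the piece of curve that it approximates,
    of diameter O(mu / 2^t) at level t of q, and [sharp_count] bounds the triples of a level that
    own something by O(4^t nu). *)
Lemma convergence_arc (f g : R -> R) al be K psi1 psi2 th1 th2 (eta : R) :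
  csys (fun x => - x) (fun x => - g x) (fun x => g x * x - f x) al be K ->
  (forall x y, al <= x <= be -> al <= y <= be ->
     `|x - y| <= K * `|f x - f y| /\ `|f x - f y| <= K * `|x - y|) ->
  (forall x, al <= x <= be -> `|g x| <= K) ->
  decr_null psi1 -> decr_null psi2 -> eta < 1 ->
  (forall q, (0 < q)%N -> q%:R `^ (- eta) <= Num.max (psi1 q) (psi2 q)) ->
  (forall e, 0 < e -> exists t1, forall T, \sum_(t1 <= t < T) 4 ^+ t *
     Num.max (psi1 (2 ^ t)%N) (psi2 (2 ^ t)%N) *
     h (Num.min (psi1 (2 ^ t)%N) (psi2 (2 ^ t)%N) / 2 ^+ t) <= e) ->
  hausdorff_measure dist2 h [set (x, f x) | x in [set x | al <= x <= be /\
    forall n, exists2 q, (n <= q)%N & approx1 psi1 th1 q x /\ approx1 psi2 th2 q (f x)]]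
  = 0%E.
Proof.
move=> sys fK gK P1 P2 eta1 maxeta conv; have [albe K1 _] := sys.
have [eta' eta'1 powle] := powR_max_half eta1.
have [C [tau [C0 /andP[tau0 _] HC]]] := sharp_count sys eta'1.
have Pmax := decr_null_max P1 P2; have Pmin := decr_null_min P1 P2.
have [p10 p1d _] := P1; have [p20 p2d _] := P2.
have K0 : 0 < 1 + K by lra.
pose nu t := Num.max (psi1 (2 ^ t)%N) (psi2 (2 ^ t)%N).
pose mu t := Num.min (psi1 (2 ^ t)%N) (psi2 (2 ^ t)%N).
have mu0 t : 0 < mu t by have [+ _ _] := Pmin; apply; rewrite expn_gt0.
have nu0 t : 0 < nu t by have [+ _ _] := Pmax; apply; rewrite expn_gt0.
have K20 : 0 < 2 / (1 + K) by rewrite divr_gt0.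
have [ta Hta] := dyadic_small Pmax K20.
pose tl (v : ivec) := trunc_log 2 `|v.1.1|%N.
pose near (v : ivec) x := [/\ (0 < v.1.1)%R, al <= x <= be,
  `|(`|v.1.1|%N)%:R * x - th1 - (v.1.2)%:~R| < psi1 `|v.1.1|%N &
  `|(`|v.1.1|%N)%:R * f x - th2 - (v.2)%:~R| < psi2 `|v.1.1|%N].
have nearq v x : near v x -> [/\ (`|v.1.1|%N)%:R = (v.1.1)%:~R :> R,
    (0 < `|v.1.1|)%N, (2 ^ tl v <= `|v.1.1|)%N & (`|v.1.1| < 2 ^ (tl v).+1)%N].
  move=> [v0 _ _ _]; have q0 : (0 < `|v.1.1|)%N by rewrite absz_gt0 gt_eqF.
  have := trunc_log_bounds (isT : (1 < 2)%N) q0; rewrite -/(tl v) => /andP[b1 b2].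
  split => //; by rewrite natr_absz ger0_norm// ltW.
pose C' := C * (1 + K) * ((be - al) + 1).
have C'0 : 0 < C' by rewrite /C' !mulr_gt0// addr_gt0// subr_gt0.
have cnt t (S : seq ivec) : (maxn ta 1 <= t)%N -> uniq S ->
    (forall v, v \in S -> tl v = t /\ exists x, near v x) ->
    (size S)%:R <= C' * (4 ^+ t * nu t).
  rewrite geq_max => /andP[tta t1] uS HS.
  have Q2 : 2 <= 2 ^+ t :> R by rewrite -{1}(expr1 2) ler_weXn2l// ler1n.
  have nu2 : nu t <= 2 / (1 + K) by exact: Hta.
  have nu1 : nu t <= 1.
    by apply: (le_trans nu2); rewrite ler_pdivrMr// mul1r; lra.
  have Q1 : 1 <= 2 ^+ t :> R by apply: le_trans Q2; rewrite ler1n.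
  have d1 : (2 ^+ t) `^ (- eta') <= (1 + K) * nu t.
    apply: (le_trans (powle _ Q1)); apply: (@le_trans _ _ (nu t)).
      have := maxeta (2 ^ t)%N; rewrite expn_gt0 natrX => /(_ isT) ; exact.
    by rewrite ler_peMl ?(ltW (nu0 t))//; lra.
  have d2 : (1 + K) * nu t <= 2 by rewrite mulrC -ler_pdivlMr.
  (* Up to sign, [X2] is the error of the second coordinate plus the slope times [X1], which
     explains the thickness (1 + K) nu. *)
  have := HC (2 ^+ t) ((1 + K) * nu t) al be th1 th2 S Q2 d1 d2 (lexx _) (ltW albe)
     (lexx _) uS.
  have hyp : forall v, v \in S -> `|(v.1.1)%:~R : R| <= 2 * 2 ^+ t /\
     exists x, [/\ al <= x <= be,
       `|X1 (fun x => - x) x (shiftv th1 th2 v)| <= Num.sqrt ((1 + K) * nu t * 2 ^+ t) &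
       `|X2 (fun x => - g x) (fun x => g x * x - f x) x (shiftv th1 th2 v)|
         <= (1 + K) * nu t].
    move=> v vS; have [tv [x nx]] := HS v vS.
    have [qE q0 qa qb] := nearq v x nx; have [v0 xab n1 n2] := nx.
    rewrite tv in qa qb.
    have pq : (0 < 2 ^ t <= `|v.1.1|)%N by rewrite expn_gt0 qa.
    have x1 : `|X1 (fun x => - x) x (shiftv th1 th2 v)| <= nu t.
      rewrite /X1 /shiftv /addv /rv /= addr0.
      have -> : (v.1.2)%:~R + th1 + - x * (v.1.1)%:~R =
        - ((`|v.1.1|%N)%:R * x - th1 - (v.1.2)%:~R) by rewrite qE; ring.
      rewrite normrN; apply: (le_trans (ltW n1)); apply: (le_trans (p1d _ _ pq)).
      by rewrite le_max lexx.
    have y1 : `|(`|v.1.1|%N)%:R * f x - th2 - (v.2)%:~R| <= nu t.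
      by apply: (le_trans (ltW n2)); apply: (le_trans (p2d _ _ pq)); rewrite le_max lexx orbT.
    split.
      rewrite -qE ger0_norm// -natrX -[2]/(2%:R) -natrM ler_nat -expnS; exact: ltnW.
    exists x; split => //.
      apply: (le_trans x1); rewrite -[leLHS]gtr0_norm// -sqrtr_sqr ler_wsqrtr//.
      rewrite expr2 (mulrC (1 + K)) -mulrA ler_pM2l//; apply: (le_trans nu1).
      apply: (le_trans Q1); rewrite ler_peMl ?exprn_ge0//; lra.
    have -> : X2 (fun x => - g x) (fun x => g x * x - f x) x (shiftv th1 th2 v) =
      - ((`|v.1.1|%N)%:R * f x - th2 - (v.2)%:~R) -
      g x * X1 (fun x => - x) x (shiftv th1 th2 v).
      by rewrite /X2 /X1 /shiftv /addv /rv /= qE; ring.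
    apply: (le_trans (ler_normB _ _)); rewrite normrN mulrDl mul1r.
    by apply: lerD => //; rewrite normrM; apply: ler_pM => //; exact: gK.
  move=> /(_ hyp) H; apply: (le_trans H).
  have -> : (2 ^+ t) ^+ 2 = 4 ^+ t :> R by rewrite -exprM mulnC exprM -natrX.
  have -> : C * ((1 + K) * nu t * 4 ^+ t) = C * (1 + K) * (4 ^+ t * nu t) by ring.
  rewrite /C' mulrAC ler_pM2r ?mulr_gt0 ?exprn_gt0// ler_pM2l ?mulr_gt0// lerD2l.
  rewrite -[leRHS](powRr0 (2 ^+ t)); apply: ler_powR => //.
  by rewrite oppr_le0 ltW.
(* The smaller function controls one coordinate up to the factor 2; K returns to x if that is the
   second coordinate, and 1 + K passes from x to the plane. *)
pose L := 2 * K * (1 + K).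
have L1 : 1 <= L by rewrite /L; nra.
have L0 : 0 < L by exact: lt_le_trans L1.
have dia v x y : near v x -> near v y ->
    dist2 (x, f x) (y, f y) <= L * (mu (tl v) / 2 ^+ tl v).
  move=> nx ny; have [qE q0 qa qb] := nearq v x nx.
  have [v0 xab n1 n2] := nx; have [_ yab m1 m2] := ny.
  set q := `|v.1.1|%N in qE q0 qa qb n1 n2 m1 m2.
  have pq : (0 < 2 ^ tl v <= q)%N by rewrite expn_gt0 qa.
  have qr : 0 < q%:R :> R by rewrite ltr0n.
  have Q0 : 0 < 2 ^+ tl v :> R by rewrite exprn_gt0.
  have Qq : 2 ^+ tl v <= q%:R :> R by rewrite -natrX ler_nat.
  have key (u w c1 c2 p psi : R) : `|q%:R * u - c1 - c2| < p -> `|q%:R * w - c1 - c2| < p ->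
      p <= psi -> `|u - w| <= 2 * psi / 2 ^+ tl v.
    move=> a1 a2 a3; rewrite ler_pdivlMr//.
    apply: (@le_trans _ _ (`|u - w| * q%:R)); first by rewrite ler_wpM2l.
    rewrite -{1}(gtr0_norm qr) -normrM.
    have -> : (u - w) * q%:R = (q%:R * u - c1 - c2) - (q%:R * w - c1 - c2) by ring.
    by apply: (le_trans (ler_normB _ _)); lra.
  have k1 := key x y _ _ _ _ n1 m1 (p1d _ _ pq).
  have k2 := key (f x) (f y) _ _ _ _ n2 m2 (p2d _ _ pq).
  have [f1 f2] := fK x y xab yab.
  have xy : `|x - y| <= 2 * K * (mu (tl v) / 2 ^+ tl v).
    rewrite /mu; have [le|le] := leP (psi1 (2 ^ tl v)%N) (psi2 (2 ^ tl v)%N).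
      apply: (le_trans k1); rewrite -mulrA -mulrA ler_pM2l// ler_peMl//.
      by rewrite divr_ge0 ?(ltW Q0)// ltW// p10// expn_gt0.
    apply: (le_trans f1); rewrite (mulrC 2) -mulrA ler_pM2l; last by lra.
    by rewrite [leRHS]mulrA.
  apply: (le_trans (dist2_le _ _)) => /=.
  have : `|x - y| + `|f x - f y| <= (1 + K) * `|x - y| by rewrite mulrDl mul1r lerD2l.
  move=> /le_trans; apply; rewrite /L (mulrC (2 * K)) -mulrA ler_pM2l//.
apply: (null_intro h_pos h_mono dist2_ge0 (T := ivec)) => e dl e0 dl0.
have [t1 Ht1] := conv (e / (C' * L)) (divr_gt0 e0 (mulr_gt0 C'0 L0)).
have [t3 Ht3] := dyadic_small Pmin (divr_gt0 dl0 L0).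
pose tm := maxn (maxn ta 1) (maxn t1 t3).
pose ok (v : ivec) := `[< exists x, near v x >] && (tm <= tl v)%N.
(* Triples of low level, or owning nothing, get radius 0 and drop out of the sum. *)
pose r (v : ivec) := if ok v then L * (mu (tl v) / 2 ^+ tl v) else 0.
exists (fun v => [set (x, f x) | x in [set x | near v x /\ (tm <= tl v)%N]]), r; split.
- move=> _ [x [xab Hx] <-]; have [q qn [[p a1] [p' a2]]] := Hx (2 ^ tm)%N.
  have q0 : (0 < q)%N by apply: leq_trans qn; rewrite expn_gt0.
  exists (Posz q, p, p') => //; exists x => //; split; first by split.
  by rewrite /tl /= trunc_log_max.
- move=> v; rewrite /r; case: ifP => [/andP[_ tv]|_]; last by rewrite lexx ltW.
  have Q1 : 1 <= 2 ^+ tl v :> R by rewrite exprn_ege1// ler1n.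
  have Q0 : 0 < 2 ^+ tl v :> R by rewrite exprn_gt0.
  rewrite mulr_ge0 ?(ltW L0) ?divr_ge0 ?(ltW Q0) ?(ltW (mu0 _))//=.
  rewrite mulrC -ler_pdivlMr// ler_pdivrMr//.
  have t3v : (t3 <= tl v)%N by apply: leq_trans tv; rewrite !leq_max leqnn !orbT.
  apply: (le_trans (Ht3 _ t3v)); rewrite ler_peMr// divr_ge0 ?ltW//.
- move=> v _ _ [x [nx tv] <-] [y [ny _] <-]; rewrite /r ifT; first exact: dia.
  by apply/andP; split => //; apply/asboolP; exists x.
move=> s us.
pose s' := [seq v <- s | ok v].
pose G t := L * h (mu t / 2 ^+ t).
have mQ0 t : 0 < mu t / 2 ^+ t by rewrite divr_gt0 ?exprn_gt0.
have -> : \sum_(v <- s) gauge h (r v) = \sum_(v <- s') gauge h (L * (mu (tl v) / 2 ^+ tl v)).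
  rewrite /s' big_filter [RHS]big_mkcond; apply: eq_bigr => v _; rewrite /r.
  by case: ifP => // _; rewrite /gauge ltxx.
apply: (@le_trans _ _ (\sum_(v <- s') G (tl v))).
  apply: ler_sum => v _; apply: (le_trans (gauge_scale h_dec L1 (ltW (mQ0 _)))).
  by rewrite /gauge mQ0.
pose n := (\max_(v <- s') tl v).+1.
rewrite (@sum_by_level R _ tl G s' tm n); last first.
  move=> v vs; rewrite ltnS (@leq_bigmax_seq _ s' predT tl v)// andbT.
  by move: vs; rewrite mem_filter => /andP[/andP[]].
apply: (@le_trans _ _ (\sum_(tm <= t < n) C' * L * (4 ^+ t * nu t * h (mu t / 2 ^+ t)))).
  rewrite big_nat [leRHS]big_nat; apply: ler_sum => t /andP[tt _].
  have -> : C' * L * (4 ^+ t * nu t * h (mu t / 2 ^+ t)) = C' * (4 ^+ t * nu t) * G t.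
    by rewrite /G; ring.
  rewrite ler_pM2r; last by rewrite /G mulr_gt0// h_pos.
  rewrite -size_filter; apply: cnt.
  - by apply: leq_trans tt; rewrite leq_maxl.
  - by rewrite !filter_uniq.
  - move=> v; rewrite !mem_filter => /andP[/eqP -> /andP[/andP[/asboolP ? _] _]].
    by split.
rewrite -mulr_sumr mulrC -ler_pdivlMr ?(mulr_gt0 C'0 L0)//.
apply: le_trans (Ht1 n).
have tm1 : (t1 <= tm)%N by rewrite !leq_max leqnn !orbT.
have pos t : 0 <= 4 ^+ t * nu t * h (mu t / 2 ^+ t).
  by rewrite !mulr_ge0 ?exprn_ge0 ?(ltW (nu0 t))// ltW// h_pos.
have [tn|nt] := leqP tm n; last first.
  by rewrite big_geq ?(ltnW nt)// sumr_ge0// => t _; exact: pos.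
rewrite [leRHS](@big_cat_nat _ _ _ tm)//= lerDr sumr_ge0// => t _; exact: pos.
Qed.

(** [F] is the coordinate with the smaller function at the levels in [Tt]. Ubiquity makes its form
    vanish exactly, leaving all of [psiF] for moving x, while the other coordinate starts with an
    error of at most half of [psiG]. *)
Lemma divergence_arc (F G g : R -> R) al be K psiF psiG thF thG (Tt : pred nat) (eta : R) :
  regular_function h ->
  csys (fun x => - F x) (fun x => - g x) (fun x => g x * F x - G x) al be K ->
  (forall x y, al <= x <= be -> al <= y <= be -> `|G x - G y| <= K * `|x - y|) ->
  (forall x r y, 0 < r -> al <= x - r -> x + r <= be -> K * `|y - F x| <= r ->
     exists2 xi, `|xi - x| <= r & F xi = y) ->
  decr_null psiF -> decr_null psiG -> eta < 1 ->
  (forall q, (0 < q)%N -> q%:R `^ (- eta) <= Num.max (psiF q) (psiG q)) ->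
  (forall t, Tt t -> psiF (2 ^ t.+1)%N <= psiG (2 ^ t.+1)%N) ->
  (forall M, exists n, M <= \sum_(0 <= t < n | Tt t) 4 ^+ t *
     Num.max (psiF (2 ^ t.+1)%N) (psiG (2 ^ t.+1)%N) * h (psiF (2 ^ t.+1)%N / 2 ^+ t)) ->
  forall Gam, 0 < Gam -> exists2 d0 : R, 0 < d0 &
  forall (V : nat -> R -> Prop) (dd a : nat -> R),
  (forall i, 0 <= dd i) ->
  (forall i x y, V i x -> V i y -> `|x - y| <= dd i) ->
  (forall i, dd i <= d0) ->
  (forall i, 0 < a i) -> (forall i, 0 < dd i -> h (dd i) <= a i) ->
  (forall x, al <= x <= be -> (forall n, exists2 q, (n <= q)%N &
     approx1 psiF thF q (F x) /\ approx1 psiG thG q (G x)) ->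
     exists i, V i x) ->
  (Gam%:E <= \sum_(0 <= i <oo) (a i)%:E)%E.
Proof.
move=> [r0 [l1 [l2 [/andP[r00 _] /andP[l10 _] l2b reg]]]] sys GK ivt PF PG eta1 maxeta TF div Gam Gam0.
have [albe K1 Hsys] := sys; have K0 : 0 < K by lra.
have [eta' /andP[eta'1 eta'2] powle] := powR_max_half eta1.
(* The room above [eta'] absorbs the passage from 2^(t+1), where the functions are evaluated, to
   2^t. *)
pose eta2 := (1 + eta') / 2.
have eta2b : 2^-1 <= eta2 < 1 by rewrite /eta2; apply/andP; split; lra.
have ivt' : forall x r y, 0 < r -> al <= x - r -> x + r <= be -> K * `|y - - F x| <= r ->
     exists2 xi, `|xi - x| <= r & - F xi = y.
  move=> x r y rp xr rx Ky; have [|xi xix Fxi] := ivt x r (- y) rp xr rx.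
    by rewrite (_ : - y - F x = - (y - - F x)) ?normrN//; ring.
  by exists xi => //; rewrite Fxi opprK.
have [kap kap0 Hub] := ubiquity sys eta2b ivt'.
have Pmax := decr_null_max PF PG.
have [pF0 pFd _] := PF; have [pG0 pGd _] := PG.
pose M t := Num.max (psiF (2 ^ t.+1)%N) (psiG (2 ^ t.+1)%N).
pose m t := psiF (2 ^ t.+1)%N.
have m0 t : 0 < m t by rewrite /m pF0// expn_gt0.
have M0 t : 0 < M t by rewrite lt_max m0.
have p2 t : 0 < 2 ^+ t :> R by rewrite exprn_gt0.
(* The inverse mesh of [ubiquity] for Q = 2^t and d = M t. The radius [rho] is such that q K rho <=
   m / 4 for every q up to 2^(t+1). *)
pose N t := M t * (2 ^+ t) ^+ 2 / kap.
pose rho t := m t / 2 ^+ t / (8 * K).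
have K8 : 0 < 8 * K by rewrite mulr_gt0.
have N0 t : 0 < N t by rewrite /N divr_gt0// mulr_gt0// exprn_gt0.
have rho0 t : 0 < rho t by rewrite /rho !divr_gt0.
have half t : rho t.+1 <= rho t / 2.
  have -> : rho t / 2 = m t / 2 ^+ t.+1 / (8 * K).
    by rewrite /rho exprS; field; rewrite !lt0r_neq0.
  rewrite /rho ler_pM2r ?invr_gt0// ler_pM2r ?invr_gt0//.
  by apply: pFd; rewrite expn_gt0 /= leq_exp2l.
have [Ct Ct0 HCt] := regular_tail h_pos h_mono l10 l2b reg rho0 half.
have [ta Hta] := dyadic_small PF r00.
have rhor t : (ta <= t)%N -> rho t < r0.
  move=> tt; apply: (@lt_le_trans _ _ (m t)); last by apply: Hta; exact: leqW.
  rewrite /rho ltr_pdivrMr// ltr_pdivrMr// -mulrA ltr_pMr//.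
  have e1 : 1 <= 2 ^+ t :> R by rewrite exprn_ege1// ler1n.
  have : 8 * K * 1 <= 8 * K * 2 ^+ t by rewrite ler_pM2l.
  by lra.
have e12 : 0 < eta2 - eta' by rewrite /eta2; lra.
have [Qa Qa2 HQa] := powR_large 2 e12.
have Meta t : Qa <= 2 ^+ t -> (2 ^+ t) `^ (- eta2) <= M t.
  move=> Qt; have e1 : 1 <= 2 ^+ t.+1 :> R by rewrite exprn_ege1// ler1n.
  apply: (@le_trans _ _ ((2 ^+ t.+1) `^ (- eta'))); last first.
    apply: (le_trans (powle _ e1)).
    by have := maxeta (2 ^ t.+1)%N; rewrite expn_gt0 natrX => /(_ isT).
  have pe : 0 < eta' by lra.
  rewrite !powRN lef_pV2 ?posrE ?powR_gt0// exprS powRM ?ler0n ?(ltW (p2 t))//.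
  have -> : eta2 = (eta2 - eta') + eta' by ring.
  rewrite powRDp// ler_pM2r ?powR_gt0//; apply: le_trans (HQa _ Qt).
  rewrite -[leRHS](powRr1 (ler0n _ 2)); apply: ler_powR; [by rewrite ler1n|exact: ltW].
have [tq Htq] := pow2_large Qa.
have [tM HtM] := dyadic_small Pmax (ltr01 : 0 < 1 :> R).
pose Tt' t := Tt t && (ta <= t)%N.
pose E t x := exists2 q, (2 ^ t <= q)%N &
  approx1 psiF thF q (F x) /\ approx1 psiG thG q (G x).
have N_inf M1 : exists t0, forall t, (t0 <= t)%N -> M1 <= N t.
  have [tb Htb] := pow2_large (`|M1| * kap).
  exists (maxn tq tb) => t; rewrite geq_max => /andP[tt1 tt2].
  have me := Meta t (Htq t tt1).
  rewrite /N ler_pdivlMr//; apply: (@le_trans _ _ (`|M1| * kap)).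
    by rewrite ler_pM2r// ler_norm.
  apply: (le_trans (Htb t tt2)).
  rewrite expr2 mulrA ler_peMl ?(ltW (p2 t))//.
  apply: (@le_trans _ _ ((2 ^+ t) `^ (- eta2) * 2 ^+ t)); last by rewrite ler_pM2r.
  rewrite -[X in _ * X](powRr1 (ltW (p2 t))) -powRDp// -[leLHS](powRr0 (2 ^+ t)).
  by apply: ler_powR; [rewrite exprn_ege1// ler1n|move: eta2b => /andP[]; lra].
have tail : exists2 C, 0 < C & forall t n, Tt' t ->
     \sum_(t <= j < n) h (rho j) <= C * h (rho t).
  by exists Ct => // t n /andP[_ tt]; apply: HCt; exact: rhor.
have div' M1 : exists n, M1 <= \sum_(0 <= t < n | Tt' t) N t * h (rho t).
  pose w t := 4 ^+ t * M t * h (m t / 2 ^+ t).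
  have w0 t : 0 <= w t.
    by rewrite /w !mulr_ge0 ?exprn_ge0 ?(ltW (M0 t))// ltW// h_pos// divr_gt0.
  have [n Hn] := unbounded_tail ta w0 div (M1 * (8 * K * kap)).
  exists n; rewrite -(ler_pM2r (mulr_gt0 K8 kap0)); apply: (le_trans Hn).
  rewrite mulr_suml; apply: ler_sum => t _.
  have s0 : 0 < m t / 2 ^+ t by rewrite divr_gt0.
  have rs : rho t <= m t / 2 ^+ t by rewrite /rho ler_pdivrMr// ler_peMr ?(ltW s0)//; lra.
  have := h_dec (rho0 t) rs; rewrite {1}/rho mulrA ler_pdivrMr// => H.
  have {}H : h (m t / 2 ^+ t) <= h (rho t) * (8 * K).
    rewrite -(ler_pM2r s0); apply: (le_trans H).
    by rewrite le_eqVlt; apply/orP; left; apply/eqP; ring.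
  have sq : (2 ^+ t) ^+ 2 = 4 ^+ t :> R by rewrite -exprM mulnC exprM -natrX.
  rewrite /w /N sq.
  have -> : M t * 4 ^+ t / kap * h (rho t) * (8 * K * kap) =
     4 ^+ t * M t * (h (rho t) * (8 * K)) by field; exact: lt0r_neq0.
  by rewrite ler_pM2l// mulr_gt0// exprn_gt0.
have UB : forall a b, al <= a -> a < b -> b <= be -> exists t0, forall t, (t0 <= t)%N ->
     Tt' t -> exists s : seq nat, [/\ uniq s,
       forall i, i \in s -> (i < Num.truncn ((b - a) / (N t)^-1))%N,
       (b - a) / (N t)^-1 / 2 <= (size s)%:R &
       forall i, i \in s -> exists2 xi, `|xi - mid a (N t)^-1 i| <= (N t)^-1 / 4 &
         forall x, `|x - xi| <= rho t -> al <= x <= be -> E t x].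
  move=> a b ala ab bbe; have [Q0 Q02 HQ0] := Hub a b ala ab bbe.
  have [tb Htb] := pow2_large Q0.
  exists (maxn tq (maxn tb tM)) => t; rewrite !geq_max => /and3P[tt1 tt2 tt3] /andP[Ttt _].
  have M1 : M t <= 1 by apply: HtM; exact: leqW.
  have := HQ0 (2 ^+ t) (M t) thF thG (Htb t tt2) (Meta t (Htq t tt1)) M1.
  have <- : (N t)^-1 = kap / (M t * (2 ^+ t) ^+ 2) by rewrite /N invf_div.
  move=> [s [us sN ss sx]]; exists s; split => // i is_.
  have [v [xi [xm /andP[vQ1 vQ2] x1 x2]]] := sx i is_; exists xi => // x xxi xab.
  have sg0 : 0 < (N t)^-1 by rewrite invr_gt0.
  have [mi1 mi2] := mid_in sg0 (ltW ab) (sN i is_).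
  have xiab : al <= xi <= be.
    have [xa xb] := near_mid sg0 xm mi1 mi2.
    by rewrite (le_trans ala xa) (le_trans xb bbe).
  have v0 : (0 < v.1.1)%R by rewrite -(ltr0z R); exact: lt_le_trans (p2 t) vQ1.
  have qE : (`|v.1.1|%N)%:R = (v.1.1)%:~R :> R by rewrite natr_absz ger0_norm// ltW.
  set q := `|v.1.1|%N in qE.
  have q1 : (2 ^ t <= q)%N by rewrite -(ler_nat R) natrX qE.
  have q2 : (q <= 2 ^ t.+1)%N by rewrite -(ler_nat R) natrX qE exprS.
  have q0 : (0 < q <= 2 ^ t.+1)%N by rewrite q2 andbT; apply: leq_trans q1; rewrite expn_gt0.
  have qr : 0 <= q%:R :> R by rewrite ler0n.
  have lip (H : R -> R) : `|H x - H xi| <= K * `|x - xi| -> `|q%:R * (H x - H xi)| <= m t / 4.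
    move=> HK; rewrite normrM ger0_norm//.
    apply: (@le_trans _ _ (2 ^+ t.+1 * (K * rho t))).
      apply: ler_pM => //; first by rewrite -natrX ler_nat.
      by apply: (le_trans HK); rewrite ler_pM2l.
    rewrite /rho exprS le_eqVlt; apply/orP; left; apply/eqP; field.
    by rewrite !lt0r_neq0.
  have lF : `|q%:R * (F x - F xi)| <= m t / 4.
    apply: lip; have [_ + _ _ _] := Hsys x xi xab xiab.
    by rewrite -opprD normrN.
  have lG : `|q%:R * (G x - G xi)| <= m t / 4 by apply: lip; exact: GK.
  have mt := m0 t; have Mt := M0 t.
  have mM : m t <= M t by rewrite le_max lexx.
  have eqx1 : (v.1.2)%:~R + thF = q%:R * F xi.
    move: x1; rewrite /X1 /shiftv /addv /rv /= addr0 -qE => /eqP.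
    by rewrite mulNr subr_eq0 mulrC => /eqP.
  exists q => //; split.
    exists v.1.2.
    have -> : q%:R * F x - thF - (v.1.2)%:~R = q%:R * (F x - F xi).
      by rewrite mulrBr -eqx1; ring.
    have [lt _] := approx_arith mt mM lF x2.
    by apply: (lt_le_trans lt); exact: pFd.
  exists v.2.
  have -> : q%:R * G x - thG - (v.2)%:~R = q%:R * (G x - G xi) -
     X2 (fun x => - g x) (fun x => g x * F x - G x) xi (shiftv thF thG v).
    rewrite /X2 /shiftv /addv /rv /= eqx1 -qE; ring.
  apply: (le_lt_trans (ler_normB _ _)).
  have [_ lt] := approx_arith mt mM lG x2.
  apply: (lt_le_trans lt).
  by apply: le_trans (pGd _ _ q0); rewrite /M (max_idPr (TF t Ttt)).
have [d0 d00 Hd0] := limsup_content h_pos h_mono h_dec h_inf h_zero N0 rho0 N_inf tail div'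
   UB albe Gam0.
exists d0 => // V dd a dd0 Vd ddd a0 ah cov; apply: (Hd0 V dd a) => // x xab HE.
apply: cov => // n; have [t nt [q tq' Hq]] := HE n; exists q => //.
by apply: (leq_trans nt); apply: leq_trans tq'; rewrite ltnW// ltn_expl.
Qed.

End ArcMeasure.

(** * Curved arcs *)

Section Arcs.
Context {R : realType}.

(** At an interior point the limit relative to [I] is the ordinary one. Caratheodory's slope
    function is the difference quotient completed by its limit. *)
Lemma derive_in_is_derive (I : set R) (f : R -> R) x : nbhs x I ->
  derivable_in I f x -> is_derive x 1 f (derive_in I f x).
Proof.
move=> nI df; set l := derive_in I f x.
have cv : diff_quotient f x y @[y --> within I x^'] --> l by exact: df.
apply/is_derive1_caratheodory.
exists (fun z => if z == x then l else diff_quotient f x z); split.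
- move=> z; have [->|zx] := eqVneq z x; first by rewrite !subrr mulr0.
  by rewrite /diff_quotient divfK// subr_eq0.
- apply/cvgrPdist_lt => e e0; rewrite eqxx.
  move/cvgrPdist_lt : cv => /(_ e e0); rewrite near_withinE near_withinE => H.
  near=> z; case: ifPn => [_|zx]; first by rewrite subrr normr0.
  have Iz : I z by near: z.
  by have := near H z; apply.
- by rewrite eqxx.
Unshelve. all: by end_near.
Qed.

Lemma mvt_in (I : set R) (f : R -> R) a b :
  (forall x, a <= x <= b -> nbhs x I) -> (forall x, I x -> derivable_in I f x) ->
  forall x y, a <= x <= b -> a <= y <= b -> exists c,
    [/\ a <= c <= b, `|c - y| <= `|x - y| & f x - f y = derive_in I f c * (x - y)].
Proof.
move=> nI df x y /andP[ax xb] /andP[ay yb].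
have der c : a <= c <= b -> is_derive c 1 f (derive_in I f c).
  by move=> /nI nc; apply: derive_in_is_derive => //; apply: df; exact: nbhs_singleton.
have mvt u v : u <= v -> a <= u -> v <= b -> exists2 c, u <= c <= v &
    f v - f u = derive_in I f c * (v - u).
  move=> uv au vb.
  have sub c : c \in `[u, v] -> a <= c <= b.
    by rewrite in_itv /= => /andP[uc cv]; rewrite (le_trans au uc) (le_trans cv vb).
  have [c|c cuv E] := @MVT_segment R f (derive_in I f) u v uv _
     (derivable_within_continuous (fun c cuv => @ex_derive _ _ _ _ _ _ _ (der c (sub c cuv)))).
    by move=> cuv; apply: der; apply: sub; exact: subset_itv_oo_cc cuv.
  by exists c => //; move: cuv; rewrite in_itv.
have [xy|yx] := leP x y.
  have [c /andP[xc cy] E] := mvt x y xy ax yb; exists c; split.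
  - by rewrite (le_trans ax xc) (le_trans cy yb).
  - by rewrite !ler0_norm ?subr_le0// lerN2 lerD2r.
  - by apply: (can_inj opprK); rewrite opprB E -mulrN opprB.
have [c /andP[yc cx] E] := mvt y x (ltW yx) ay xb; exists c; split => //.
- by rewrite (le_trans ay yc) (le_trans cx xb).
- by rewrite !ger0_norm ?subr_ge0// ?(ltW yx)// lerD2r.
Qed.

(** Rational end points make the family of boxes countable, so that null sets can be collected over
    it. *)
Lemma rational_interval (x : R) (P : set R) : nbhs x P -> exists p : rat * rat,
  ratr p.1 < x < ratr p.2 /\ forall y, ratr p.1 <= y <= ratr p.2 -> P y.
Proof.
move=> /nbhs_ballP[e /= e0 He].
have x1 : x - e < x by rewrite ltrBlDr ltrDl.
have x2 : x < x + e by rewrite ltrDl.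
have [p] := rat_in_itvoo x1; rewrite in_itv /= => /andP[p1 p2].
have [q] := rat_in_itvoo x2; rewrite in_itv /= => /andP[q1 q2].
exists (p, q); split; first by rewrite p2.
move=> y /= /andP[py yq]; apply: He; rewrite /ball /= ltr_norml.
by apply/andP; split; lra.
Qed.

(** With g = f', [X1] is the error of the first coordinate and [X2] the second error corrected by
    the slope, that is q times the vertical distance to the tangent. The quadratic condition becomes
    Taylor's formula at [y]. *)
Lemma csys_primal (f g : R -> R) al be K : al < be -> 1 <= K ->
  (forall x y, al <= x <= be -> al <= y <= be ->
    [/\ `|x - y| <= K * `|g x - g y|, `|g x - g y| <= K * `|x - y| &
        `|f y - f x - g y * (y - x)| <= K * (x - y) ^+ 2]) ->
  csys (fun x => - x) (fun x => - g x) (fun x => g x * x - f x) al be K.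
Proof.
move=> albe K1 H; split => // x y xab yab; have [h1 h2 h3] := H x y xab yab.
rewrite -!opprD !normrN; split => //.
- by rewrite ler_peMl.
- by rewrite ler_peMl.
- apply: le_trans h3; rewrite -normrN le_eqVlt; apply/orP; left; apply/eqP.
  by congr (`|_|); ring.
Qed.

(** The system of the inverse function, of slope 1 / g, still written in the parameter x. It serves
    the levels at which the second coordinate has the smaller function. *)
Lemma csys_swapped (f g : R -> R) al be K : al < be -> 1 <= K ->
  (forall x y, al <= x <= be -> al <= y <= be ->
    [/\ `|x - y| <= K * `|g x - g y|, `|g x - g y| <= K * `|x - y| &
        `|f y - f x - g y * (y - x)| <= K * (x - y) ^+ 2]) ->
  (forall x y, al <= x <= be -> al <= y <= be ->
    `|x - y| <= K * `|f x - f y| /\ `|f x - f y| <= K * `|x - y|) ->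
  (forall x, al <= x <= be -> K^-1 <= `|g x| /\ `|g x| <= K) ->
  csys (fun x => - f x) (fun x => - (g x)^-1) (fun x => (g x)^-1 * f x - x) al be (K ^+ 3).
Proof.
move=> albe K1 H fK gK; have K0 : 0 < K by lra.
have K3 : K <= K ^+ 3 by rewrite -{1}(expr1 K) ler_weXn2l.
split => //; first exact: le_trans K1 K3.
move=> x y xab yab; have [h1 h2 h3] := H x y xab yab.
have [f1 f2] := fK x y xab yab.
have [gx1 gx2] := gK x xab; have [gy1 gy2] := gK y yab.
have Ki : 0 < K^-1 by rewrite invr_gt0.
have gx0 : 0 < `|g x| by lra.
have gy0 : 0 < `|g y| by lra.
have gxn : g x != 0 by rewrite -normr_gt0.
have gyn : g y != 0 by rewrite -normr_gt0.
rewrite -!opprD !normrN.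
have up (u v : R) : 0 <= v -> u <= K * v -> u <= K ^+ 3 * v.
  by move=> v0 /le_trans; apply; rewrite ler_wpM2r.
have gE : `|(g x)^-1 - (g y)^-1| * (`|g x| * `|g y|) = `|g x - g y|.
  rewrite -!normrM -normrN; congr (`|_|); field; exact/andP.
have gg1 : `|g x| * `|g y| <= K ^+ 2 by rewrite expr2 ler_pM.
have gg2 : 1 <= K ^+ 2 * (`|g x| * `|g y|).
  have -> : 1 = (K * K^-1) * (K * K^-1) by rewrite mulfV ?mul1r// gt_eqF.
  rewrite expr2 [leRHS](_ : _ = (K * `|g x|) * (K * `|g y|)); last by ring.
  by apply: ler_pM; rewrite ?mulr_ge0 ?(ltW K0) ?(ltW Ki)// ler_pM2l.
split.
- exact: up.
- exact: up.
- apply: (le_trans h1); rewrite exprS -mulrA ler_pM2l// -gE mulrC ler_wpM2r//.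
- rewrite -(ler_pM2r (mulr_gt0 gx0 gy0)) gE; apply: (le_trans h2).
  have -> : K ^+ 3 * `|x - y| * (`|g x| * `|g y|) =
    K * `|x - y| * (K ^+ 2 * (`|g x| * `|g y|)) by ring.
  by rewrite ler_peMr ?mulr_ge0 ?(ltW K0).
- have -> : (g y)^-1 * f y - y - ((g x)^-1 * f x - x) -
       - f x * - ((g y)^-1 - (g x)^-1) = (f y - f x - g y * (y - x)) / g y.
    by field; exact/andP.
  rewrite normrM normfV ler_pdivrMr//; apply: (le_trans h3).
  have -> : K ^+ 3 * (x - y) ^+ 2 * `|g y| = K * (x - y) ^+ 2 * (K * (K * `|g y|)) by ring.
  have sq0 : 0 <= K * (x - y) ^+ 2 by apply: mulr_ge0; [exact: ltW|exact: sqr_ge0].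
  apply: (ler_peMr sq0).
  have : 1 <= K * `|g y| by rewrite mulrC -ler_pdivrMr// div1r.
  by nra.
Qed.

Lemma bracket_ivt (f : R -> R) x r y : 0 <= r ->
  {within `[x - r, x + r], continuous f} ->
  (f (x - r) <= y <= f (x + r)) \/ (f (x + r) <= y <= f (x - r)) ->
  exists2 xi, `|xi - x| <= r & f xi = y.
Proof.
move=> r0 cf Hy.
have le : x - r <= x + r by lra.
have mm : Num.min (f (x - r)) (f (x + r)) <= y <= Num.max (f (x - r)) (f (x + r)).
  by case: Hy => /andP[h1 h2]; rewrite ge_min le_max h1 h2 ?orbT.
have [c] := IVT le cf mm; rewrite in_itv /= => /andP[c1 c2] fc; exists c => //.
by rewrite ler_norml; apply/andP; split; lra.
Qed.

End Arcs.

(** * Local structure of the curve away from zeros of the first two derivatives *)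

Section SmoothCurve.
Context {R : realType} (I : set R) (f : R -> R).
Context (I_itv : is_interval I) (f_C3 : class_C 3 I f).

Let f1 := derive_in_n I 1 f.
Let f2 := derive_in_n I 2 f.

Lemma derivable_f x : I x -> derivable_in I f x.
Proof. by move=> Ix; have [+ _] := f_C3; move=> /(_ 0%N isT x Ix). Qed.

Lemma derivable_f1 x : I x -> derivable_in I f1 x.
Proof. by move=> Ix; have [+ _] := f_C3; move=> /(_ 1%N isT x Ix). Qed.

Lemma derivable_f2 x : I x -> derivable_in I f2 x.
Proof. by move=> Ix; have [+ _] := f_C3; move=> /(_ 2%N isT x Ix). Qed.

Lemma derivable_in_near (g : R -> R) x e : nbhs x I -> derivable_in I g x -> 0 < e ->
  \forall y \near x, `|g y - g x| < e.
Proof.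
move=> nI dg e0; have [dgx _] := derive_in_is_derive nI dg.
have /differentiable_continuous cg : differentiable g x by apply/derivable1_diffP.
move/cvgrPdist_lt : cg => /(_ e e0); apply: filterS => y /=.
by rewrite distrC.
Qed.

Lemma interior_point x y z : I y -> I z -> y < x < z -> nbhs x I.
Proof.
move=> Iy Iz /andP[yx xz]; apply/nbhs_ballP.
exists (Num.min (x - y) (z - x)); first by rewrite /= lt_min !subr_gt0 yx.
move=> u; rewrite /ball /= lt_min !ltr_norml => /andP[/andP[a1 a2] /andP[b1 b2]].
by apply: (I_itv Iy Iz); apply/andP; split; lra.
Qed.

Lemma lipschitz_near (x : R) : nbhs x I -> exists p : rat * rat,
  ratr p.1 < x < ratr p.2 /\ exists2 K, 0 <= K & forall u v,
    ratr p.1 <= u <= ratr p.2 -> ratr p.1 <= v <= ratr p.2 -> `|f u - f v| <= K * `|u - v|.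
Proof.
move=> nI; have Ix := nbhs_singleton nI.
have nb : nbhs x [set y | nbhs y I /\ `|f1 y - f1 x| < 1].
  apply: filterI; first exact: nbhs_interior.
  exact: derivable_in_near (derivable_f1 Ix) ltr01.
have [p [px Hp]] := rational_interval nb; exists p; split => //.
exists (`|f1 x| + 1); first by rewrite addr_ge0.
move=> u v uab vab.
have [c [cab _ ->]] := mvt_in (fun y yab => (Hp y yab).1) derivable_f uab vab.
rewrite normrM ler_wpM2r//; have [_ c1] := Hp c cab.
rewrite -[derive_in I f c]/(f1 c) -{1}(subrK (f1 x) (f1 c)) addrC.
by apply: (le_trans (ler_normD _ _)); rewrite lerD2l ltW.
Qed.

Definition curved_arc al be K : Prop :=
  [/\ al < be, 1 <= K, forall x, al <= x <= be -> nbhs x I,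
    forall x y, al <= x <= be -> al <= y <= be ->
    [/\ `|x - y| <= K * `|f1 x - f1 y|, `|f1 x - f1 y| <= K * `|x - y| &
        `|f y - f x - f1 y * (y - x)| <= K * (x - y) ^+ 2] &
    forall x, al <= x <= be -> K^-1 <= `|f2 x|].

Lemma curved_arc_near (x : R) : nbhs x I -> f2 x != 0 -> exists p : rat * rat,
  ratr p.1 < x < ratr p.2 /\ exists K, curved_arc (ratr p.1) (ratr p.2) K.
Proof.
move=> nI f2x; have Ix := nbhs_singleton nI.
have f20 : 0 < `|f2 x| / 2 by rewrite divr_gt0// normr_gt0.
have nb : nbhs x [set y | nbhs y I /\ `|f2 y - f2 x| < `|f2 x| / 2].
  apply: filterI; first exact: nbhs_interior.
  exact: derivable_in_near (derivable_f2 Ix) f20.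
have [p [px Hp]] := rational_interval nb; exists p; split => //.
have [u uE] : exists u : R, u = `|f2 x| by eexists.
have u0 : 0 < u by rewrite uE normr_gt0.
have ui : 0 < u^-1 by rewrite invr_gt0.
(* On the box |f''| lies between u / 2 and 3 u / 2, and K exceeds 3 u / 2 as well as 2 / u. *)
pose K := 1 + 2 * u + 2 / u.
have K0 : 0 < K by rewrite /K; lra.
have nIp (y : R) : ratr p.1 <= y <= ratr p.2 -> nbhs y I by move=> yab; have [] := Hp y yab.
have lo (y : R) : ratr p.1 <= y <= ratr p.2 -> K^-1 <= `|f2 y| /\ `|f2 y| <= K.
  move=> yab; have [_] := Hp y yab; rewrite -uE => y1.
  have t1 : `|f2 y| <= u + u / 2.
    rewrite -{1}(subrK (f2 x) (f2 y)) addrC; apply: (le_trans (ler_normD _ _)).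
    by rewrite -uE lerD2l ltW.
  have t2 : u / 2 <= `|f2 y|.
    have : u <= `|f2 y| + `|f2 y - f2 x|.
      by rewrite uE -{1}(subKr (f2 y) (f2 x)) ler_normB.
    by lra.
  split; last by rewrite /K; lra.
  apply: le_trans t2; rewrite -[leRHS]invrK lef_pV2 ?posrE ?invr_gt0 ?divr_gt0//.
  by rewrite invf_div /K; lra.
have lip (a b : R) : ratr p.1 <= a <= ratr p.2 -> ratr p.1 <= b <= ratr p.2 ->
    `|a - b| <= K * `|f1 a - f1 b| /\ `|f1 a - f1 b| <= K * `|a - b|.
  move=> aab bab.
  have [c [cab _ E]] := mvt_in nIp derivable_f1 aab bab.
  rewrite E normrM; have [c1 c2] := lo c cab.
  split; last by rewrite ler_wpM2r.
  by rewrite mulrA ler_peMl// -ler_pdivrMl// mulr1.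
exists K; split => //.
- by case/andP: px => p1 p2; exact: lt_trans p1 p2.
- by rewrite /K; lra.
- move=> a b aab bab; have [l1 l2] := lip a b aab bab; split => //.
  have [c [cab cb E]] := mvt_in nIp derivable_f aab bab.
  have -> : f b - f a - f1 b * (b - a) = - ((f1 c - f1 b) * (a - b)).
    by rewrite -[f b - f a]opprB E -[derive_in I f c]/(f1 c); ring.
  rewrite normrN normrM -real_normK ?num_real// expr2 mulrA ler_wpM2r//.
  have [_ l3] := lip c b cab bab; apply: (le_trans l3); rewrite ler_pM2l//.
- by move=> y yab; have [] := lo y yab.
Qed.

(** The sign of the slope is recorded with its size, because it decides in which order the values at
    the two ends bracket a given value. *)
Definition sloped_arc al be K : Prop := curved_arc al be K /\
  ((forall x, al <= x <= be -> K^-1 <= f1 x <= K) \/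
   (forall x, al <= x <= be -> K^-1 <= - f1 x <= K)).

Lemma sloped_arc_near (x : R) : nbhs x I -> f1 x != 0 -> f2 x != 0 -> exists p : rat * rat,
  ratr p.1 < x < ratr p.2 /\ exists K, sloped_arc (ratr p.1) (ratr p.2) K.
Proof.
move=> nI f1x f2x; have Ix := nbhs_singleton nI.
have [p [px [K [albe K1 nIp H1 H2]]]] := curved_arc_near nI f2x.
have f10 : 0 < `|f1 x| / 2 by rewrite divr_gt0// normr_gt0.
have nb : nbhs x [set y | ratr p.1 < y < ratr p.2 /\ `|f1 y - f1 x| < `|f1 x| / 2].
  apply: filterI; last exact: derivable_in_near (derivable_f1 Ix) f10.
  have /andP[px1 px2] := px.
  apply/nbhs_ballP; exists (Num.min (x - ratr p.1) (ratr p.2 - x)).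
    by rewrite /= lt_min !subr_gt0 px1.
  move=> u; rewrite /ball /= lt_min !ltr_norml => /andP[/andP[a1 a2] /andP[b1 b2]].
  by apply/andP; split; lra.
have [s [sx Hs]] := rational_interval nb; exists s; split => //.
have [u uE] : exists u : R, u = `|f1 x| by eexists.
have u0 : 0 < u by rewrite uE normr_gt0.
have ui : 0 < u^-1 by rewrite invr_gt0.
pose L := K + 2 * u + 2 / u.
have KL : K <= L by rewrite /L; lra.
have L0 : 0 < L by lra.
have sub (y : R) : ratr s.1 <= y <= ratr s.2 -> ratr p.1 <= y <= ratr p.2.
  by move=> /Hs[/andP[y1 y2] _]; rewrite !ltW.
have Li : L^-1 <= u / 2.
  rewrite -[leRHS]invrK lef_pV2 ?posrE ?invr_gt0 ?divr_gt0//.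
  by rewrite invf_div /L; lra.
exists L; split.
  split.
  - by case/andP: sx => s1 s2; exact: lt_trans s1 s2.
  - exact: le_trans K1 KL.
  - by move=> y /sub /nIp.
  - move=> a b /sub aab /sub bab; have [h1 h2 h3] := H1 a b aab bab; split.
    + by apply: (le_trans h1); rewrite ler_wpM2r.
    + by apply: (le_trans h2); rewrite ler_wpM2r.
    + by apply: (le_trans h3); rewrite ler_wpM2r// sqr_ge0.
  - move=> y /sub /H2; apply: le_trans.
    by rewrite lef_pV2 ?posrE//; lra.
have [pos|neg] := ltP 0 (f1 x); [left|right] => y yab; have [_] := Hs y yab;
  rewrite -uE ltr_norml => /andP[y1 y2]; apply/andP; split;
  move: uE; rewrite ?(gtr0_norm pos) ?(ler0_norm neg) => uE; rewrite /L; lra.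
Qed.

Lemma curved_arc_injective al be K x y : curved_arc al be K ->
  al <= x <= be -> al <= y <= be -> f1 x = f1 y -> x = y.
Proof.
move=> [_ _ _ H _] xab yab fxy; have [+ _ _] := H x y xab yab.
rewrite fxy subrr normr0 mulr0 => h; apply/eqP; rewrite -subr_eq0 -normr_eq0.
by rewrite eq_le h normr_ge0.
Qed.

Lemma sloped_arc_bilipschitz al be K : sloped_arc al be K ->
  (forall x y, al <= x <= be -> al <= y <= be ->
    `|x - y| <= K * `|f x - f y| /\ `|f x - f y| <= K * `|x - y|) /\
  (forall x, al <= x <= be -> K^-1 <= `|f1 x| /\ `|f1 x| <= K).
Proof.
move=> [[albe K1 nIp _ _] sgn]; have K0 : 0 < K by lra.
have b x : al <= x <= be -> K^-1 <= `|f1 x| /\ `|f1 x| <= K.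
  move=> xab; have Ki : 0 < K^-1 by rewrite invr_gt0.
  case: sgn => /(_ x xab) /andP[s1 s2].
    by rewrite ger0_norm//; apply: le_trans s1; exact: ltW.
  by rewrite -normrN ger0_norm//; apply: le_trans s1; exact: ltW.
split => // x y xab yab.
have [c [cab _ E]] := mvt_in nIp derivable_f xab yab.
rewrite E normrM -[derive_in I f c]/(f1 c); have [c1 c2] := b c cab.
split; last by rewrite ler_wpM2r.
by rewrite mulrA ler_peMl// -ler_pdivrMl// mulr1.
Qed.

Lemma sloped_arc_ivt al be K : sloped_arc al be K ->
  forall x r y, 0 < r -> al <= x - r -> x + r <= be -> K * `|y - f x| <= r ->
     exists2 xi, `|xi - x| <= r & f xi = y.
Proof.
move=> [[albe K1 nIp _ _] sgn] x r y r0 xr rx; have K0 : 0 < K by lra.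
rewrite mulrC -ler_pdivlMr// ler_norml => /andP[y1 y2].
have m1 : al <= x - r <= be by apply/andP; split; lra.
have m2 : al <= x + r <= be by apply/andP; split; lra.
have m3 : al <= x <= be by apply/andP; split; lra.
have cont : {within `[x - r, x + r], continuous f}.
  apply: derivable_within_continuous => z; rewrite in_itv /= => /andP[z1 z2].
  have zab : al <= z <= be by apply/andP; split; lra.
  by have [] := derive_in_is_derive (nIp z zab) (derivable_f (nbhs_singleton (nIp z zab))).
apply: bracket_ivt (ltW r0) cont _.
have [c [cab _ E]] := mvt_in nIp derivable_f m2 m3.
have [c' [cab' _ E']] := mvt_in nIp derivable_f m3 m1.
rewrite -[derive_in I f c]/(f1 c) addrAC subrr add0r in E.
rewrite -[derive_in I f c']/(f1 c') subKr in E'.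
have mul z : K^-1 <= z -> r / K <= z * r by move=> zK; rewrite mulrC ler_pM2r.
case: sgn => sgn; [left|right].
  have /andP[s1 _] := sgn c cab; have /andP[s2 _] := sgn c' cab'.
  by have := mul _ s1; have := mul _ s2; move=> ? ?; apply/andP; split; lra.
have /andP[s1 _] := sgn c cab; have /andP[s2 _] := sgn c' cab'.
by have := mul _ s1; have := mul _ s2; rewrite !mulNr => ? ?; apply/andP; split; lra.
Qed.

End SmoothCurve.

(** * The theorem *)

Section Transfer.
Context {R : realType}.

(** A positive function with limit 0 cannot be nondecreasing, so monotonicity means decrease. *)
Lemma approximating_decr_null (psi : nat -> R) :
  approximating_function psi -> decr_null psi.
Proof.
move=> [p0 mono lim].
have small e : 0 < e -> exists n, forall q, (n <= q)%N -> psi q <= e.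
  move=> e0; move/cvgr0Pnorm_lt : lim => /(_ e e0)[n _ Hn]; exists n => q nq.
  by apply: (le_trans (ler_norm _)); apply: ltW; exact: Hn.
split => //; case: mono => // inc.
have [n Hn] := small (psi 1%N / 2) (divr_gt0 (p0 1%N isT) (ltr0Sn _ 1)).
have := Hn n.+1 (leqnSn n); have := inc 1%N n.+1 isT; have := p0 1%N isT; lra.
Qed.

Lemma dist_int_ltP (z e : R) :
  dist_int z < e <-> exists p : int, `|z - p%:~R| < e.
Proof.
split=> [lt|[p lt]].
- have ne : range (fun n : int => `|z - n%:~R|) !=set0 by exists `|z - 0%:~R|, 0.
  by have [_ [p _ <-] pe] := inf_lt ne lt; exists p.
- apply: le_lt_trans lt; apply: ge_inf; last by exists p.
  by exists 0 => _ [n _ <-].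
Qed.

Lemma infinite_natP (S : set nat) :
  infinite_set S <-> forall n, exists2 q, (n <= q)%N & S q.
Proof.
split=> [inf n|H /finite_seqP[s Es]].
  apply: contrapT => H; apply: inf; apply: (@sub_finite_set _ _ `I_n).
    by move=> q Sq /=; rewrite ltnNge; apply/negP => nq; apply: H; exists q.
  exact: finite_II.
have [q nq] := H (\max_(q <- s) q).+1; rewrite Es /= => qs.
by move: nq; rewrite ltnNge leq_bigmax_seq.
Qed.

Lemma simul_approxP (psi1 psi2 : nat -> R) th x y :
  simul_approx psi1 psi2 th (x, y) <-> forall n, exists2 q, (n <= q)%N &
    approx1 psi1 th.1 q x /\ approx1 psi2 th.2 q y.
Proof.
rewrite /simul_approx /=; split => [/infinite_natP H n|H].
  have [q nq [q0 /dist_int_ltP a1 /dist_int_ltP a2]] := H n.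
  by exists q.
apply/infinite_natP => n; have [q nq [a1 a2]] := H n.+1.
exists q; first exact: ltnW.
by split; [exact: leq_trans nq|exact/dist_int_ltP|exact/dist_int_ltP].
Qed.

Lemma unbounded_split (w : nat -> R) (T : pred nat) :
  (forall M, exists n, M <= \sum_(0 <= t < n) w t) ->
  (forall M, exists n, M <= \sum_(0 <= t < n | T t) w t) \/
  (forall M, exists n, M <= \sum_(0 <= t < n | ~~ T t) w t).
Proof.
move=> div; apply: contrapT => H.
have [H1 H2] : ~ (forall M, exists n, M <= \sum_(0 <= t < n | T t) w t) /\
  ~ (forall M, exists n, M <= \sum_(0 <= t < n | ~~ T t) w t).
  by split => h; apply: H; [left|right].
have bnd (P : pred nat) : ~ (forall M, exists n, M <= \sum_(0 <= t < n | P t) w t) ->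
    exists M, forall n, \sum_(0 <= t < n | P t) w t < M.
  move=> h; apply: contrapT => h'; apply: h => M; apply: contrapT => h2; apply: h'.
  by exists M => n; rewrite ltNge; apply/negP => h3; apply: h2; exists n.
have [M1 b1] := bnd _ H1; have [M2 b2] := bnd _ H2.
have [n] := div (M1 + M2); rewrite (bigID T) /=.
by have := b1 n; have := b2 n; lra.
Qed.

Lemma volume_sum_unbounded (a : nat -> R) : (forall q, (0 < q)%N -> 0 <= a q) ->
  (\sum_(1 <= q <oo) (a q)%:E)%E = +oo%E ->
  forall M, exists n, M <= \sum_(1 <= q < n) a q.
Proof.
move=> a0 aoo M; apply: contrapT => H.
have : (\sum_(1 <= q <oo) (a q)%:E <= M%:E)%E.
  apply: lime_le.
    by apply: is_cvg_nneseries => q q1 _; rewrite lee_fin a0.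
  apply: nearW => n; rewrite sumEFin lee_fin leNgt; apply/negP => lt.
  by apply: H; exists n; exact: ltW.
by rewrite aoo leye_eq.
Qed.

Lemma volume_sum_bounded (a : nat -> R) : (forall q, (0 < q)%N -> 0 <= a q) ->
  (\sum_(1 <= q <oo) (a q)%:E < +oo)%E ->
  exists B, forall n, \sum_(1 <= q < n) a q <= B.
Proof.
move=> a0 aoo; set S := (\sum_(1 <= q <oo) _)%E in aoo.
have S0 : (0 <= S)%E by apply: nneseries_ge0 => q q1 _; rewrite lee_fin a0.
exists (fine S) => n; rewrite -lee_fin fineK ?ge0_fin_numE// -sumEFin.
by apply: nneseries_lim_ge => q q1 _; rewrite lee_fin a0.
Qed.

Section Gauge.
Context (h : R -> R) (h_dim : dimension_function h).

Lemma dim_pos r : 0 < r -> 0 < h r.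
Proof. by have [+ _ _ _] := h_dim; apply. Qed.

Lemma dim_mono r s : 0 < r -> r <= s -> h r <= h s.
Proof. by have [_ + _ _] := h_dim; apply. Qed.

Lemma near_right0 (P : R -> Prop) : (\forall r \near 0^'+, P r) ->
  exists2 e, 0 < e & forall r, 0 < r -> r <= e -> P r.
Proof.
move=> [e /= e0 He]; exists (e / 2); first by rewrite divr_gt0.
move=> r r0 re; apply: He => //=; rewrite sub0r normrN gtr0_norm//; lra.
Qed.

Lemma dim_zero e : 0 < e -> exists2 r, 0 < r & h r < e.
Proof.
move=> e0; have [_ _ _ /cvgr0Pnorm_lt /(_ e e0) /near_right0[r r0 Hr]] := h_dim.
exists r => //; exact: le_lt_trans (ler_norm _) (Hr r r0 (lexx _)).
Qed.

Lemma dim_inf : r^-1 * h r @[r --> 0^'+] --> +oo ->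
  forall M, exists2 r0, 0 < r0 & forall r, 0 < r -> r <= r0 -> M * r <= h r.
Proof.
move=> /cvgryPge H M; have [e e0 He] := near_right0 (H M); exists e => // r r0 re.
by rewrite mulrC -ler_pdivlMl//; exact: He.
Qed.

Lemma dim_dec : (forall r s, 0 < r -> r <= s -> s^-1 * h s <= r^-1 * h r) ->
  forall r s, 0 < r -> r <= s -> h s * r <= h r * s.
Proof.
move=> H r s r0 rs; have s0 : 0 < s by exact: lt_le_trans rs.
have := H r s r0 rs; rewrite ler_pdivrMl// mulrA mulrAC ler_pdivlMr//.
by rewrite (mulrC s).
Qed.

(** A planar cover is pulled back to the parameter without increasing diameters. Costs have to be
    positive, so the i-th is raised by 2^-(i+1); this adds 1 in total, whence the bound M + 1. *)
Lemma infinite_measure (f : R -> R) (S : set R) (B : set (R * R)) :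
  (forall Gam, 0 < Gam -> exists2 d0 : R, 0 < d0 &
    forall (V : nat -> R -> Prop) (dd a : nat -> R),
    (forall i, 0 <= dd i) ->
    (forall i x y, V i x -> V i y -> `|x - y| <= dd i) ->
    (forall i, dd i <= d0) ->
    (forall i, 0 < a i) -> (forall i, 0 < dd i -> h (dd i) <= a i) ->
    (forall x, S x -> exists i, V i x) ->
    (Gam%:E <= \sum_(0 <= i <oo) (a i)%:E)%E) ->
  (forall x, S x -> B (x, f x)) -> hausdorff_measure dist2 h B = +oo%E.
Proof.
move=> H SB; apply/eqyP => M M0.
have G0 : 0 < M + 1 by rewrite addr_gt0.
have [d0 d00 Hd] := H _ G0.
apply: le_ereal_sup_tmp; exists (hausdorff_content dist2 h d0 B); first by exists d0.
apply: le_ereal_inf_tmp => _ [U [BU Ud] <-].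
have fd i := fine_diam dist2_ge0 (ltW d00) (Ud i).
pose dd i := fine (diam dist2 (U i)).
pose a i := gauge h (dd i) + 1 / (2 ^ i.+1)%:R.
have g0 i : 0 <= gauge h (dd i) by apply: gauge_ge0; exact: dim_pos.
have e0 i : 0 < 1 / (2 ^ i.+1)%:R :> R by rewrite divr_gt0// ltr0n expn_gt0.
have := Hd (fun i x => U i (x, f x)) dd a.
have -> : (\sum_(0 <= i <oo) (a i)%:E = \sum_(0 <= i <oo)
   ((gauge h (dd i))%:E + (1 / (2 ^ i.+1)%:R)%:E))%E.
  by apply: eq_eseriesr => i _; rewrite -EFinD.
move=> K.
have {K} : ((M + 1)%:E <= \sum_(0 <= i <oo)
   ((gauge h (dd i))%:E + (1 / (2 ^ i.+1)%:R)%:E))%E.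
  apply: K.
  - by move=> i; have [] := fd i.
  - move=> i x y Ux Uy; have [_ _ d1] := fd i.
    exact: le_trans (dist2_ge1 (x, f x) (y, f y)) (d1 _ _ Ux Uy).
  - by move=> i; have [] := fd i.
  - by move=> i; rewrite ltr_wpDl.
  - by move=> i di; rewrite /a /gauge di lerDl ltW.
  - by move=> x /SB /BU[i _ Ui]; exists i.
have gE i : (0 <= (gauge h (dd i))%:E)%E by rewrite lee_fin.
move=> /le_trans /(_ (epsilon_trick xpredT gE ler01)).
by rewrite EFinD leeD2rE.
Qed.

End Gauge.
End Transfer.

(** * From arcs to the whole curve *)

Section KhintchineCurve.
Context {R : realType} (psi1 psi2 : nat -> R) (theta : R * R) (I : set R) (f h : R -> R).
Context (psi1_null : decr_null psi1) (psi2_null : decr_null psi2)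
  (eta : R) (eta_lt1 : eta < 1)
  (psi_max : forall q : nat, (0 < q)%N ->
    q%:R `^ (- eta) <= Num.max (psi1 q) (psi2 q))
  (I_itv : is_interval I) (I_nondegenerate : exists a b : R, [/\ I a, I b & a < b])
  (f_C3 : class_C 3 I f)
  (h_pos : forall r, 0 < r -> 0 < h r)
  (h_mono : forall r s, 0 < r -> r <= s -> h r <= h s)
  (h_dec : forall r s, 0 < r -> r <= s -> h s * r <= h r * s)
  (h_inf : forall M, exists2 r0, 0 < r0 & forall r, 0 < r -> r <= r0 -> M * r <= h r)
  (f''_null : hausdorff_measure dist1 h
     [set x | I x /\ derive_in_n I 2 f x = 0] = 0%E).

Let f1 := derive_in_n I 1 f.
Let f2 := derive_in_n I 2 f.
Let nu q := Num.max (psi1 q) (psi2 q).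
Let mu q := Num.min (psi1 q) (psi2 q).

Definition well_approx x := forall n, exists2 q, (n <= q)%N &
  approx1 psi1 theta.1 q x /\ approx1 psi2 theta.2 q (f x).

Let rbox (p : rat * rat) (x : R) := ratr p.1 <= x <= ratr p.2.

(** Over countably many boxes, points with f'' = 0 lie on Lipschitz graphs over a null set; points
    with f' = 0 on a curved arc number at most one per box, as f' is injective there; other interior
    points lie on sloped arcs. [P4] and [P5] take care of the end points of [I]. *)
Lemma curve_null :
  (forall e, 0 < e -> exists t1, forall T,
    \sum_(t1 <= t < T) 4 ^+ t * nu (2 ^ t) * h (mu (2 ^ t) / 2 ^+ t) <= e) ->
  hausdorff_measure dist2 h [set (x, f x) | x in [set x | I x /\ well_approx x]] = 0%E.
Proof.
move=> conv.
pose G (P : R -> Prop) : set (R * R) := [set (x, f x) | x in [set x | P x]].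
have sub1 P : (forall x y, P x -> P y -> x = y) -> hausdorff_measure dist2 h (G P) = 0%E.
  move=> P1; apply: (null_subsingleton h_pos h_mono dist2_ge0 dist2xx).
  by move=> _ _ [x Px <-] [y Py <-]; rewrite (P1 x y).
pose P1 p x := [/\ rbox p x, I x /\ f2 x = 0 & exists2 K, 0 <= K & forall u v,
    rbox p u -> rbox p v -> `|f u - f v| <= K * `|u - v|].
pose P2 p x := [/\ rbox p x, f1 x = 0 & exists K, curved_arc I f (ratr p.1) (ratr p.2) K].
pose P3 p x := [/\ rbox p x, well_approx x &
    exists K, sloped_arc I f (ratr p.1) (ratr p.2) K].
pose P4 x := I x /\ forall y, I y -> x <= y.
pose P5 x := I x /\ forall y, I y -> y <= x.
have N1 p : hausdorff_measure dist2 h (G (P1 p)) = 0%E.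
  have [[K K0 HK]|no] := pselect (exists2 K, 0 <= K & forall u v,
    rbox p u -> rbox p v -> `|f u - f v| <= K * `|u - v|); last first.
    by apply: sub1 => x y [_ _ /no].
  apply: (null_graph h_pos h_mono h_dec K0).
    by move=> x y [xp _ _] [yp _ _]; exact: HK.
  apply: (null_subset h_pos h_mono dist1_ge0 _ f''_null).
  by move=> x [_ [Ix fx] _].
have N2 p : hausdorff_measure dist2 h (G (P2 p)) = 0%E.
  apply: sub1 => x y [xp fx [K arc]] [yp fy _].
  by apply: (curved_arc_injective arc) => //; rewrite -/f1 fx fy.
have N3 p : hausdorff_measure dist2 h (G (P3 p)) = 0%E.
  have [[K arc]|no] := pselect (exists K, sloped_arc I f (ratr p.1) (ratr p.2) K); last first.
    by apply: sub1 => x y [_ _ /no].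
  have [[albe K1 _ tay _] _] := arc.
  have [bil slope] := sloped_arc_bilipschitz f_C3 arc.
  have sys := csys_primal albe K1 tay.
  have slope2 x : ratr p.1 <= x <= ratr p.2 -> `|f1 x| <= K by move=> /slope[].
  have := @convergence_arc R h h_pos h_mono h_dec f f1 _ _ K psi1 psi2 theta.1 theta.2 eta
    sys bil slope2 psi1_null psi2_null eta_lt1 psi_max conv.
  apply: (null_subset h_pos h_mono dist2_ge0) => _ [x [xp wx _] <-].
  by exists x.
have N4 : hausdorff_measure dist2 h (G P4) = 0%E.
  by apply: sub1 => x y [Ix x1] [Iy y1]; apply/eqP; rewrite eq_le x1// y1.
have N5 : hausdorff_measure dist2 h (G P5) = 0%E.
  by apply: sub1 => x y [Ix x1] [Iy y1]; apply/eqP; rewrite eq_le x1// y1.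
have cup := null_bigcup h_pos h_mono dist2_ge0.
have U := @null_setU R h h_pos h_mono _ _ dist2_ge0.
have all := U _ _ (U _ _ (U _ _ (cup _ _ N1) (cup _ _ N2)) (cup _ _ N3)) (U _ _ N4 N5).
apply: (null_subset h_pos h_mono dist2_ge0 _ all) => _ [x [Ix wx] <-].
have [x4|n4] := pselect (P4 x); first by right; left; exists x.
have [x5|n5] := pselect (P5 x); first by right; right; exists x.
left.
have [y Iy yx] : exists2 y, I y & y < x.
  apply: contrapT => H; apply: n4; split => // y Iy; rewrite leNgt; apply/negP => yx.
  by apply: H; exists y.
have [z Iz xz] : exists2 z, I z & x < z.
  apply: contrapT => H; apply: n5; split => // z Iz; rewrite leNgt; apply/negP => xz.
  by apply: H; exists z.
have yxz : y < x < z by rewrite yx xz.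
have nI := interior_point I_itv Iy Iz yxz.
have box (p : rat * rat) : ratr p.1 < x < ratr p.2 -> rbox p x.
  by move=> /andP[p1 p2]; rewrite /rbox !ltW.
have [f20|f20] := eqVneq (f2 x) 0.
  have [p [px Hp]] := lipschitz_near f_C3 nI.
  by left; left; exists p => //; exists x => //; split => //; exact: box.
have [f10|f10] := eqVneq (f1 x) 0.
  have [p [px Hp]] := curved_arc_near f_C3 nI f20.
  by left; right; exists p => //; exists x => //; split => //; exact: box.
have [p [px Hp]] := sloped_arc_near f_C3 nI f10 f20.
by right; exists p => //; exists x => //; split => //; exact: box.
Qed.

(** If f'' vanished on an inner interval, that interval would be null, against [interval_not_null].
    On the curved arc so obtained f' is injective, hence nonzero at one of any two points. *)
Lemma exists_sloped_arc : exists al be K, sloped_arc I f al be K.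
Proof.
have [a [b [Ia Ib ab]]] := I_nondegenerate.
(* The middle third of [a, b] consists of interior points of [I]. *)
pose c := (2 * a + b) / 3; pose d := (a + 2 * b) / 3.
have nI x : c <= x <= d -> nbhs x I.
  move=> /andP[cx xd]; apply: (interior_point I_itv Ia Ib).
  by apply/andP; split; move: cx xd; rewrite /c /d; lra.
have cd : c < d by rewrite /c /d; lra.
have lin : exists2 r0, 0 < r0 & forall r, 0 < r -> r <= r0 -> r <= h r.
  by have [r0 r00 Hr] := h_inf 1; exists r0 => // r rp rr; rewrite -[leLHS]mul1r; exact: Hr.
have [x xcd f2x] : exists2 x, c <= x <= d & f2 x != 0.
  apply: contrapT => H; have := interval_not_null h_pos cd lin.
  rewrite (null_subset h_pos h_mono dist1_ge0 _ f''_null) ?eqxx// => x xcd.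
  split; first exact: nbhs_singleton (nI x xcd).
  by apply/eqP; apply/negPn/negP => f2x; apply: H; exists x.
have [p [px [K arc]]] := curved_arc_near f_C3 (nI x xcd) f2x.
have /andP[p1 p2] := px.
have xp : rbox p x by rewrite /rbox !ltW.
have yp : rbox p (ratr p.2) by rewrite /rbox lexx andbT ltW// (lt_trans p1).
have [albe K1 nIp _ f2p] := arc.
have [z zp f1z] : exists2 z, rbox p z & f1 z != 0.
  have [fx|fx] := eqVneq (f1 x) 0; last by exists x.
  have [fy|fy] := eqVneq (f1 (ratr p.2)) 0; last by exists (ratr p.2).
  have := curved_arc_injective arc xp yp; rewrite -/f1 fx fy => /(_ erefl) E.
  by move: p2; rewrite E ltxx.
have f2z : f2 z != 0.
  rewrite -normr_gt0; apply: lt_le_trans (f2p z zp).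
  by rewrite invr_gt0; lra.
have [s [_ [L arcL]]] := sloped_arc_near f_C3 (nIp z zp) f1z f2z.
by exists (ratr s.1), (ratr s.2), L.
Qed.

(** The coordinate with the smaller function may vary with the level, but one of the two classes of
    levels alone carries a divergent sum, and this fixes the choice of parameter. *)
Lemma curve_infinite (h_dim : dimension_function h) : regular_function h ->
  (forall M, exists n, M <= \sum_(0 <= t < n)
    4 ^+ t * nu (2 ^ t.+1) * h (mu (2 ^ t.+1) / 2 ^+ t)) ->
  hausdorff_measure dist2 h [set (x, f x) | x in [set x | I x /\ well_approx x]] = +oo%E.
Proof.
move=> reg div.
have [al [be [K arc]]] := exists_sloped_arc.
have [[albe K1 nI tay _] _] := arc.
have [bil slope] := sloped_arc_bilipschitz f_C3 arc.
have K0 : 0 < K by lra.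
have K3 : K <= K ^+ 3 by rewrite -{1}(expr1 K) ler_weXn2l.
have ivt := sloped_arc_ivt f_C3 arc.
apply: (@infinite_measure R h h_dim f (fun x => al <= x <= be /\ well_approx x)); last first.
  move=> x [xab wx]; exists x => //; split => //.
  exact: nbhs_singleton (nI x xab).
have hz := dim_zero h_dim.
pose T t := psi1 (2 ^ t.+1)%N <= psi2 (2 ^ t.+1)%N.
have [div1|div2] := unbounded_split T div; move=> Gam Gam0.
  have lip x y : al <= x <= be -> al <= y <= be -> `|f x - f y| <= K * `|x - y|.
    by move=> xab yab; have [] := bil x y xab yab.
  have ivt1 x r y : 0 < r -> al <= x - r -> x + r <= be -> K * `|y - x| <= r ->
      exists2 xi : R, `|xi - x| <= r & xi = y.
    by move=> _ _ _ Ky; exists y => //; apply: le_trans Ky; rewrite ler_peMl.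
  have div1' M : exists n, M <= \sum_(0 <= t < n | T t) 4 ^+ t *
     Num.max (psi1 (2 ^ t.+1)%N) (psi2 (2 ^ t.+1)%N) * h (psi1 (2 ^ t.+1)%N / 2 ^+ t).
    have [n Hn] := div1 M; exists n; apply: (le_trans Hn).
    by apply: ler_sum => t Tt; rewrite /mu (min_idPl Tt).
  have [d0 d00 Hd] := divergence_arc h_pos h_mono h_dec h_inf hz (F := id) theta.1 theta.2 reg
    (csys_primal albe K1 tay) lip ivt1 psi1_null psi2_null eta_lt1 psi_max
    (fun t (Tt : T t) => Tt) div1' Gam0.
  exists d0 => // V dd a v1 v2 v3 v4 v5 cov; apply: (Hd V dd a) => // x xab wx.
  by apply: cov; split.
have lip x y : al <= x <= be -> al <= y <= be -> `|x - y| <= K ^+ 3 * `|x - y|.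
  by move=> _ _; rewrite ler_peMl//; exact: le_trans K1 K3.
have ivt2 x r y : 0 < r -> al <= x - r -> x + r <= be -> K ^+ 3 * `|y - f x| <= r ->
    exists2 xi : R, `|xi - x| <= r & f xi = y.
  by move=> r0 xr rx Ky; apply: ivt => //; apply: le_trans Ky; rewrite ler_wpM2r.
have TF t : ~~ T t -> psi2 (2 ^ t.+1)%N <= psi1 (2 ^ t.+1)%N.
  by rewrite /T -ltNge => /ltW.
have max2 q : (0 < q)%N -> q%:R `^ (- eta) <= Num.max (psi2 q) (psi1 q).
  by move=> q0; rewrite maxC; exact: psi_max.
have div2' M : exists n, M <= \sum_(0 <= t < n | ~~ T t) 4 ^+ t *
   Num.max (psi2 (2 ^ t.+1)%N) (psi1 (2 ^ t.+1)%N) * h (psi2 (2 ^ t.+1)%N / 2 ^+ t).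
  have [n Hn] := div2 M; exists n; apply: (le_trans Hn).
  by apply: ler_sum => t /TF Tt; rewrite /mu /nu maxC (min_idPr Tt).
have [d0 d00 Hd] := divergence_arc h_pos h_mono h_dec h_inf hz (G := id) theta.2 theta.1 reg
  (csys_swapped albe K1 tay bil slope) lip ivt2 psi2_null psi1_null eta_lt1 max2 TF div2' Gam0.
exists d0 => // V dd a v1 v2 v3 v4 v5 cov; apply: (Hd V dd a) => // x xab wx.
apply: cov; split => // n; have [q nq [a1 a2]] := wx n; by exists q.
Qed.

End KhintchineCurve.

Theorem theorem1 (R : realType) (psi1 psi2 : nat -> R) (theta : R * R)
    (I : set R) (f h : R -> R)
    (psi1_approx : approximating_function psi1)
    (psi2_approx : approximating_function psi2)
    (psi_max : exists2 eta : R, eta < 1 &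
       forall q : nat, (0 < q)%N ->
         q%:R `^ (- eta) <= Num.max (psi1 q) (psi2 q))
    (I_itv : is_interval I)
    (I_nondegenerate : exists a b : R, [/\ I a, I b & a < b])
    (f_C3 : class_C 3 I f)
    (h_dim : dimension_function h)
    (h_reg : regular_function h)
    (h_infty : r^-1 * h r @[r --> 0^'+] --> +oo)
    (h_decr : forall r s : R, 0 < r -> r <= s -> s^-1 * h s <= r^-1 * h r)
    (f''_null : hausdorff_measure dist1 h
       [set x | I x /\ derive_in_n I 2 f x = 0] = 0%E) :
  ((volume_sum psi1 psi2 h < +oo)%E ->
     hausdorff_measure dist2 h
       (curve I f `&` simul_approx psi1 psi2 theta) = 0%E) /\
  (volume_sum psi1 psi2 h = +oo%E ->
     hausdorff_measure dist2 h
       (curve I f `&` simul_approx psi1 psi2 theta) = +oo%E).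
Proof.
have h_pos := dim_pos h_dim; have h_mono := dim_mono h_dim.
have h_dec := dim_dec h_decr; have h_inf := dim_inf h_infty.
have n1 := approximating_decr_null psi1_approx.
have n2 := approximating_decr_null psi2_approx.
have [mx0 mxd _] := decr_null_max n1 n2; have [mn0 mnd _] := decr_null_min n1 n2.
have [eta eta1 Heta] := psi_max.
have -> : curve I f `&` simul_approx psi1 psi2 theta =
    [set (x, f x) | x in [set x | I x /\ well_approx psi1 psi2 theta f x]].
  apply/seteqP; split=> [_ [[x Ix <-] /simul_approxP wx]|_ [x [Ix wx] <-]].
    by exists x.
  by split; [exists x|apply/simul_approxP].
have vol0 q : (0 < q)%N -> 0 <= q%:R * h (Num.min (psi1 q) (psi2 q) / q%:R) *
    Num.max (psi1 q) (psi2 q).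
  move=> q0; rewrite !mulr_ge0 ?(ltW (mx0 q q0))// ltW// h_pos// divr_gt0 ?mn0//.
  by rewrite ltr0n.
split=> [fin|inf].
  have [B HB] := volume_sum_bounded vol0 fin.
  have conv := volume_dyadic_tail h_pos h_mono mn0 mx0 mnd mxd HB.
  exact: (curve_null theta n1 n2 eta1 Heta I_itv f_C3 h_pos h_mono h_dec f''_null conv).
have div := volume_dyadic_unbounded h_pos h_mono mn0 mx0 mnd mxd
  (volume_sum_unbounded vol0 inf).
exact: (curve_infinite theta n1 n2 eta1 Heta I_itv I_nondegenerate f_C3 h_pos h_mono h_dec
  h_inf f''_null h_dim h_reg div).
Qed.
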